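(* There exists a Theta--network $\Gamma_0$ such that $$F(\Gamma_0)=\inf\{F(\Gamma)\mid \Gamma \text{ is a Theta--network}\},$$ i.e. the infimum of $F$ over the class of Theta--networks is attained.
   Context: A planar curve is given by a parametrization $\gamma:[0,1]\to\mathbb{R}^2$; it is regular if (it is at least $C^1$ and) $|\partial_x\gamma(x)|\neq 0$ for all $x\in[0,1]$. For a regular curve, $\partial_s=\frac{\partial_x}{|\partial_x\gamma|}$, $\mathrm{d}s=|\partial_x\gamma|\,\mathrm{d}x$, $\tau=\partial_s\gamma$ is the unit tangent, $\nu$ is the counterclockwise rotation of $\tau$ by $\pi/2$, and the scalar curvature $k$ is defined by $\partial_s^2\gamma=k\nu$ (a.e. for $H^2$ curves). A Theta--network $\Gamma=\{\gamma^1,\gamma^2,\gamma^3\}$ consists of three regular curves $\gamma^i:[0,1]\to\mathbb{R}^2$ of class $H^2$ that meet at two triple junctions $P^1=\gamma^1(0)=\gamma^2(0)=\gamma^3(0)$ and $P^2=\gamma^1(1)=\gamma^2(1)=\gamma^3(1)$, forming angles of $120$ degrees at both junctions: $\tau^1(0)+\tau^2(0)+\tau^3(0)=0$ and $\tau^1(1)+\tau^2(1)+\tau^3(1)=0$. The curves may intersect each other and may have self-intersections. The penalized elastic energy is $F(\Gamma)=\sum_{i=1}^3\int_{\gamma^i}\big((k^i)^2+1\big)\,\mathrm{d}s^i$. *)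

(* Defs.v *)
From HB Require Import structures.
From mathcomp Require Import all_boot all_order all_algebra.
From mathcomp Require Import all_classical all_reals all_analysis.

Set Implicit Arguments.
Unset Strict Implicit.
Unset Printing Implicit Defensive.
Import Order.TTheory GRing.Theory Num.Theory.
Import numFieldNormedType.Exports.
Local Open Scope classical_set_scope.
Local Open Scope ring_scope.

(* A map [0,1] -> R^2 is represented by a total function R -> 'rV[R]_2 of
   which only the values on [0,1] are ever used. *)

Section Plane.
Context {R : realType}.
Implicit Types (v : 'rV[R]_2) (g : R -> 'rV[R]_2) (x : R).

(* The norm that the library puts on 'rV[R]_2 is the sup norm. *)
Definition enorm v : R := Num.sqrt (v 0 0 ^+ 2 + v 0 1 ^+ 2).

Definition rot90 v : 'rV[R]_2 := \row_j (if j == 0 then - v 0 1 else v 0 0).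

(* Difference quotients are taken within [0,1]: the derivative is two-sided
   in ]0,1[ and one-sided at the end points.  Where it does not exist, dx g x
   is an unspecified vector. *)
Definition diffq g x : R -> 'rV[R]_2 := fun y => (y - x)^-1 *: (g y - g x).

Definition derivable_at g x : Prop :=
  cvg (diffq g x y @[y --> within `[0, 1] x^']).

Definition dx g x : 'rV[R]_2 :=
  lim (diffq g x y @[y --> within `[0, 1] x^']).

Definition C1 g : Prop :=
  (forall x, x \in `[0, 1] -> derivable_at g x) /\
  {within `[0, 1], continuous (dx g)}.

Definition regular g : Prop :=
  C1 g /\ forall x, x \in `[0, 1] -> enorm (dx g x) != 0.

Definition ds g (f : R -> 'rV[R]_2) x : 'rV[R]_2 :=
  (enorm (dx g x))^-1 *: dx f x.

Definition tau g : R -> 'rV[R]_2 := ds g g.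

Definition nu g x : 'rV[R]_2 := rot90 (tau g x).

(* The k such that the second arc-length derivative of g is k nu.  For a
   regular H^2 curve it exists at almost every x in [0,1], and is unique since
   nu <> 0; elsewhere the value is unspecified. *)
Definition curvature g x : R := get [set k : R | ds g (tau g) x = k *: nu g x].

(* Sobolev spaces on ]0,1[, with weak derivatives tested against the functions
   of class C^1_c(]0,1[). *)
Definition test_function (phi : R -> R) : Prop :=
  [/\ forall x, derivable phi x 1,
      continuous (derive1 phi)
    & closure [set x | phi x != 0] `<=` `]0, 1[ ].

Definition L2 (u : R -> R) : Prop :=
  measurable_fun (`]0, 1[%classic : set R) u /\
  (\int[lebesgue_measure]_(x in `]0%R, 1%R[) (u x ^+ 2)%:E < +oo)%E.

Definition weak_derivative (u u' : R -> R) : Prop :=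
  forall phi, test_function phi ->
    \int[lebesgue_measure]_(x in `]0, 1[) (u x * derive1 phi x) =
    - \int[lebesgue_measure]_(x in `]0, 1[) (u' x * phi x).

Definition Sobolev_H2 (u : R -> R) : Prop :=
  exists u1 u2 : R -> R,
    [/\ L2 u, L2 u1, L2 u2, weak_derivative u u1 & weak_derivative u1 u2].

Definition H2 g : Prop := forall j, Sobolev_H2 (fun x => g x 0 j).

Definition theta_network (G : 'I_3 -> R -> 'rV[R]_2) : Prop :=
  [/\ forall i, regular (G i) /\ H2 (G i),
      exists P1 : 'rV[R]_2, forall i, G i 0 = P1,
      exists P2 : 'rV[R]_2, forall i, G i 1 = P2,
      \sum_(i < 3) tau (G i) 0 = 0
    & \sum_(i < 3) tau (G i) 1 = 0].

Definition int_ds g (f : R -> R) : \bar R :=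
  (\int[lebesgue_measure]_(x in `[0%R, 1%R]) (f x * enorm (dx g x))%:E)%E.

Definition penalized_energy (G : 'I_3 -> R -> 'rV[R]_2) : \bar R :=
  (\sum_(i < 3) int_ds (G i) (fun x => (curvature (G i) x ^+ 2 + 1)%R))%E.

End Plane.

(* Main.v *)
(* Reparametrized at constant speed, a curve is encoded by its length L, its unit
   tangent, its position divided by L, and the function
   V(t) = int_0^t |T'|^2; its energy is L + V(1) / L.  The inequality
   |T(b) - T(a)|^2 <= (b - a) (V(b) - V(a)) and the other conditions put on such
   data pass to pointwise limits, so the limit of a minimizing sequence along a
   free ultrafilter is again a (possibly degenerate) network.  If it is
   nondegenerate it is realized by H^2 curves: T has an L^2 derivative, obtained
   by Radon-Nikodym from limits of difference quotients and bounded by Fatou.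
   Two curves cannot both shrink, because of the 120 degree condition.  If one
   curve shrinks to a point, its tangent is constant and the other two become
   loops, each of energy at least 4 sqrt 6 by a calibration; but the standard
   double bubble has energy 16 pi / 3 + sqrt 3 < 8 sqrt 6. *)

Require Import Defs.
From HB Require Import structures.
From mathcomp Require Import all_boot all_order all_algebra.
From mathcomp Require Import all_classical all_reals all_analysis.
From mathcomp Require Import measurable_realfun.
From mathcomp Require Import ring lra.

Set Implicit Arguments.
Unset Strict Implicit.
Unset Printing Implicit Defensive.
Import Order.TTheory GRing.Theory Num.Theory.
Import numFieldNormedType.Exports.
Local Open Scope classical_set_scope.
Local Open Scope ring_scope.

(** * Absolutely continuous functions on [0,1] *)

Section LocalToGlobal.
Variable R : realType.
Implicit Types (f g m w : R -> R) (a b x y e d : R).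

(** Every condition on the data is an equation or a non-strict inequality between finitely many
    values, so pointwise limits preserve it without any equicontinuity argument or subsequence; weak
    derivatives reappear only when the limit is turned back into curves. The scaling is the delicate
    point. Dividing the position by L keeps the direction of a shrinking curve visible, and V, taken
    in the rescaled parameter, is L times the integral of k^2 ds: it tends to 0 with L when the
    energy is bounded, which is why a vanishing curve has a constant tangent. The calibration rests
    on L (1 + cos a) + a'^2 / L >= 2 sqrt(1 + cos a) |a'|, where a is the angle from a unit vector e
    to T; since |T - e| = 2 |sin(a/2)|, the right side is sqrt 8 times the speed at which |T - e|
    varies. On a closed curve cos a integrates to 0, so the energy is at least sqrt 8 times the
    total variation of |T - e|, and 4 sqrt 6 = sqrt 8 times 2 sqrt 3. Numerically, 8 sqrt 6 is about
    19.60 and the double bubble has energy about 18.49, a gap that tolerates crude estimates of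
    pi. *)

Definition in01 x := (0 <= x) && (x <= 1).

Definition unif_cont01 f := forall e, 0 < e -> exists2 d : R, 0 < d &
  forall x y, in01 x -> in01 y -> `|x - y| < d -> `|f x - f y| <= e.

Definition nondecr01 f :=
  forall x y, 0 <= x -> x <= y -> y <= 1 -> f x <= f y.

Lemma exists_uniform_step d : 0 < d -> exists n : nat, n.+1%:R^-1 < d.
Proof.
move=> d0; exists (Num.truncn d^-1).
have n0 : (0 : R) < (Num.truncn d^-1).+1%:R by rewrite ltr0n.
by rewrite invf_plt ?posrE// Num.Theory.truncnS_gt.
Qed.

(* Summing the hypothesis over a fine uniform partition; the errors telescope
   to a small multiple of the total variation of m. *)
Lemma local_to_global g m : nondecr01 m ->
  (forall e, 0 < e -> exists2 d : R, 0 < d &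
     forall x y, 0 <= x -> x <= y -> y <= 1 -> y - x < d ->
       - (e * (m y - m x)) <= g y - g x) ->
  nondecr01 g.
Proof.
move=> mm H a b a0 ab b1.
have ab' e : 0 < e -> - (e * (m b - m a)) <= g b - g a.
  move=> e0; have [d d0 Hd] := H e e0.
  have [n nd] := exists_uniform_step d0.
  pose p k : R := a + k%:R * ((b - a) / n.+1%:R).
  have n0 : (0 : R) < n.+1%:R by rewrite ltr0n.
  have s0 : 0 <= (b - a) / n.+1%:R by rewrite divr_ge0 ?subr_ge0// ltW.
  have pS k : p k.+1 = p k + (b - a) / n.+1%:R.
    by rewrite /p -natr1; ring.
  have pn : p n.+1 = b by rewrite /p mulrC divfK ?gt_eqF//; ring.
  have ap k : a <= p k by rewrite /p lerDl mulr_ge0.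
  have pb k : (k <= n.+1)%N -> p k <= b.
    move=> kn; rewrite -pn /p lerD2l ler_wpM2r// ler_nat//.
  have K : forall k, (k <= n.+1)%N -> - (e * (m (p k) - m a)) <= g (p k) - g a.
    elim=> [|k IH] kn; first by rewrite /p mul0r addr0 !subrr mulr0 oppr0.
    have := IH (ltnW kn).
    have : - (e * (m (p k.+1) - m (p k))) <= g (p k.+1) - g (p k).
      apply: Hd.
      - exact: le_trans (ap k).
      - by rewrite pS lerDl.
      - exact: le_trans (pb _ kn) _.
      - rewrite pS addrAC subrr add0r (le_lt_trans _ nd)//.
        rewrite ler_piMl ?invr_ge0 ?ler0n//; lra.
    by lra.
  by have := K n.+1 (leqnn _); rewrite pn.
have [mab|mab] := ltP (m a) (m b); last first.
  have := ab' 1 ltr01; have := mm _ _ a0 ab b1; lra.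
rewrite -subr_ge0; apply/ler_addgt0Pr => e e0.
have M0 : 0 < m b - m a by rewrite subr_gt0.
have := ab' (e / (m b - m a)) (divr_gt0 e0 M0).
by rewrite divfK ?gt_eqF//; lra.
Qed.

(** The two-sided error makes both [g] and [- g] nondecreasing. *)
Lemma local_to_global_eq g m : nondecr01 m ->
  (forall e, 0 < e -> exists2 d : R, 0 < d &
     forall x y, 0 <= x -> x <= y -> y <= 1 -> y - x < d ->
       `|g y - g x| <= e * (m y - m x)) ->
  forall x, in01 x -> g x = g 0.
Proof.
move=> mm H x /andP[x0 x1].
have A : nondecr01 g.
  apply: (local_to_global mm) => e e0; have [d d0 Hd] := H e e0.
  exists d => // u v u0 uv v1 uvd; have := Hd u v u0 uv v1 uvd.
  by rewrite ler_norml => /andP[].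
have B : nondecr01 (\- g).
  apply: (local_to_global mm) => e e0; have [d d0 Hd] := H e e0.
  exists d => // u v u0 uv v1 uvd; have := Hd u v u0 uv v1 uvd.
  rewrite ler_norml => /andP[_] /=; lra.
have := A 0 x (lexx _) x0 x1; have := B 0 x (lexx _) x0 x1; rewrite /=; lra.
Qed.

Lemma sub_dom a b : 0 <= a -> b <= 1 -> `[a, b] `<=` `[(0 : R), 1].
Proof.
move=> a0 b1 x /=; rewrite !in_itv /= => /andP[ax xb].
by rewrite (le_trans a0)//= (le_trans xb).
Qed.

(** Heine's theorem. Compactness is used in its near-covering form, with the filter of small
    positive [d]: continuity at [x] gives a radius, of which one half is spent on moving [x] and the
    other on the distance to [y]. *)
Lemma heine01 f : {within `[0, 1], continuous f} -> unif_cont01 f.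
Proof.
move=> cf e e0.
have e20 : 0 < e / 2 by rewrite divr_gt0.
have cc := @segment_compact R 0 1.
move/compact_near_coveringP/near_covering_withinP : cc.
pose P (d x : R) := forall y, in01 y -> `|x - y| < d -> `|f x - f y| <= e.
move=> /(_ _ (0:R)^'+ P) -[].
- move=> x xin; move/subspace_continuousP: cf => /(_ x xin)/cvgrPdist_lt/(_ _ e20).
  rewrite near_withinE => -[d /= d0 Hd].
  have d20 : 0 < d / 2 by rewrite divr_gt0.
  exists (ball x (d / 2), [set i | 0 < i < d / 2]) => /=.
    split; first exact: nbhsx_ballx.
    by near=> i; apply/andP; split; near: i;
      [exact: nbhs_right_gt|exact: nbhs_right_lt].
  move=> [x' i] /= [xx' /andP[i0 id]] x'in y yin x'y.
  rewrite (_ : f x' - f y = (f x - f y) - (f x - f x')); last by ring.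
  rewrite (le_trans (ler_normB _ _))// (splitr e) lerD//; apply/ltW/Hd => //=.
  + rewrite (_ : x - y = (x - x') + (x' - y)); last by ring.
    rewrite (le_lt_trans (ler_normD _ _))// (splitr d) ltrD//.
    exact: lt_trans id.
  + by move: xx'; rewrite /ball /= => /lt_trans; apply; lra.
- move=> d /= d0 H; exists (d / 2); first by rewrite divr_gt0.
  move=> x y xin yin xy; apply: (H (d / 2)) => //=; last by rewrite divr_gt0.
  rewrite sub0r normrN gtr0_norm ?divr_gt0//; lra.
Unshelve. all: by end_near. Qed.

Local Notation mu := (@lebesgue_measure R).

Definition integrable01 w := mu.-integrable `[0, 1] (EFin \o w).

(** Absolute continuity of [f] on [0,1] in integral form; the density [w] matters only up to null
    sets. *)
Definition primitive01 f w := integrable01 w /\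
  forall a b, 0 <= a -> a <= b -> b <= 1 ->
    f b - f a = \int[mu]_(x in `[a, b]) w x.

Lemma integrable01S w a b : integrable01 w -> 0 <= a -> b <= 1 ->
  mu.-integrable `[a, b] (EFin \o w).
Proof. by move=> iw a0 b1; apply: integrableS iw => //; exact: sub_dom. Qed.

Lemma Rintegral_split w a b c : integrable01 w ->
  0 <= a -> a <= b -> b <= c -> c <= 1 ->
  \int[mu]_(x in `[a, c]) w x =
  \int[mu]_(x in `[a, b]) w x + \int[mu]_(x in `[b, c]) w x.
Proof.
move=> iw a0 ab bc c1; apply/eqP; rewrite addrC -subr_eq; apply/eqP.
have iac := integrable01S iw a0 c1.
rewrite Rintegral_itvB ?bnd_simp//.
apply: Rintegral_itv_obnd_cbnd.
by apply: integrableS iac => //; apply: subset_itvScc; rewrite bnd_simp.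
Qed.

Lemma primitive01_Rintegral w : integrable01 w ->
  primitive01 (fun x => \int[mu]_(t in `[0, x]) w t) w.
Proof.
by move=> iw; split=> // a b a0 ab b1; rewrite (@Rintegral_split w 0 a b)//; lra.
Qed.

Lemma primitive01_continuous f w : primitive01 f w ->
  {within `[0, 1], continuous f}.
Proof.
move=> [iw fw].
have : {within `[0, 1], continuous (fun x => \int[mu]_(t in `[0, x]) w t)}.
  exact: parameterized_integral_continuous.
move=> c; apply: (@subspace_eq_continuous _ _ _ (fun x => f 0 + \int[mu]_(t in `[0, x]) w t)).
  move=> x; rewrite inE /= in_itv /= => /andP[x0 x1].
  by rewrite -fw// addrC subrK.
by move=> x; apply: cvgD; [exact: cvg_cst|exact: c].
Qed.

Lemma integrable01_norm w : integrable01 w -> integrable01 (fun x => `|w x|).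
Proof. exact: integrable_norm. Qed.

Lemma integrable01_cont f : {within `[0, 1], continuous f} -> integrable01 f.
Proof. by apply: continuous_compact_integrable; exact: segment_compact. Qed.

Lemma integrable01D w z : integrable01 w -> integrable01 z ->
  integrable01 (fun x => w x + z x).
Proof.
rewrite /integrable01 => iw iz.
by have := @integrableD _ _ _ _ _ _ _ _ iw iz; apply.
Qed.

Lemma integrable01Zl c w : integrable01 w -> integrable01 (fun x => c * w x).
Proof. by rewrite /integrable01 => iw; have := @integrableZl _ _ _ _ _ _ c _ iw; apply. Qed.

Lemma integrable01B w z : integrable01 w -> integrable01 z ->
  integrable01 (fun x => w x - z x).
Proof.
rewrite /integrable01 => iw iz.
by have := @integrableB _ _ _ _ _ _ _ _ iw iz; apply.
Qed.

Lemma cont01_measurable f : {within `[0, 1], continuous f} ->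
  measurable_fun (`[0, 1] : set R) f.
Proof. by move/integrable01_cont/measurable_int/measurable_EFinP. Qed.

Lemma cont01_bounded f : {within `[0, 1], continuous f} ->
  exists2 M, 0 < M & forall x, in01 x -> `|f x| <= M.
Proof.
move=> cf.
have cn : {within `[0, 1], continuous (fun x => `|f x|)}.
  by move=> x; apply: cvg_norm; exact: cf.
have [c cin Hc] := EVT_max (@ler01 R) cn.
exists (`|f c| + 1); first by rewrite ltr_wpDl.
by move=> x xin; rewrite (le_trans (Hc x _)) ?in_itv// lerDl.
Qed.

Lemma integrable01M_cont f w : {within `[0, 1], continuous f} ->
  integrable01 w -> integrable01 (fun x => f x * w x).
Proof.
move=> cf iw; have [M M0 HM] := cont01_bounded cf.
apply: (@integrableMr _ _ _ mu _ _ f (EFin \o w)) => //.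
  exact: cont01_measurable.
exists M; split; first exact: num_real.
move=> r Mr x; rewrite /= in_itv /= => xin.
by apply: le_trans (HM x xin) _; exact: ltW.
Qed.

Lemma le_Rintegral01 w z a b : integrable01 w -> integrable01 z ->
  0 <= a -> b <= 1 -> (forall x, a <= x <= b -> w x <= z x) ->
  \int[mu]_(x in `[a, b]) w x <= \int[mu]_(x in `[a, b]) z x.
Proof.
move=> iw iz a0 b1 H; by apply: le_Rintegral => //; exact: integrable01S.
Qed.

Lemma Rintegral_cst_itv c a b : a <= b -> \int[mu]_(x in `[a, b]) c = c * (b - a).
Proof.
move=> ab; rewrite Rintegral_cst//= lebesgue_measure_itv/= lte_fin.
by have [//|ba] := ltP a b; have -> : b = a by [lra]; rewrite subrr.
Qed.

Lemma primitive01_nondecr f w : primitive01 f w ->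
  (forall x, in01 x -> 0 <= w x) -> nondecr01 f.
Proof.
move=> [iw fw] w0 x y x0 xy y1; rewrite -subr_ge0 fw//.
apply: Rintegral_ge0 => t; rewrite /= in_itv /= => /andP[xt ty]; apply: w0.
by rewrite /in01; lra.
Qed.

(** Source of the product and chain rules below: the difference between [g] and the integral of [z]
    has increments negligible against those of the integral of [|u|], so [local_to_global_eq] makes
    it constant. No derivative at a point is taken. *)
Lemma primitive01_local g z u : integrable01 z -> integrable01 u ->
  (forall e, 0 < e -> exists2 d : R, 0 < d &
     forall x y, 0 <= x -> x <= y -> y <= 1 -> y - x < d ->
       `|g y - g x - \int[mu]_(t in `[x, y]) z t| <=
       e * \int[mu]_(t in `[x, y]) `|u t|) ->
  primitive01 g z.
Proof.
move=> iz iu H.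
have [_ Pz] := primitive01_Rintegral iz.
have Pu := primitive01_Rintegral (integrable01_norm iu).
have C : forall x, in01 x -> g x - \int[mu]_(t in `[0, x]) z t =
    g 0 - \int[mu]_(t in `[0, 0]) z t.
  apply: (local_to_global_eq (g := fun x => g x - \int[mu]_(t in `[0, x]) z t)
    (primitive01_nondecr Pu _)) => // e e0.
  have [d d0 Hd] := H e e0; exists d => // x y x0 xy y1 xyd.
  rewrite Pu.2//; apply: le_trans (Hd x y x0 xy y1 xyd).
  by rewrite -Pz// le_eqVlt; apply/orP; left; apply/eqP; congr `|_|; ring.
split=> // a b a0 ab b1; rewrite -Pz//.
have Ca := C a; have Cb := C b.
have := Ca; have := Cb; rewrite /in01 => /(_ ltac:(lra)) + /(_ ltac:(lra)); lra.
Qed.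

End LocalToGlobal.

(** * Product, reciprocal and square root rules for absolutely continuous functions *)

Section AbsolutelyContinuousCalculus.
Variable R : realType.
Implicit Types (f g m w z : R -> R) (a b x y e d : R).
Local Notation mu := (@lebesgue_measure R).

Lemma Rintegral01_close p q u e x y :
  integrable01 p -> integrable01 q -> integrable01 u ->
  0 <= x -> y <= 1 ->
  (forall t, x <= t <= y -> `|p t - q t| <= e * u t) ->
  `|\int[mu]_(t in `[x, y]) p t - \int[mu]_(t in `[x, y]) q t| <=
  e * \int[mu]_(t in `[x, y]) u t.
Proof.
move=> ip iq iu x0 y1 H.
have ipq := integrable01B ip iq.
rewrite -RintegralB//; [|exact: integrable01S..].
apply: le_trans (le_normr_Rintegral _ _) _ => //; first exact: integrable01S.
rewrite -RintegralZl//; last exact: integrable01S.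
apply: le_Rintegral01 => //; last exact: integrable01Zl.
exact: integrable01_norm.
Qed.

(** A chain rule: when [g] is h composed with [f], the factor [K x y] is the difference quotient of
    h between [f x] and [f y], which is algebraic for the reciprocal and the square root, and [k] is
    h' along [f]. *)
Lemma primitive01_factor f w g (k : R -> R) (K : R -> R -> R) :
  primitive01 f w -> {within `[0, 1], continuous k} ->
  (forall x y, 0 <= x -> x <= y -> y <= 1 -> g y - g x = K x y * (f y - f x)) ->
  (forall e, 0 < e -> exists2 d : R, 0 < d & forall x y t, 0 <= x -> y <= 1 ->
     x <= t <= y -> y - x < d -> `|K x y - k t| <= e) ->
  primitive01 g (fun t => k t * w t).
Proof.
move=> fw ck gK HK; have iw := fw.1.
apply: (primitive01_local (u := w)) => //; first exact: integrable01M_cont.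
move=> e e0; have [d d0 Hd] := HK e e0.
exists d => // x y x0 xy y1 xyd.
rewrite gK// fw.2// -RintegralZl//; last exact: integrable01S.
apply: Rintegral01_close => //.
- exact: integrable01Zl.
- exact: integrable01M_cont.
- exact: integrable01_norm.
by move=> t xty; rewrite -mulrBl normrM ler_wpM2r// (Hd x y t).
Qed.

Lemma primitive01M f w g z : primitive01 f w -> primitive01 g z ->
  primitive01 (fun t => f t * g t) (fun t => g t * w t + f t * z t).
Proof.
move=> fw gz.
have cf := primitive01_continuous fw; have cg := primitive01_continuous gz.
have ii : integrable01 (fun t => g t * w t + f t * z t).
  by apply: integrable01D; apply: integrable01M_cont => //; [exact: fw.1|exact: gz.1].
have iu : integrable01 (fun t => `|w t| + `|z t|).
  by apply: integrable01D; apply: integrable01_norm; [exact: fw.1|exact: gz.1].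
apply: (primitive01_local (u := fun t => `|w t| + `|z t|)) => //.
move=> e e0.
have [df df0 Hf] := heine01 cf e0; have [dg dg0 Hg] := heine01 cg e0.
exists (Num.min df dg); first by rewrite lt_min df0.
move=> x y x0 xy y1; rewrite lt_min => /andP[xydf xydg].
(* Discrete product rule: with [g] frozen at [y] and [f] at [x] the increment is an exact integral,
   and only the freezing errors remain, controlled by uniform continuity. *)
have -> : f y * g y - f x * g x =
    \int[mu]_(t in `[x, y]) (g y * w t + f x * z t).
  rewrite RintegralD//; last 2 first.
  - by apply: integrable01S => //; apply: integrable01Zl; exact: fw.1.
  - by apply: integrable01S => //; apply: integrable01Zl; exact: gz.1.
  have iw := fw.1; have iz := gz.1.
  rewrite !RintegralZl//; [|exact: integrable01S..].
  rewrite -fw.2// -gz.2//; ring.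
have -> : \int[mu]_(t in `[x, y]) `| (`|w t| + `|z t|) | =
    \int[mu]_(t in `[x, y]) (`|w t| + `|z t|).
  by apply: eq_Rintegral => t _; rewrite ger0_norm// addr_ge0.
apply: Rintegral01_close => //.
  by apply: integrable01D; apply: integrable01Zl; [exact: fw.1|exact: gz.1].
move=> t /andP[xt ty].
rewrite (_ : _ - _ = (g y - g t) * w t + (f x - f t) * z t); last by ring.
rewrite (le_trans (ler_normD _ _))// !normrM mulrDr lerD//.
  by rewrite ler_wpM2r// Hg ?/in01; [|lra|lra|rewrite ger0_norm; lra].
by rewrite ler_wpM2r// Hf ?/in01; [|lra|lra|rewrite ler0_norm; lra].
Qed.

Lemma primitive01D f w g z : primitive01 f w -> primitive01 g z ->
  primitive01 (fun t => f t + g t) (fun t => w t + z t).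
Proof.
move=> [iw fw] [iz gz]; split=> [|a b a0 ab b1]; first exact: integrable01D.
by rewrite RintegralD//; [rewrite -fw// -gz//; ring|exact: integrable01S..].
Qed.

Lemma primitive01Zl c f w : primitive01 f w ->
  primitive01 (fun t => c * f t) (fun t => c * w t).
Proof.
move=> [iw fw]; split=> [|a b a0 ab b1]; first exact: integrable01Zl.
by rewrite RintegralZl//; [rewrite -fw//; ring|exact: integrable01S].
Qed.

Lemma eq_primitive01 f w f' w' : (forall x, in01 x -> f x = f' x) ->
  (forall x, in01 x -> w x = w' x) -> primitive01 f w -> primitive01 f' w'.
Proof.
move=> ff ww [iw fw]; split.
  apply: eq_integrable iw => // x; rewrite inE /= in_itv /= => xin.
  by rewrite ww.
move=> a b a0 ab b1; rewrite -ff -?ff ?/in01; [|lra..].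
rewrite fw//; apply: eq_Rintegral => t; rewrite inE /= in_itv /= => tin.
by rewrite ww// /in01; lra.
Qed.

Lemma cont01V f c : 0 < c -> (forall x, in01 x -> c <= f x) ->
  {within `[0, 1], continuous f} ->
  {within `[0, 1], continuous (fun x => (f x)^-1)}.
Proof.
move=> c0 cf H.
apply/subspace_continuousP => x xin; apply: cvgV.
  by rewrite gt_eqF// (lt_le_trans c0)// cf//; move: xin; rewrite /= in_itv.
by move/subspace_continuousP: H; exact.
Qed.

Lemma cont01_sqrt f : {within `[0, 1], continuous f} ->
  {within `[0, 1], continuous (fun x => Num.sqrt (f x))}.
Proof.
move/subspace_continuousP => H; apply/subspace_continuousP => x xin.
exact: (cvg_comp _ _ (H x xin) (@sqrt_continuous R (f x))).
Qed.

Lemma cont01M f g : {within `[0, 1], continuous f} ->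
  {within `[0, 1], continuous g} ->
  {within `[0, 1], continuous (fun x => f x * g x)}.
Proof. by move=> cf cg x; apply: cvgM; [exact: cf|exact: cg]. Qed.

Lemma cont01D f g : {within `[0, 1], continuous f} ->
  {within `[0, 1], continuous g} ->
  {within `[0, 1], continuous (fun x => f x + g x)}.
Proof. by move=> cf cg x; apply: cvgD; [exact: cf|exact: cg]. Qed.

Lemma cont01_cst (c : R) : {within `[0, 1], continuous (fun _ : R => c)}.
Proof. by move=> x; exact: cvg_cst. Qed.

Lemma primitive01V f w c : 0 < c -> (forall x, in01 x -> c <= f x) ->
  primitive01 f w ->
  primitive01 (fun t => (f t)^-1) (fun t => - ((f t)^-1 * (f t)^-1) * w t).
Proof.
move=> c0 cf fw.
have f0 x : in01 x -> 0 < f x by move=> xin; rewrite (lt_le_trans c0)// cf.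
have ci := cont01V c0 cf (primitive01_continuous fw).
have [M M0 HM] := cont01_bounded ci.
apply: (primitive01_factor (K := fun x y => - ((f x)^-1 * (f y)^-1)) fw).
- by move=> x; apply: cvgN; exact: (cont01M ci ci).
- move=> x y x0 xy y1; have fx : 0 < f x by apply: f0; rewrite /in01; lra.
  have fy : 0 < f y by apply: f0; rewrite /in01; lra.
  by field; rewrite !gt_eqF.
move=> e e0; have eM : 0 < e / (2 * M) by rewrite divr_gt0// mulr_gt0.
have [d d0 Hd] := heine01 ci eM; exists d => // x y t x0 y1 /andP[xt ty] xyd.
have xin : in01 x by rewrite /in01; lra.
have yin : in01 y by rewrite /in01; lra.
have tin : in01 t by rewrite /in01; lra.
rewrite (_ : _ - _ = (f t)^-1 * ((f t)^-1 - (f x)^-1) +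
   (f x)^-1 * ((f t)^-1 - (f y)^-1)); last by ring.
have A := Hd t x tin xin; have B := Hd t y tin yin.
have {}A := A ltac:(rewrite ger0_norm; lra).
have {}B := B ltac:(rewrite ler0_norm; lra).
rewrite (le_trans (ler_normD _ _))// !normrM.
have -> : e = M * (e / (2 * M)) + M * (e / (2 * M)).
  by field; rewrite gt_eqF.
by rewrite lerD// ler_pM// HM.
Qed.

Lemma primitive01_sqrt f w c : 0 < c -> (forall x, in01 x -> c <= f x) ->
  primitive01 f w ->
  primitive01 (fun t => Num.sqrt (f t)) (fun t => (2 * Num.sqrt (f t))^-1 * w t).
Proof.
move=> c0 cf fw.
pose r t := Num.sqrt (f t).
change (primitive01 r (fun t => (2 * r t)^-1 * w t)).
have f0 x : in01 x -> 0 < f x by move=> xin; rewrite (lt_le_trans c0)// cf.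
pose s := Num.sqrt c.
have s0 : 0 < s by rewrite sqrtr_gt0.
have rs x : in01 x -> s <= r x by move=> xin; apply: ler_wsqrtr; exact: cf.
have cr : {within `[0, 1], continuous r}.
  exact/cont01_sqrt/(primitive01_continuous fw).
apply: (primitive01_factor (K := fun x y => (r x + r y)^-1) fw).
- apply: (@cont01V _ s) => //.
    by move=> x xin; have := rs x xin; rewrite /r; lra.
  by apply: cont01M => //; exact: cont01_cst.
- move=> x y x0 xy y1.
  have xin : in01 x by rewrite /in01; lra.
  have yin : in01 y by rewrite /in01; lra.
  have := rs x xin; have := rs y yin; move=> rx ry.
  rewrite -(sqr_sqrtr (ltW (f0 _ xin))) -(sqr_sqrtr (ltW (f0 _ yin))) -/(r x) -/(r y).
  by field; rewrite gt_eqF//; lra.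
(* The numerator of the error will be at most 2 e s^2 and its denominator at least 4 s^2. *)
move=> e e0; have es : 0 < e * (s * s) by rewrite !mulr_gt0.
have [d d0 Hd] := heine01 cr es; exists d => // x y t x0 y1 /andP[xt ty] xyd.
have xin : in01 x by rewrite /in01; lra.
have yin : in01 y by rewrite /in01; lra.
have tin : in01 t by rewrite /in01; lra.
have A := Hd t x tin xin; have B := Hd t y tin yin.
have {}A := A ltac:(rewrite ger0_norm; lra).
have {}B := B ltac:(rewrite ler0_norm; lra).
have rx := rs x xin; have ry := rs y yin; have rt := rs t tin.
rewrite (_ : _ - _ = ((r t - r x) + (r t - r y)) / ((r x + r y) * (2 * r t))); last first.
  by field; apply/andP; split; rewrite gt_eqF//; lra.
rewrite normrM normfV (ger0_norm (_ : 0 <= (r x + r y) * (2 * r t))); last first.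
  by rewrite mulr_ge0//; lra.
rewrite ler_pdivrMr; last by rewrite mulr_gt0//; lra.
rewrite (le_trans (ler_normD _ _))//.
apply: (@le_trans _ _ (e * (2 * s * (2 * s)))); first by nra.
by rewrite ler_pM2l// ler_pM//; lra.
Qed.

End AbsolutelyContinuousCalculus.

(** * Derivatives relative to [0,1] and the fundamental theorem of calculus *)

Section Derivative01.
Variable R : realType.
Implicit Types (f m w z : R -> R) (a b x y e d : R) (g : R -> 'rV[R]_2).
Local Notation mu := (@lebesgue_measure R).

(** First-order expansion tested only on points of [0,1], hence one-sided at the end points; it
    expresses the limits of [diffq] without division. *)
Definition deriv01 f x l := forall e, 0 < e -> exists2 d : R, 0 < d &
  forall y, in01 y -> `|y - x| < d -> `|f y - f x - l * (y - x)| <= e * `|y - x|.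

Lemma derivable_deriv01 f x : derivable f x 1 -> deriv01 f x (derive1 f x).
Proof.
move=> df e e0.
have : h^-1 *: (f (h + x) - f x) @[h --> 0^'] --> derive1 f x.
  rewrite derive1E.
  have := df; rewrite /derivable /derive.
  rewrite (_ : (fun h => _) = (fun h => h^-1 *: (f (h + x) - f x))) //.
  by apply/funext => h; rewrite /= [_%:A]mulr1.
move/cvgrPdist_le => /(_ e e0) [d /= d0 Hd].
exists d => // y yin yxd.
have [->|yx] := eqVneq y x; first by rewrite !subrr mulr0 subr0 normr0 mulr0.
have yx0 : y - x != 0 by rewrite subr_eq0.
have := Hd (y - x); rewrite /= sub0r normrN yxd => /(_ isT yx0).
rewrite subrK distrC [_ *: _]mulrC => H.
rewrite (_ : _ - _ = ((f y - f x) / (y - x) - derive1 f x) * (y - x)); last by field.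
by rewrite normrM ler_wpM2r.
Qed.

Lemma deriv01_is_derive f x l : 0 < x -> x < 1 -> deriv01 f x l ->
  is_derive x 1 f l.
Proof.
move=> x0 x1 H.
suff K : h^-1 *: (f (h *: 1 + x) - f x) @[h --> 0^'] --> l.
  by apply: DeriveDef; [apply/cvg_ex; exists l|apply: cvg_lim].
apply/cvgrPdist_le => e e0; have [d d0 Hd] := H e e0.
exists (Num.min d (Num.min x (1 - x))) => /=.
  by rewrite !lt_min d0 x0 subr_gt0.
move=> h /=; rewrite sub0r normrN !lt_min => /and3P[hd hx h1] h0.
have := Hd (h + x); rewrite addrK /in01 => /(_ _ hd).
have := ler_norm h; have := ler_norm (- h); rewrite normrN => hn1 hn2.
move=> /(_ ltac:(lra)) H1.
rewrite [_%:A]mulr1 distrC [_ *: _]mulrC.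
rewrite (_ : _ - _ = (f (h + x) - f x - l * h) / h); last by field.
by rewrite normrM normfV ler_pdivrMr// normr_gt0.
Qed.

Lemma deriv01_cont f f' x : (forall x, in01 x -> deriv01 f x (f' x)) ->
  {within `[0, 1], continuous f}.
Proof.
move=> H; apply/subspace_continuousP => t tin.
have {}tin : in01 t by move: tin; rewrite /= in_itv.
apply/cvgrPdist_le => e e0; have [d d0 Hd] := H t tin 1 ltr01.
rewrite near_withinE /=.
have M0 : 0 < 1 + `|f' t| by rewrite ltr_pwDl.
exists (Num.min d (e / (1 + `|f' t|))); first by rewrite /= lt_min d0 divr_gt0.
move=> y /=; rewrite lt_min distrC => /andP[ytd yte] /=; rewrite in_itv /= => yin.
have := Hd y yin ytd; rewrite mul1r => K; rewrite distrC.
rewrite (_ : f y - f t = (f y - f t - f' t * (y - t)) + f' t * (y - t)); last by ring.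
rewrite (le_trans (ler_normD _ _))// normrM.
have : `|y - t| * (1 + `|f' t|) <= e by rewrite -ler_pdivlMr// ltW.
by lra.
Qed.

Lemma FTC01 f f' : (forall x, in01 x -> deriv01 f x (f' x)) ->
  {within `[0, 1], continuous f'} -> primitive01 f f'.
Proof.
move=> H cf'; split; first exact: integrable01_cont.
move=> a b a0; rewrite le_eqVlt => /predU1P[<- _|ab b1].
  by rewrite subrr set_itv1 Rintegral_set1.
have cf := deriv01_cont 0 H.
have sab := sub_dom a0 b1.
have cfab : {within `[a, b], continuous f} by exact: continuous_subspaceW cf.
have cfab' : {within `[a, b], continuous f'} by exact: continuous_subspaceW cf'.
have D x : x \in `]a, b[ -> is_derive x 1 f (f' x).
  rewrite in_itv /= => /andP[ax xb].
  by apply: deriv01_is_derive; [lra|lra|apply: H; rewrite /in01; lra].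
have [c1 c2 c3] := (continuous_within_itvP f ab).1 cfab.
rewrite /Rintegral (@continuous_FTC2 _ f' f)//=.
  by split => // x xab; case: (D x xab).
by move=> x xab; rewrite derive1E; case: (D x xab).
Qed.

(** Lebesgue's differentiation theorem for [w] extended by 0 outside [0,1], which is locally
    integrable on the line; at interior points the extension still has the value [w x]. *)
Lemma primitive01_ae_deriv f w : primitive01 f w ->
  {ae mu, forall x, 0 < x < 1 -> deriv01 f x (w x)}.
Proof.
move=> [iw fw].
have lw := integrable_locally (measurable_itv _) iw.
have iw' : mu.-integrable `[0, 1] (EFin \o (w \_ `[0, 1])).
  apply: eq_integrable iw => //.
  by move=> x xin; rewrite /= patchE xin.
have := lebesgue_differentiation lw.
apply: (@filterS _ _ (ae_filter_ringOfSetsType mu)) => x lx /andP[x0 x1].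
have [|dF FE] := FTC1_lebesgue_pt x1 iw' _ lx.
  by rewrite lte_fin.
have wx : (w \_ `[0, 1]) x = w x.
  by rewrite patchE ifT// inE /= in_itv /= !ltW.
move=> e e0; have [d d0 Hd] := derivable_deriv01 dF e0.
exists d => // y yin yx; have := Hd y yin yx; rewrite FE wx.
have E t : in01 t -> \int[mu]_(s in `[0, t]) (w \_ `[0, 1]) s = f t - f 0.
  move=> /andP[t0 t1]; rewrite fw//; apply: eq_Rintegral => s.
  rewrite inE /= in_itv /= => /andP[s0 st].
  by rewrite patchE ifT// inE /= in_itv /= s0 (le_trans st).
rewrite (E y)// (E x) ?/in01; last by lra.
by rewrite (_ : _ - _ - _ = f y - f x - w x * (y - x)); last by ring.
Qed.

Lemma cvg_rV2 (T : Type) (F : set_system T) (FF : Filter F)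
    (h : T -> 'rV[R]_2) (v : 'rV[R]_2) :
  (forall j, h t 0 j @[t --> F] --> v 0 j) -> h t @[t --> F] --> v.
Proof.
move=> H A [P MP sPA].
have K : F [set t | forall j, P 0 j (h t 0 j)].
  by apply: (@filter_forall T 'I_2 (fun j t => P 0 j (h t 0 j))) => j; apply: H; exact: MP.
suff : F (h @^-1` A) by [].
apply: (filterS _ K) => t Ht; apply: sPA => i j; rewrite (ord1 i).
exact: Ht.
Qed.

(** Properness makes the limit in [dx] unique, so that a computed limit is the value of [dx], also
    at the end points. *)
Lemma within_dnbhs_proper x : in01 x -> ProperFilter (within `[0, 1] x^').
Proof.
move=> /andP[x0 x1]; apply: Build_ProperFilter_ex => A [d /= d0 Hd].
(* From the left half one moves right, from the right half left; a move of at most 1/2 stays in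
   [0,1]. *)
have [x12|x12] := leP x (1 / 2).
  pose t := x + Num.min (d / 2) (1 / 2).
  have m0 : 0 < Num.min (d / 2) (1 / 2) by rewrite lt_min !divr_gt0.
  have m1 : Num.min (d / 2) (1 / 2) <= d / 2 by rewrite ge_min lexx.
  have m2 : Num.min (d / 2) (1 / 2) <= 1 / 2 by rewrite ge_min lexx orbT.
  exists t; apply: (Hd t) => /=.
  - rewrite distrC /t addrAC subrr add0r ger0_norm ?ltW//; lra.
  - by rewrite /t -subr_eq0 addrAC subrr add0r gt_eqF.
  - by rewrite in_itv /= /t; lra.
pose t := x - Num.min (d / 2) (1 / 2).
have m0 : 0 < Num.min (d / 2) (1 / 2) by rewrite lt_min !divr_gt0.
have m1 : Num.min (d / 2) (1 / 2) <= d / 2 by rewrite ge_min lexx.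
have m2 : Num.min (d / 2) (1 / 2) <= 1 / 2 by rewrite ge_min lexx orbT.
exists t; apply: (Hd t) => /=.
- rewrite /t opprB addrC subrK ger0_norm ?ltW//; lra.
- by rewrite /t -subr_eq0 addrAC subrr add0r oppr_eq0 gt_eqF.
- by rewrite in_itv /= /t; lra.
Qed.

Lemma diffq_cvg_deriv01 g x (l : 'rV[R]_2) :
  (forall j, deriv01 (fun t => g t 0 j) x (l 0 j)) ->
  diffq g x y @[y --> within `[0, 1] x^'] --> l.
Proof.
move=> H; apply: cvg_rV2 => j; apply/cvgrPdist_le => e e0.
have [d d0 Hd] := H j e e0.
exists d => //= y /=; rewrite distrC => yxd yx; rewrite in_itv /= => yin.
have := Hd y yin yxd; have yx0 : y - x != 0 by rewrite subr_eq0.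
move=> K; rewrite /diffq !mxE distrC.
rewrite (_ : _ - _ = (g y 0 j - g x 0 j - l 0 j * (y - x)) / (y - x)); last by field.
by rewrite normrM normfV ler_pdivrMr// normr_gt0.
Qed.

Lemma deriv01_dx g x (l : 'rV[R]_2) : in01 x ->
  (forall j, deriv01 (fun t => g t 0 j) x (l 0 j)) ->
  derivable_at g x /\ dx g x = l.
Proof.
move=> xin /diffq_cvg_deriv01 H; split; first by apply/cvg_ex; exists l.
have ? := within_dnbhs_proper xin.
exact: cvg_lim H.
Qed.

Lemma dx_deriv01 g x j : derivable_at g x -> deriv01 (fun t => g t 0 j) x (dx g x 0 j).
Proof.
move=> dg e e0.
have : (diffq g x y) 0 j @[y --> within `[0, 1] x^'] --> dx g x 0 j.
  exact: (cvg_comp (diffq g x) (fun M : 'rV[R]_2 => M 0 j) dg (@coord_continuous _ _ _ 0 j (dx g x))).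
move=> /cvgrPdist_le /(_ e e0) [d /= d0 Hd]; exists d => // y yin yxd.
have [->|yx] := eqVneq y x; first by rewrite !subrr mulr0 subr0 normr0 mulr0.
have yx0 : y - x != 0 by rewrite subr_eq0.
have := Hd y; rewrite /= distrC => /(_ yxd yx); rewrite in_itv /= => /(_ yin).
rewrite /diffq !mxE distrC => K.
rewrite (_ : _ - _ = ((y - x)^-1 * (g y 0 j - g x 0 j) - dx g x 0 j) * (y - x)); last by field.
by rewrite normrM ler_wpM2r.
Qed.

End Derivative01.

(** * Weak derivatives *)

Section WeakDerivatives.
Variable R : realType.
Implicit Types (f u v w : R -> R) (a b c h x y e d : R).
Local Notation mu := (@lebesgue_measure R).

(** Truncated powers, the building blocks of B-splines. [ppow3] is written as a product so that its
    derivative follows from that of [ppow2]. *)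
Definition ppow1 x : R := Num.max x 0.
Definition ppow2 x : R := ppow1 x ^+ 2.
Definition ppow3 x : R := x * ppow2 x.

Lemma ppow1_pos x : 0 <= x -> ppow1 x = x.
Proof. by move=> x0; rewrite /ppow1; apply/max_idPl. Qed.

Lemma ppow1_neg x : x <= 0 -> ppow1 x = 0.
Proof. by move=> x0; rewrite /ppow1; apply/max_idPr. Qed.

Lemma ppow1_continuous : continuous ppow1.
Proof. by move=> x; apply: continuous_max; [exact: cvg_id|exact: cvg_cst]. Qed.

Lemma ppow2_derive x : is_derive x 1 ppow2 (2 * ppow1 x).
Proof.
suff K : h^-1 *: (ppow2 (h *: 1 + x) - ppow2 x) @[h --> 0^'] --> 2 * ppow1 x.
  by apply: DeriveDef; [apply/cvg_ex; exists (2 * ppow1 x)|apply: cvg_lim].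
apply/cvgrPdist_le => e e0; exists e => // h /=; rewrite sub0r normrN => he h0.
rewrite [_%:A]mulr1 distrC [_ *: _]mulrC.
rewrite (_ : _ - _ = (ppow2 (h + x) - ppow2 x - 2 * ppow1 x * h) / h); last by field.
rewrite normrM normfV ler_pdivrMr ?normr_gt0//.
apply: (@le_trans _ _ (`|h| * `|h|)); last by rewrite ler_wpM2r// ltW.
rewrite -normrM (ger0_norm (_ : 0 <= h * h)) -?expr2 ?sqr_ge0//.
rewrite ler_norml /ppow2.
have [hx|hx] := leP 0 (h + x); have [x0|x0] := leP 0 x.
- rewrite !ppow1_pos//; apply/andP; split; nra.
- rewrite (ppow1_pos hx) (ppow1_neg (ltW x0)); apply/andP; split; nra.
- rewrite (ppow1_neg (ltW hx)) (ppow1_pos x0); apply/andP; split; nra.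
- rewrite (ppow1_neg (ltW hx)) (ppow1_neg (ltW x0)); apply/andP; split; nra.
Qed.

Lemma ppow3_derive x : is_derive x 1 ppow3 (3 * ppow2 x).
Proof.
have D := @is_deriveM R R id ppow2 x 1 _ _ (is_derive_id x 1) (ppow2_derive x).
apply: is_derive_eq D _; rewrite /ppow2 /= /GRing.scale /=.
have [x0|x0] := leP 0 x; first by rewrite ppow1_pos//; ring.
by rewrite ppow1_neg ?ltW//; ring.
Qed.

Lemma is_derive_shift f c x l : is_derive (x - c) 1 f l ->
  is_derive x 1 (fun t => f (t - c)) l.
Proof.
move=> [df fE].
have E : (fun t : R => t^-1 *: (f (t *: 1 + (x - c)) - f (x - c))) =
    (fun t : R => t^-1 *: (f (t *: 1 + x - c) - f (x - c))).
  by apply/funext => t; rewrite addrA.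
move: df fE; rewrite /derivable /derive E => df fE.
by apply: DeriveDef.
Qed.

(** Third backward difference with step [h]: it kills polynomials of degree at most 2 and sends the
    cube to 6 h^3, hence the normalizations that follow. *)
Definition third_diff f c h x :=
  f (x - c) - 3 * f (x - (c + h)) + 3 * f (x - (c + 2 * h)) - f (x - (c + 3 * h)).

Lemma third_diff_derive f f' c h x : (forall t : R, is_derive t (1 : R) f (f' t)) ->
  is_derive x 1 (third_diff f c h) (third_diff f' c h x).
Proof.
move=> H; rewrite /third_diff.
have H0 := is_derive_shift (H (x - c)).
have H1 := is_derive_shift (H (x - (c + h))).
have H2 := is_derive_shift (H (x - (c + 2 * h))).
have H3 := is_derive_shift (H (x - (c + 3 * h))).
have D := is_deriveB (is_deriveD (is_deriveB H0 (is_deriveZ 3 H1)) (is_deriveZ 3 H2)) H3.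
exact: D.
Qed.

(** [bump] is the quadratic B-spline with knots c, c + h, c + 2h, c + 3h, of class C^1 and integral
    1; [bstep] is its primitive, climbing from 0 to 1, and [dbump] its derivative. Differences of
    two [bstep] or of two [bump] are thus explicit test functions. *)
Definition bstep c h x := (6 * h ^+ 3)^-1 * third_diff ppow3 c h x.
Definition bump c h x := (2 * h ^+ 3)^-1 * third_diff ppow2 c h x.
Definition dbump c h x := (h ^+ 3)^-1 * third_diff ppow1 c h x.

Lemma bstep_derive c h x : 0 < h -> is_derive x 1 (bstep c h) (bump c h x).
Proof.
move=> h0.
have D := is_deriveZ (6 * h ^+ 3)^-1 (third_diff_derive c h x ppow3_derive).
apply: is_derive_eq D _.
rewrite /bump /third_diff /GRing.scale /=.
by field; rewrite gt_eqF.
Qed.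

Lemma bump_derive c h x : 0 < h -> is_derive x 1 (bump c h) (dbump c h x).
Proof.
move=> h0.
have D := is_deriveZ (2 * h ^+ 3)^-1 (third_diff_derive c h x ppow2_derive).
apply: is_derive_eq D _.
rewrite /dbump /third_diff /GRing.scale /=.
by field; rewrite gt_eqF.
Qed.

Lemma dbump_continuous c h : continuous (dbump c h).
Proof.
have K k : continuous (fun x => ppow1 (x - k)).
  move=> x; have C : (t - k) @[t --> x] --> x - k by apply: cvgB => //; exact: cvg_cst.
  exact: (cvg_comp (fun x => x - k) ppow1 C (@ppow1_continuous (x - k))).
move=> x; rewrite /dbump /third_diff; apply: cvgM; first exact: cvg_cst.
apply: cvgB; last exact: K.
apply: cvgD; last by apply: cvgM; [exact: cvg_cst|exact: K].
by apply: cvgB; [exact: K|apply: cvgM; [exact: cvg_cst|exact: K]].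
Qed.

Lemma third_diff_left f c h x : (forall t, t <= 0 -> f t = 0) -> 0 < h ->
  x <= c -> third_diff f c h x = 0.
Proof. by move=> H h0 xc; rewrite /third_diff !H; [ring|lra..]. Qed.

Lemma bstep_left c h x : 0 < h -> x <= c -> bstep c h x = 0.
Proof.
move=> h0 xc; rewrite /bstep third_diff_left ?mulr0// => t t0.
by rewrite /ppow3 /ppow2 ppow1_neg//; ring.
Qed.

Lemma bump_left c h x : 0 < h -> x <= c -> bump c h x = 0.
Proof.
move=> h0 xc; rewrite /bump third_diff_left ?mulr0// => t t0.
by rewrite /ppow2 ppow1_neg//; ring.
Qed.

Lemma bstep_right c h x : 0 < h -> c + 3 * h <= x -> bstep c h x = 1.
Proof.
move=> h0 xc; rewrite /bstep /third_diff /ppow3 /ppow2 !ppow1_pos; [|lra..].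
by field; rewrite gt_eqF.
Qed.

Lemma bump_right c h x : 0 < h -> c + 3 * h <= x -> bump c h x = 0.
Proof.
move=> h0 xc; rewrite /bump /third_diff /ppow2 !ppow1_pos; [|lra..].
by field; rewrite gt_eqF.
Qed.

Lemma bump_ge0 c h x : 0 < h -> 0 <= bump c h x.
Proof.
move=> h0; have [xc|xc] := leP x c; first by rewrite bump_left.
have [xc3|xc3] := leP (c + 3 * h) x; first by rewrite bump_right.
rewrite /bump mulr_ge0//; first by rewrite invr_ge0 mulr_ge0// exprn_ge0// ltW.
rewrite /third_diff /ppow2 (@ppow1_pos (x - c)) ?(@ppow1_neg (x - (c + 3 * h))); [|lra..].
have [x1|x1] := leP (x - (c + h)) 0.
  rewrite (ppow1_neg x1) (@ppow1_neg (x - (c + 2 * h))); [nra|lra].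
rewrite (ppow1_pos (ltW x1)).
have [x2|x2] := leP (x - (c + 2 * h)) 0; first by rewrite (ppow1_neg x2); nra.
rewrite (ppow1_pos (ltW x2)).
(* On the last cell the missing term would complete the third difference of a quadratic polynomial,
   which is 0. *)
have -> : (x - c) ^+ 2 - 3 * (x - (c + h)) ^+ 2 + 3 * (x - (c + 2 * h)) ^+ 2 - 0 ^+ 2
   = (c + 3 * h - x) ^+ 2 by ring.
exact: sqr_ge0.
Qed.

(** Du Bois-Reymond's argument: [bstep a h - bstep b h] has compact support in ]0,1[ and derivative
    [bump a h - bump b h]. The weak derivative [u2] is tested with the former, [u1] with the latter,
    and two integrations by parts compare [u'] with the integral of [u2]. *)
Lemma weak_derivative_bump u u' u1 u2 a b h :
  (forall x, in01 x -> deriv01 u x (u' x)) ->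
  {within `[0, 1], continuous u'} ->
  weak_derivative u u1 -> weak_derivative u1 u2 -> integrable01 u2 ->
  0 < h -> 0 < a -> a <= b -> b + 3 * h < 1 ->
  let v := fun x => u' x - \int[mu]_(t in `[0, x]) u2 t in
  \int[mu]_(x in `[0, 1]) (v x * bump a h x) =
  \int[mu]_(x in `[0, 1]) (v x * bump b h x).
Proof.
move=> du cu' w1 w2 iu2 h0 a0 ab bh v.
pose phi x := bstep a h x - bstep b h x.
pose phi1 x := bump a h x - bump b h x.
pose phi2 x := dbump a h x - dbump b h x.
have D0 (x : R) : is_derive x (1 : R) phi (phi1 x).
  exact: (is_deriveB (bstep_derive a x h0) (bstep_derive b x h0)).
have D1 (x : R) : is_derive x (1 : R) phi1 (phi2 x).
  exact: (is_deriveB (bump_derive a x h0) (bump_derive b x h0)).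
have E0 : derive1 phi = phi1.
  by apply/funext => x; rewrite derive1E; case: (D0 x).
have E1 : derive1 phi1 = phi2.
  by apply/funext => x; rewrite derive1E; case: (D1 x).
have c2 : continuous phi2.
  by move=> x; apply: cvgB; exact: dbump_continuous.
have c1 : continuous phi1.
  by move=> x; apply/differentiable_continuous/derivable1_diffP; case: (D1 x).
have c0 : continuous phi.
  by move=> x; apply/differentiable_continuous/derivable1_diffP; case: (D0 x).
have supp p : (forall x, x <= a -> p x = 0) -> (forall x, b + 3 * h <= x -> p x = 0) ->
    closure [set x | p x != 0] `<=` `]0, 1[.
  move=> pl pr; apply: (@subset_trans _ `[a, b + 3 * h]).
    rewrite closureE => y; apply => /=; split; first exact: itv_closed.
    move=> x /=; rewrite in_itv /=; apply: contraNT.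
    by rewrite negb_and -!ltNge => /orP[/ltW/pl ->|/ltW/pr ->].
  by move=> y /=; rewrite !in_itv /=; lra.
have phi_l x : x <= a -> phi x = 0 by move=> xa; rewrite /phi !bstep_left; lra.
have phi_r x : b + 3 * h <= x -> phi x = 0.
  by move=> xa; rewrite /phi !bstep_right; lra.
have phi1_l x : x <= a -> phi1 x = 0 by move=> xa; rewrite /phi1 !bump_left; lra.
have phi1_r x : b + 3 * h <= x -> phi1 x = 0.
  by move=> xa; rewrite /phi1 !bump_right; lra.
have T0 : test_function phi.
  split; [by move=> x; case: (D0 x)|by rewrite E0|exact: supp].
have T1 : test_function phi1.
  split; [by move=> x; case: (D1 x)|by rewrite E1|exact: supp].
have W0 := w2 _ T0; have W1 := w1 _ T1; rewrite E0 in W0; rewrite E1 in W1.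
have C01 f : continuous f -> {within `[0, 1], continuous f}.
  by move=> cf; exact: continuous_subspaceT.
have ioo f : integrable01 f -> \int[mu]_(x in `]0, 1[) f x = \int[mu]_(x in `[0, 1]) f x.
  move=> If; rewrite Rintegral_itv_bndo_bndc; last first.
    by apply: integrableS If => //; apply: subset_itvScc; rewrite bnd_simp.
  rewrite Rintegral_itv_obnd_cbnd//.
  by apply: integrableS If => //; apply: subset_itvScc; rewrite bnd_simp.
have cu := deriv01_cont 0 du.
have Pu := FTC01 du cu'.
have Pphi : primitive01 phi phi1.
  apply: FTC01; last exact: C01.
  by move=> x _; have [dp pE] := D0 x; rewrite -E0; exact: derivable_deriv01.
have Pphi1 : primitive01 phi1 phi2.
  apply: FTC01; last exact: C01.
  by move=> x _; have [dp pE] := D1 x; rewrite -E1; exact: derivable_deriv01.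
have Ca x : x <= a -> (phi x = 0) /\ (phi1 x = 0) by move=> xa; split; [exact: phi_l|exact: phi1_l].
have z0 : phi 0 = 0 /\ phi1 0 = 0 by apply: Ca; exact: ltW.
have z1 : phi 1 = 0 /\ phi1 1 = 0 by split; [apply: phi_r|apply: phi1_r]; exact: ltW.
(* Integration by parts; [phi] and [phi1] vanish at both ends, so no boundary term survives. *)
have [_ M1] := primitive01M Pu Pphi1.
have PU := primitive01_Rintegral iu2.
have [_ M2] := primitive01M PU Pphi.
have := M1 0 1 (lexx _) ler01 (lexx _).
have := M2 0 1 (lexx _) ler01 (lexx _).
rewrite z0.1 z0.2 z1.1 z1.2 !mulr0 !subr0.
have I1 : integrable01 (fun x => u2 x * phi x).
  by under [X in integrable01 X]eq_fun do rewrite mulrC; apply: integrable01M_cont => //; exact: C01.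
have I1' : integrable01 (fun x => phi x * u2 x).
  by apply: integrable01M_cont => //; exact: C01.
have I2 : integrable01 (fun x => (\int[mu]_(t in `[0, x]) u2 t) * phi1 x).
  apply: integrable01_cont; apply: cont01M; last exact: C01.
  exact: primitive01_continuous PU.
have I3 : integrable01 (fun x => u' x * phi1 x).
  by apply: integrable01_cont; apply: cont01M => //; exact: C01.
have I3' : integrable01 (fun x => phi1 x * u' x).
  by apply: integrable01_cont; apply: cont01M => //; exact: C01.
have I4 : integrable01 (fun x => u x * phi2 x).
  by apply: integrable01_cont; apply: cont01M => //; exact: C01.
rewrite (RintegralD _ I1' I2)// (RintegralD _ I3' I4)//.
move: W0 W1; rewrite (ioo _ I1) (ioo _ I4) => W0 W1.
have -> : \int[mu]_(x in `[0, 1]) (phi x * u2 x) = \int[mu]_(x in `[0, 1]) (u2 x * phi x).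
  by apply: eq_Rintegral => x _; rewrite mulrC.
have -> : \int[mu]_(x in `[0, 1]) (phi1 x * u' x) = \int[mu]_(x in `[0, 1]) (u' x * phi1 x).
  by apply: eq_Rintegral => x _; rewrite mulrC.
move=> A B.
have cv : {within `[0, 1], continuous v}.
  by move=> x; apply: cvgB; [exact: cu'|exact: primitive01_continuous PU x].
have cb k : {within `[0, 1], continuous (bump k h)}.
  apply: C01 => x; apply/differentiable_continuous/derivable1_diffP.
  by case: (bump_derive k x h0).
have Iv k : integrable01 (fun x => v x * bump k h x).
  by apply: integrable01_cont; exact: cont01M.
apply/eqP; rewrite -subr_eq0; apply/eqP; rewrite -(RintegralB _ (Iv a) (Iv b))//.
transitivity (\int[mu]_(x in `[0, 1]) (u' x * phi1 x - (\int[mu]_(t in `[0, x]) u2 t) * phi1 x)).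
  by apply: eq_Rintegral => x _; rewrite /v /phi1; ring.
rewrite (RintegralB _ I3 I2)//.
by move: (Rintegral _ _ _) (Rintegral _ _ _) (Rintegral _ _ _) W0 W1 A B => *; lra.
Qed.

End WeakDerivatives.

(** * The du Bois-Reymond lemma *)

Section DuBoisReymond.
Variable R : realType.
Implicit Types (f u v w : R -> R) (a b c h x y e d : R).
Local Notation mu := (@lebesgue_measure R).

Lemma L2_measurable01 u : L2 u -> measurable_fun (`[0, 1] : set R) u.
Proof.
move=> [mu0 _].
by apply/measurable_fun_itv_bndo_bndcP/measurable_fun_itv_obnd_cbndP.
Qed.

Lemma L2_integrable_sqr u : L2 u -> integrable01 (fun x => u x ^+ 2).
Proof.
move=> Lu; have mu01 := L2_measurable01 Lu; have [mu0 iu] := Lu.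
have mu2 : measurable_fun (`[0, 1] : set R) (fun x => u x ^+ 2).
  by apply: (measurableT_comp (f := fun x : R => x ^+ 2)) => //; exact: exprn_measurable.
apply/integrableP; split; first exact/measurable_EFinP.
rewrite (_ : (\int[mu]_(x in `[0%R, 1%R]) _)%E =
    (\int[mu]_(x in `]0%R, 1%R[) (u x ^+ 2)%:E)%E)//.
rewrite -integral_itv_obnd_cbnd; last first.
  apply/measurable_EFinP; apply: measurableT_comp => //.
  by apply: measurable_funS mu2 => //; apply: subset_itvScc; rewrite bnd_simp.
rewrite -integral_itv_bndo_bndc; last first.
  apply/measurable_EFinP; apply: measurableT_comp => //.
  by apply: measurable_funS mu2 => //; apply: subset_itvScc; rewrite bnd_simp.
by apply: eq_integral => x _ /=; rewrite ger0_norm// sqr_ge0.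
Qed.

Lemma L2_integrable01 u : L2 u -> integrable01 u.
Proof.
move=> Lu; have iu2 := L2_integrable_sqr Lu.
have i1 : integrable01 (fun=> 1 : R) by apply: integrable01_cont; exact: cont01_cst.
apply: (le_integrable _ _ _ (integrable01D i1 iu2)) => //.
  by apply/measurable_EFinP; exact: L2_measurable01.
move=> x _ /=; rewrite lee_fin [leRHS]ger0_norm; last by rewrite addr_ge0// sqr_ge0.
rewrite ler_norml; apply/andP; split; nra.
Qed.

(** [bump a h] is an approximate identity at [a]: nonnegative, of integral 1, and supported in
    [a, a + 3h]. *)
Lemma bump_average v a e : {within `[0, 1], continuous v} ->
  0 < a < 1 -> 0 < e -> exists2 d : R, 0 < d & forall h, 0 < h < d ->
  `|\int[mu]_(x in `[0, 1]) (v x * bump a h x) - v a| <= e.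
Proof.
move=> cv /andP[a0 a1] e0; have [d d0 Hd] := heine01 cv e0.
(* The support [a, a + 3h] has to lie within [d] of [a] and inside [0,1]. *)
exists (Num.min (d / 3) ((1 - a) / 3)).
  by rewrite lt_min !divr_gt0// subr_gt0.
move=> h /andP[h0]; rewrite lt_min => /andP[hd ha].
have cb : {within `[0, 1], continuous (bump a h)}.
  apply: continuous_subspaceT => x; apply/differentiable_continuous/derivable1_diffP.
  by case: (bump_derive a x h0).
have Pb : primitive01 (bstep a h) (bump a h).
  apply: FTC01 => // x _; have [dp pE] := bstep_derive a x h0.
  by rewrite -pE -derive1E; exact: derivable_deriv01.
have Ib : \int[mu]_(x in `[0, 1]) (bump a h x) = 1.
  rewrite -Pb.2//.
  by rewrite bstep_right ?bstep_left ?subr0//; lra.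
have -> : v a = \int[mu]_(x in `[0, 1]) (v a * bump a h x).
  by rewrite RintegralZl// ?Ib ?mulr1//; exact: Pb.1.
have -> : e = e * \int[mu]_(x in `[0, 1]) (bump a h x) by rewrite Ib mulr1.
apply: Rintegral01_close => //.
- by apply: integrable01_cont; exact: cont01M.
- by apply: integrable01Zl; exact: Pb.1.
- exact: Pb.1.
move=> t /andP[t0 t1].
have [ta|ta] := leP t a; first by rewrite bump_left// !mulr0 subrr normr0.
have [tb|tb] := leP (a + 3 * h) t; first by rewrite bump_right// !mulr0 subrr normr0.
have b0 := bump_ge0 a t h0.
rewrite -mulrBl normrM (ger0_norm b0) ler_wpM2r// Hd ?/in01; [|lra|lra|].
- done.
- by rewrite ger0_norm; lra.
Qed.

(** The averages of [v] over bumps at two points agree; letting [h] tend to 0 makes [v] constant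
    inside, and continuity extends this to the ends. So the classical derivative is absolutely
    continuous with the second weak derivative as its density. *)
Lemma weak_derivative2_primitive u u' u1 u2 :
  (forall x, in01 x -> deriv01 u x (u' x)) ->
  {within `[0, 1], continuous u'} ->
  weak_derivative u u1 -> weak_derivative u1 u2 -> integrable01 u2 ->
  primitive01 u' u2.
Proof.
move=> du cu' w1 w2 iu2.
pose v := fun x => u' x - \int[mu]_(t in `[0, x]) u2 t.
have PU := primitive01_Rintegral iu2.
have cv : {within `[0, 1], continuous v}.
  by move=> x; apply: cvgB; [exact: cu'|exact: (primitive01_continuous PU)].
have vab a b : 0 < a -> a <= b -> b < 1 -> v a = v b.
  move=> a0 ab b1; apply/eqP; rewrite -subr_eq0 -normr_le0.
  apply/ler_addgt0Pr => e e0; rewrite add0r.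
  have e2 : 0 < e / 2 by rewrite divr_gt0.
  have a01 : 0 < a < 1 by rewrite a0 (le_lt_trans ab).
  have b01 : 0 < b < 1 by rewrite b1 (lt_le_trans a0).
  have [da da0 Ha] := bump_average cv a01 e2.
  have [db db0 Hb] := bump_average cv b01 e2.
  pose h := (Num.min da (Num.min db ((1 - b) / 3))) / 2.
  have m0 : 0 < Num.min da (Num.min db ((1 - b) / 3)).
    by rewrite !lt_min da0 db0 divr_gt0// subr_gt0.
  have m1 : Num.min da (Num.min db ((1 - b) / 3)) <= da by rewrite ge_min lexx.
  have m2 : Num.min da (Num.min db ((1 - b) / 3)) <= db.
    by rewrite !ge_min lexx !orbT.
  have m3 : Num.min da (Num.min db ((1 - b) / 3)) <= (1 - b) / 3.
    by rewrite !ge_min lexx !orbT.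
  have h0 : 0 < h by rewrite divr_gt0.
  have {}Ha := Ha h; have {}Hb := Hb h.
  move: Ha Hb; rewrite h0 /= => /(_ ltac:(rewrite /h; lra)) Ha /(_ ltac:(rewrite /h; lra)) Hb.
  have E := @weak_derivative_bump R u u' u1 u2 a b h du cu' w1 w2 iu2 h0 a0 ab.
  have {}E := E ltac:(rewrite /h; lra).
  rewrite -/v in E; move: Ha Hb; rewrite E.
  set I := Rintegral _ _ _ => Ha Hb.
  rewrite (_ : v a - v b = (I - v b) - (I - v a)); last by ring.
  by rewrite (le_trans (ler_normB _ _))//; lra.
have vin (x : R) : 0 < x -> x < 1 -> v x = v (1 / 2).
  move=> x0 x1; have [xh|xh] := leP x (1 / 2); first by apply: vab => //; lra.
  by apply/esym/vab => //; lra.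
have vc (x : R) : in01 x -> v x = v (1 / 2).
  move=> xin; apply/eqP; rewrite -subr_eq0 -normr_le0.
  apply/ler_addgt0Pr => e e0; rewrite add0r.
  have [d d0 Hd] := heine01 cv e0.
  pose m := Num.min (d / 2) (1 / 4).
  have m0 : 0 < m by rewrite lt_min !divr_gt0.
  have m1 : m <= d / 2 by rewrite /m ge_min lexx.
  have m2 : m <= 1 / 4 by rewrite /m ge_min lexx orbT.
  move: xin => /andP[x0 x1].
  have [xh|xh] := leP x (1 / 2).
    rewrite -(vin (x + m)); [|lra|lra].
    by apply: Hd; rewrite ?/in01; [lra|lra|rewrite ler0_norm; lra].
  rewrite -(vin (x - m)); [|lra|lra].
  by apply: Hd; rewrite ?/in01; [lra|lra|rewrite ger0_norm; lra].
split=> // a b a0 ab b1; rewrite -PU.2//.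
have := vc a; have := vc b; rewrite /in01 => /(_ ltac:(lra)) vb /(_ ltac:(lra)) va.
have : v b = v a by rewrite va vb.
rewrite /v; set Ib := Rintegral _ _ _; set Ia := Rintegral _ _ _ => E; lra.
Qed.

End DuBoisReymond.

(** * From curves to constant-speed data *)

Section NonmeasurableIntegrands.
Local Open Scope ereal_scope.
Context d (T : measurableType d) (R : realType).
Variables (mu : {measure set T -> \bar R}) (D : set T).
Hypothesis mD : measurable D.
Import HBNNSimple.

(** Here [f] may be non-measurable, like an integrand built on [curvature], which is unspecified on
    a null set. Its integral is a supremum over simple functions below [f], each of which is almost
    everywhere below [h]. *)
Lemma ge0_integral_ae_le (f h : T -> \bar R) :
  (forall x, D x -> 0 <= f x) -> (forall x, D x -> 0 <= h x) ->
  measurable_fun D h -> {ae mu, forall x, D x -> f x <= h x} ->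
  \int[mu]_(x in D) f x <= \int[mu]_(x in D) h x.
Proof.
move=> f0 h0 mh fh; rewrite ge0_integralE//; apply: ge_ereal_sup => _ [s /= sf <-].
rewrite -integralT_nnsfun [leRHS]integral_mkcond.
apply: ae_ge0_le_integral => //.
- by move=> x _; rewrite lee_fin.
- exact/measurable_EFinP.
- by move=> x _; apply: erestrict_ge0.
- exact/(measurable_restrictT _ _).1.
apply: (@filterS _ _ (ae_filter_ringOfSetsType mu) _ _ _ fh) => x fhx _.
apply: le_trans (sf x) _; rewrite !patchE; case: ifPn => // xD.
by apply: fhx; exact/set_mem.
Qed.

Lemma ge0_integral_ae_ge (f h : T -> \bar R) :
  (forall x, D x -> 0 <= f x) -> (forall x, D x -> 0 <= h x) ->
  measurable_fun D h -> {ae mu, forall x, D x -> h x <= f x} ->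
  \int[mu]_(x in D) h x <= \int[mu]_(x in D) f x.
Proof.
move=> f0 h0 mh [N [mN N0 hfN]].
(* Once the exceptional null set is removed from the domain of [h], a simple function below [h] is
   everywhere below [f]. *)
rewrite (ge0_negligible_integral mN)// [leRHS]ge0_integralE// ge0_integralE; last first.
  by move=> x [Dx _]; exact: h0.
apply: ge_ereal_sup => _ [s /= sh <-]; apply: ereal_sup_ubound; exists s => //= x.
apply: le_trans (sh x) _; rewrite !patchE.
case: ifPn => [|_]; last by case: ifPn => // /set_mem /f0.
move/set_mem => [Dx Nx]; rewrite mem_set//.
by move/subsetCl : hfN; apply.
Qed.

Lemma ge0_integral_ae_eq (f h : T -> \bar R) :
  (forall x, D x -> 0 <= f x) -> (forall x, D x -> 0 <= h x) ->
  measurable_fun D h -> {ae mu, forall x, D x -> f x = h x} ->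
  \int[mu]_(x in D) f x = \int[mu]_(x in D) h x.
Proof.
move=> f0 h0 mh fh; apply/eqP; rewrite eq_le; apply/andP; split.
  apply: ge0_integral_ae_le => //.
  apply: (@filterS _ _ (ae_filter_ringOfSetsType mu) _ _ _ fh) => x fhx Dx.
  by rewrite fhx.
apply: ge0_integral_ae_ge => //.
apply: (@filterS _ _ (ae_filter_ringOfSetsType mu) _ _ _ fh) => x fhx Dx.
by rewrite fhx.
Qed.

End NonmeasurableIntegrands.

(** * Curvature at points where the tangent is differentiable *)

Section Curvature.
Variable R : realType.
Implicit Types (f p q r : R -> R) (x y e d l : R) (g : R -> 'rV[R]_2).
Local Notation mu := (@lebesgue_measure R).

Lemma deriv01_unique f x l l' : 0 < x < 1 ->
  deriv01 f x l -> deriv01 f x l' -> l = l'.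
Proof.
move=> /andP[x0 x1] /(deriv01_is_derive x0 x1)[_ <-].
by move=> /(deriv01_is_derive x0 x1)[_ <-].
Qed.

Lemma eq_deriv01 f f' x l : in01 x -> (forall t, in01 t -> f t = f' t) ->
  deriv01 f x l -> deriv01 f' x l.
Proof.
move=> xin ff H e e0; have [d d0 Hd] := H e e0; exists d => // y yin yx.
by rewrite -!ff//; exact: Hd.
Qed.

Lemma unit_deriv01_orth p q x a b : 0 < x < 1 ->
  (forall t, in01 t -> p t ^+ 2 + q t ^+ 2 = 1) ->
  deriv01 p x a -> deriv01 q x b -> p x * a + q x * b = 0.
Proof.
move=> /[dup] x01 /andP[x0 x1] pq dp dq.
have xin : in01 x by rewrite /in01; lra.
have Dp := deriv01_is_derive x0 x1 dp; have Dq := deriv01_is_derive x0 x1 dq.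
have [D E] := is_deriveD (is_deriveM Dp Dp) (is_deriveM Dq Dq).
have K := derivable_deriv01 D; rewrite derive1E E in K.
have K1 : deriv01 (fun _ => 1) x 0.
  by move=> e e0; exists 1 => // y _ _; rewrite subrr mul0r subrr normr0 mulr_ge0// ltW.
have K2 : deriv01 (p * p + q * q) x 0.
  apply: eq_deriv01 K1 => // t tin; rewrite -(pq t tin) !expr2 //.
have := deriv01_unique x01 K K2; rewrite /GRing.scale /=; lra.
Qed.

Lemma enorm_ge0 (v : 'rV[R]_2) : 0 <= enorm v.
Proof. exact: sqrtr_ge0. Qed.

Lemma enorm_neq0_gt0 (v : 'rV[R]_2) : enorm v != 0 -> 0 < enorm v.
Proof. by rewrite lt_def enorm_ge0 andbT. Qed.

Lemma ord2E (P : 'I_2 -> Prop) : P 0 -> P 1 -> forall j, P j.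
Proof.
move=> P0 P1 j; case: j => [[|[|//]] jlt].
  by rewrite (_ : Ordinal jlt = 0)//; exact: val_inj.
by rewrite (_ : Ordinal jlt = 1)//; exact: val_inj.
Qed.

(** At such a point tau' is orthogonal to tau, hence a multiple of [nu]; this determines [curvature]
    and gives |k| = |tau'| / r, with r the speed. *)
Lemma curvature_ae g x a b : 0 < x < 1 ->
  (forall t, in01 t -> enorm (dx g t) != 0) ->
  deriv01 (fun t => tau g t 0 0) x a -> deriv01 (fun t => tau g t 0 1) x b ->
  (curvature g x ^+ 2 + 1) * enorm (dx g x) =
  (a ^+ 2 + b ^+ 2) / enorm (dx g x) + enorm (dx g x).
Proof.
move=> x01 rg da db; have /andP[x0 x1] := x01.
have xin : in01 x by rewrite /in01; lra.
have unit t : in01 t -> tau g t 0 0 ^+ 2 + tau g t 0 1 ^+ 2 = 1.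
  move=> tin; rewrite /tau /ds !mxE !exprMn -mulrDr.
  have r0 := enorm_neq0_gt0 (rg t tin).
  have <- : enorm (dx g t) ^+ 2 = dx g t 0 0 ^+ 2 + dx g t 0 1 ^+ 2.
    by rewrite sqr_sqrtr// addr_ge0// sqr_ge0.
  by rewrite -exprMn mulVf ?expr1n// gt_eqF.
have orth := unit_deriv01_orth x01 unit da db.
have [_ dxtau] : derivable_at (tau g) x /\ dx (tau g) x = \row_j (if j == 0 then a else b).
  by apply: deriv01_dx => //; apply: ord2E; rewrite mxE.
have r0 := enorm_neq0_gt0 (rg x xin).
set r := enorm (dx g x) in r0 *.
have ux := unit x xin.
have nu0 : nu g x 0 0 = - tau g x 0 1 by rewrite /nu /rot90 mxE.
have nu1 : nu g x 0 1 = tau g x 0 0 by rewrite /nu /rot90 mxE.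
move: ux orth nu0 nu1.
set p := tau g x 0 0; set q := tau g x 0 1 => ux orth nu0 nu1.
(* Component of tau' along [nu], per unit of arc length. *)
pose k := r^-1 * (- q * a + p * b).
have kP : [set k : R | ds g (tau g) x = k *: nu g x] k.
  rewrite /= {1}/ds dxtau -/r; apply/rowP; apply: ord2E.
    rewrite [RHS]mxE nu0 !mxE /= /k -mulrA; congr (_ * _).
    have E : a = (p ^+ 2 + q ^+ 2) * a - p * (p * a + q * b) by rewrite orth ux; ring.
    by rewrite {1}E; ring.
  rewrite [RHS]mxE nu1 !mxE /= /k -mulrA; congr (_ * _).
  have E : b = (p ^+ 2 + q ^+ 2) * b - q * (p * a + q * b) by rewrite orth ux; ring.
  by rewrite {1}E; ring.
have kE : curvature g x = k.
  have /= := @getPex _ [set k : R | ds g (tau g) x = k *: nu g x] (ex_intro _ k kP).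
  rewrite -/(curvature g x) => cP.
  have : (curvature g x - k) *: nu g x = 0 by rewrite scalerBl -cP -kP subrr.
  move/eqP; rewrite scaler_eq0 => /orP[|/eqP nuz]; first by rewrite subr_eq0 => /eqP.
  move: nu0 nu1 ux; rewrite nuz !mxE => q0 p0.
  by rewrite -p0; nra.
rewrite kE /k.
(* Lagrange's identity; the subtracted square is 0 by orthogonality. *)
have -> : (r^-1 * (- q * a + p * b)) ^+ 2 =
    ((p ^+ 2 + q ^+ 2) * (a ^+ 2 + b ^+ 2) - (p * a + q * b) ^+ 2) / r ^+ 2.
  by field; rewrite gt_eqF.
by rewrite ux orth; field; rewrite gt_eqF.
Qed.

End Curvature.

(* Constant-speed curve data on [0,1]: len is the length L, (tx, ty) the unit
   tangent, (px, py) the position rescaled by 1/L, and var t the integral of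
   the square of the derivative of the tangent over [0,t], so that nrg stands
   for an upper bound L + var 1 / L of the energy.  All the conditions of
   valid_curve are preserved by pointwise limits, and L = 0 is allowed. *)
Record curve_data (R : realType) := CurveData {
  len : R; nrg : R; tx : R -> R; ty : R -> R; px : R -> R; py : R -> R;
  var : R -> R }.

Record valid_curve (R : realType) (D : curve_data R) : Prop := ValidCurve {
  len_ge0 : 0 <= len D;
  tangent_unit : forall x, in01 x -> tx D x ^+ 2 + ty D x ^+ 2 = 1;
  var0 : var D 0 = 0;
  var_nondecr : nondecr01 (var D);
  tangent_var : forall x y, 0 <= x -> x <= y -> y <= 1 ->
    (tx D y - tx D x) ^+ 2 + (ty D y - ty D x) ^+ 2 <= (y - x) * (var D y - var D x);
  pos0 : px D 0 = 0 /\ py D 0 = 0;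
  chord_x : forall x y, 0 <= x -> x <= y -> y <= 1 ->
    (px D y - px D x - (y - x) * tx D x) ^+ 2 <= (y - x) ^+ 3 * var D 1;
  chord_y : forall x y, 0 <= x -> x <= y -> y <= 1 ->
    (py D y - py D x - (y - x) * ty D x) ^+ 2 <= (y - x) ^+ 3 * var D 1;
  var_energy : var D 1 <= len D * (nrg D - len D);
  len_le_nrg : len D <= nrg D }.

(** * The energy of an H2 curve in terms of its tangent *)

Section CurveToData.
Variable R : realType.
Implicit Types (f p q r : R -> R) (x y e d l : R) (g : R -> 'rV[R]_2).
Local Notation mu := (@lebesgue_measure R).

Lemma dx_coord_continuous g j : regular g ->
  {within `[0, 1], continuous (fun t => dx g t 0 j)}.
Proof.
move=> [[_ cg] _]; move/subspace_continuousP: cg => cg.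
apply/subspace_continuousP => x xin.
exact: (cvg_comp (dx g) (fun M : 'rV[R]_2 => M 0 j) (cg x xin) (@coord_continuous _ _ _ 0 j (dx g x))).
Qed.

Lemma regular_deriv01 g j x : regular g -> in01 x ->
  deriv01 (fun t => g t 0 j) x (dx g x 0 j).
Proof. by move=> [[dg _] _] xin; apply/dx_deriv01/dg; rewrite in_itv. Qed.

Lemma regular_neq0 g x : regular g -> in01 x -> enorm (dx g x) != 0.
Proof. by move=> [_ ng] xin; apply: ng; rewrite in_itv. Qed.

(** The components of [dx g] are absolutely continuous by [weak_derivative2_primitive], and
    compactness bounds the speed away from 0, as the square root rule requires. *)
Lemma speed_primitive g : regular g -> H2 g ->
  exists2 c : R, 0 < c & (forall x, in01 x -> c <= enorm (dx g x)) /\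
  exists wr, primitive01 (fun t => enorm (dx g t)) wr.
Proof.
move=> rg H2g.
have P j : exists u2, primitive01 (fun t => dx g t 0 j) u2.
  have [u1 [u2 [_ _ L2u2 w1 w2]]] := H2g j; exists u2.
  apply: weak_derivative2_primitive w1 w2 _.
  - by move=> x xin; exact: regular_deriv01.
  - exact: dx_coord_continuous.
  - exact: L2_integrable01.
have [ux Px] := P 0; have [uy Py] := P 1.
have := primitive01D (primitive01M Px Px) (primitive01M Py Py).
set S := (fun t => _ + _) => PS.
have SE t : S t = dx g t 0 0 ^+ 2 + dx g t 0 1 ^+ 2 by rewrite /S !expr2.
have [c cin cmin] := EVT_min (@ler01 R) (primitive01_continuous PS).
have Sc : 0 < S c.
  have := enorm_neq0_gt0 (regular_neq0 rg (cin : in01 c)).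
  by rewrite /enorm sqrtr_gt0 SE.
exists (Num.sqrt (S c)); first by rewrite sqrtr_gt0.
split=> [x xin|].
  by rewrite /enorm -SE; apply: ler_wsqrtr; apply: cmin; rewrite in_itv.
exists (fun t => (2 * Num.sqrt (S t))^-1 *
  (dx g t 0 0 * ux t + dx g t 0 0 * ux t + (dx g t 0 1 * uy t + dx g t 0 1 * uy t))).
have Q := @primitive01_sqrt R S _ (S c) Sc (fun x xin => cmin x xin) PS.
by apply: eq_primitive01 Q => // x xin; rewrite /enorm -SE.
Qed.

Lemma tangent_primitive g j : regular g -> H2 g ->
  exists w, primitive01 (fun t => tau g t 0 j) w.
Proof.
move=> rg H2g; have [c c0 [cr [wr Pr]]] := speed_primitive rg H2g.
have [u1 [u2 [_ _ L2u2 w1 w2]]] := H2g j.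
have Pj : primitive01 (fun t => dx g t 0 j) u2.
  apply: weak_derivative2_primitive w1 w2 _.
  - by move=> x xin; exact: regular_deriv01.
  - exact: dx_coord_continuous.
  - exact: L2_integrable01.
have Q := primitive01M (primitive01V c0 cr Pr) Pj.
eexists; apply: eq_primitive01 Q => // x xin.
by rewrite /tau /ds !mxE.
Qed.

Lemma ae_interior01 : {ae mu, forall x : R, in01 x -> 0 < x < 1}.
Proof.
exists [set 0; 1]; split.
- by apply: measurableU; exact: measurable_set1.
- apply: countable_lebesgue_measure0; apply: finite_set_countable.
  exact: finite_set2.
- move=> x /= /not_implyP[/andP[x0 x1]]; rewrite !lt_neqAle x0 x1 !andbT.
  move/negP; rewrite negb_and !negbK => /orP[/eqP|/eqP]; by [left|right].
Qed.

(** Almost everywhere [tau g] has derivative ([wp], [wq]), so [curvature_ae] identifies the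
    integrands; as the left one may fail to be measurable, [ge0_integral_ae_eq] is used. *)
Lemma energy_tangent g wp wq : regular g -> H2 g ->
  primitive01 (fun t => tau g t 0 0) wp -> primitive01 (fun t => tau g t 0 1) wq ->
  int_ds g (fun x => curvature g x ^+ 2 + 1) =
  (\int[mu]_(x in `[0%R, 1%R])
     ((wp x ^+ 2 + wq x ^+ 2) / enorm (dx g x) + enorm (dx g x))%:E)%E.
Proof.
move=> rg H2g Pp Pq; have [c c0 [cr [wr Pr]]] := speed_primitive rg H2g.
have cont_r := primitive01_continuous Pr.
rewrite /int_ds; apply: ge0_integral_ae_eq => //.
- by move=> x _; rewrite lee_fin mulr_ge0 ?enorm_ge0// addr_ge0// sqr_ge0.
- move=> x _; rewrite lee_fin addr_ge0 ?enorm_ge0// divr_ge0 ?enorm_ge0//.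
  by rewrite addr_ge0// sqr_ge0.
- apply/measurable_EFinP; apply: measurable_funD; last exact: cont01_measurable.
  have mw w : integrable01 w -> measurable_fun (`[0, 1] : set R) (fun x => w x ^+ 2).
    move=> /measurable_int/measurable_EFinP mw.
    by apply: (measurableT_comp (f := fun x : R => x ^+ 2)) => //; exact: exprn_measurable.
  apply: measurable_funM.
    by apply: measurable_funD; apply: mw; [exact: Pp.1|exact: Pq.1].
  by apply: cont01_measurable; exact: (cont01V c0 cr).
have := ae_interior01; have := primitive01_ae_deriv Pp; have := primitive01_ae_deriv Pq.
move=> Hq Hp Hi.
have F := ae_filter_ringOfSetsType mu.
apply: (@filterS3 _ _ F _ _ _ _ _ Hp Hq Hi) => x dp dq xi.
rewrite /= in_itv /= => xin; have x01 := xi xin.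
congr (_%:E); apply: curvature_ae => //; last 2 first.
- exact: dp.
- exact: dq.
by move=> t tin; exact: regular_neq0.
Qed.

End CurveToData.

(** * Reparametrization at constant speed *)

Section ConstantSpeed.
Variable R : realType.
Implicit Types (f p q r : R -> R) (x y e d l : R) (g : R -> 'rV[R]_2).
Local Notation mu := (@lebesgue_measure R).

Lemma integrable01_sqr_quotient_tangent g wp wq : regular g -> H2 g ->
  primitive01 (fun t => tau g t 0 0) wp -> primitive01 (fun t => tau g t 0 1) wq ->
  (int_ds g (fun x => curvature g x ^+ 2 + 1)%R < +oo)%E ->
  integrable01 (fun x => (wp x ^+ 2 + wq x ^+ 2) / enorm (dx g x)).
Proof.
move=> rg H2g Pp Pq; rewrite (energy_tangent rg H2g Pp Pq) => fin.
have [c c0 [cr [wr Pr]]] := speed_primitive rg H2g.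
have cont_r := primitive01_continuous Pr.
have i1 : integrable01 (fun x => (wp x ^+ 2 + wq x ^+ 2) / enorm (dx g x) + enorm (dx g x)).
  apply/integrableP; split.
    apply/measurable_EFinP; apply: measurable_funD; last exact: cont01_measurable.
    have mw w : integrable01 w -> measurable_fun (`[0, 1] : set R) (fun x => w x ^+ 2).
      move=> /measurable_int/measurable_EFinP mw.
      by apply: (measurableT_comp (f := fun x : R => x ^+ 2)) => //; exact: exprn_measurable.
    apply: measurable_funM.
      by apply: measurable_funD; apply: mw; [exact: Pp.1|exact: Pq.1].
    by apply: cont01_measurable; exact: (cont01V c0 cr).
  apply: le_lt_trans fin; rewrite le_eqVlt; apply/orP; left; apply/eqP.
  apply: eq_integral => x _ /=; rewrite ger0_norm// addr_ge0 ?enorm_ge0//.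
  by rewrite divr_ge0 ?enorm_ge0// addr_ge0// sqr_ge0.
have := integrable01B i1 (integrable01_cont cont_r).
by under eq_fun do rewrite addrK.
Qed.

(* Cauchy-Schwarz in the form 2 v.w <= l |v|^2 r + |w|^2 / (l r), with
   l = 1 / (arc length). *)
Lemma tangent_increment g wp wq s V : regular g -> H2 g ->
  primitive01 (fun t => tau g t 0 0) wp -> primitive01 (fun t => tau g t 0 1) wq ->
  primitive01 s (fun x => enorm (dx g x)) ->
  primitive01 V (fun x => (wp x ^+ 2 + wq x ^+ 2) / enorm (dx g x)) ->
  forall a b : R, 0 <= a -> a <= b -> b <= 1 ->
  (tau g b 0 0 - tau g a 0 0) ^+ 2 + (tau g b 0 1 - tau g a 0 1) ^+ 2 <=
  (s b - s a) * (V b - V a).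
Proof.
move=> rg H2g Pp Pq Ps PV a b a0; rewrite le_eqVlt => /predU1P[<- _|ab b1].
  by rewrite !subrr expr0n addr0 mul0r.
have ab' := ltW ab.
have r0 t : in01 t -> 0 < enorm (dx g t).
  by move=> tin; apply/enorm_neq0_gt0/regular_neq0.
have [c c0 [cr _]] := speed_primitive rg H2g.
have ds0 : 0 < s b - s a.
  rewrite Ps.2// (@lt_le_trans _ _ (c * (b - a)))//; first by rewrite mulr_gt0// subr_gt0.
  rewrite -Rintegral_cst_itv//; apply: le_Rintegral01 => //.
  - by apply: integrable01_cont; exact: cont01_cst.
  - exact: Ps.1.
  - by move=> t /andP[t1 t2]; apply: cr; rewrite /in01; lra.
set v1 := _ - _; set v2 := tau g b 0 1 - _.
set n := v1 ^+ 2 + v2 ^+ 2.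
set S := s b - s a in ds0 *.
have : 2 * n <= n + S * (V b - V a).
  have -> : 2 * n = \int[mu]_(t in `[a, b]) (2 * v1 * wp t + 2 * v2 * wq t).
    have iw := Pp.1; have iq := Pq.1.
    rewrite RintegralD//; [|by apply: integrable01S => //; exact: integrable01Zl..].
    rewrite !RintegralZl//; [|exact: integrable01S..].
    rewrite -(Pp.2 a b a0 ab' b1) -(Pq.2 a b a0 ab' b1) -/v1 -/v2 /n.
    by ring.
  have -> : n + S * (V b - V a) = \int[mu]_(t in `[a, b])
     (n / S * enorm (dx g t) + S * ((wp t ^+ 2 + wq t ^+ 2) / enorm (dx g t))).
    have is' := Ps.1; have iV := PV.1.
    rewrite RintegralD//; [|by apply: integrable01S => //; exact: integrable01Zl..].
    rewrite !RintegralZl//; [|exact: integrable01S..].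
    by rewrite -PV.2// -Ps.2// -/S divfK// gt_eqF.
  apply: le_Rintegral01 => //.
  - by apply: integrable01D; apply: integrable01Zl; [exact: Pp.1|exact: Pq.1].
  - by apply: integrable01D; apply: integrable01Zl; [exact: Ps.1|exact: PV.1].
  move=> t /andP[t1 t2]; have rt : 0 < enorm (dx g t) by apply: r0; rewrite /in01; lra.
  set r := enorm _ in rt *.
  rewrite -subr_ge0 (_ : _ - _ = ((r * v1 - S * wp t) ^+ 2 + (r * v2 - S * wq t) ^+ 2) / (r * S)).
    by rewrite divr_ge0 ?addr_ge0 ?sqr_ge0// ltW// mulr_gt0.
  by rewrite /n; field; rewrite !gt_eqF.
by lra.
Qed.

(** The curve is reparametrized by y = s / L, with [si] inverting arc length. In this parameter
    |T'(y)|^2 dy = L |tau'|^2 / r dx, which explains the factor [L] in [var] and makes [var_energy]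
    an equality here. *)
Lemma curve_to_data g : regular g -> H2 g ->
  (int_ds g (fun x => curvature g x ^+ 2 + 1)%R < +oo)%E ->
  exists D : curve_data R,
  [/\ valid_curve D, 0 < len D,
      (nrg D)%:E = int_ds g (fun x => curvature g x ^+ 2 + 1),
      [/\ tx D 0 = tau g 0 0 0, ty D 0 = tau g 0 0 1,
        tx D 1 = tau g 1 0 0 & ty D 1 = tau g 1 0 1]
    & len D * px D 1 = g 1 0 0 - g 0 0 0 /\ len D * py D 1 = g 1 0 1 - g 0 0 1].
Proof.
move=> rg H2g fin.
have [wp Pp] := tangent_primitive 0 rg H2g.
have [wq Pq] := tangent_primitive 1 rg H2g.
have iW := integrable01_sqr_quotient_tangent rg H2g Pp Pq fin.
have [c c0 [cr [wr Pr]]] := speed_primitive rg H2g.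
have ir := integrable01_cont (primitive01_continuous Pr).
pose s x := \int[mu]_(t in `[0, x]) enorm (dx g t).
pose V x := \int[mu]_(t in `[0, x]) ((wp t ^+ 2 + wq t ^+ 2) / enorm (dx g t)).
have Ps : primitive01 s (fun x => enorm (dx g x)) by exact: primitive01_Rintegral.
have PV : primitive01 V (fun x => (wp x ^+ 2 + wq x ^+ 2) / enorm (dx g x)).
  exact: primitive01_Rintegral.
have s0 : s 0 = 0 by rewrite /s set_itv1 Rintegral_set1.
have V0 : V 0 = 0 by rewrite /V set_itv1 Rintegral_set1.
have smono : nondecr01 s by apply: (primitive01_nondecr Ps) => t _; exact: enorm_ge0.
have Vmono : nondecr01 V.
  apply: (primitive01_nondecr PV) => t _; rewrite divr_ge0 ?enorm_ge0//.
  by rewrite addr_ge0// sqr_ge0.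
have sstrict a b : 0 <= a -> a < b -> b <= 1 -> s a < s b.
  move=> a0 ab b1; have ab' := ltW ab; rewrite -subr_gt0 Ps.2//.
  rewrite (@lt_le_trans _ _ (c * (b - a)))//; first by rewrite mulr_gt0// subr_gt0.
  rewrite -Rintegral_cst_itv//; apply: le_Rintegral01 => //.
  - by apply: integrable01_cont; exact: cont01_cst.
  - by move=> t /andP[t1 t2]; apply: cr; rewrite /in01; lra.
pose L := s 1.
have L0 : 0 < L by rewrite -s0; apply: sstrict.
have inv y : exists x, in01 y -> in01 x /\ s x = L * y.
  have [yin|yin] := boolP (in01 y); last by exists 0.
  have [|x xin sx] := IVT (@ler01 R) (primitive01_continuous Ps) (_ : _ <= L * y <= _).
    have L1 := ltW L0; rewrite s0 -/L min_l// max_r//.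
    by move: yin => /andP[y0 y1]; rewrite mulr_ge0//= ler_piMr.
  by exists x => _; split => //; move: xin; rewrite in_itv.
have [si Hsi] := choice inv.
have siin y : in01 y -> in01 (si y) by move=> /Hsi[].
have ssi y : in01 y -> s (si y) = L * y by move=> /Hsi[].
have simono y z : in01 y -> in01 z -> y <= z -> si y <= si z.
  move=> yin zin yz; rewrite leNgt; apply/negP => H.
  have /andP[z0 _] := siin z zin; have /andP[_ y1] := siin y yin.
  have := sstrict _ _ z0 H y1; rewrite !ssi// ltr_pM2l//; lra.
have in0 : in01 (0 : R) by rewrite /in01; lra.
have in1 : in01 (1 : R) by rewrite /in01; lra.
have si0 : si 0 = 0.
  have /andP[a0 a1] := siin 0 in0; apply/eqP; rewrite eq_le a0 andbT leNgt.
  by apply/negP => H; have := sstrict _ _ (lexx _) H a1; rewrite ssi// mulr0 s0 ltxx.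
have si1 : si 1 = 1.
  have /andP[a0 a1] := siin 1 in1; apply/eqP; rewrite eq_le a1 /= leNgt.
  by apply/negP => H; have := sstrict _ _ a0 H (lexx _); rewrite ssi// mulr1 ltxx.
have TV := tangent_increment rg H2g Pp Pq Ps PV.
(* The quantity squared on the left is the integral of tau(t) - tau(a) against arc length, and [TVj]
   bounds that difference by the square root of (s b - s a) V(1). *)
have chord j w : primitive01 (fun t => tau g t 0 j) w ->
    (forall a b, 0 <= a -> a <= b -> b <= 1 ->
       (tau g b 0 j - tau g a 0 j) ^+ 2 <= (s b - s a) * (V b - V a)) ->
    forall a b, 0 <= a -> a <= b -> b <= 1 ->
    (g b 0 j - g a 0 j - (s b - s a) * tau g a 0 j) ^+ 2 <= (s b - s a) ^+ 3 * V 1.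
  move=> Pj TVj a b a0 ab b1.
  have Pg : primitive01 (fun t => g t 0 j) (fun t => dx g t 0 j).
    by apply: FTC01 => [x xin|]; [exact: regular_deriv01|exact: dx_coord_continuous].
  have ds0 : 0 <= s b - s a by rewrite subr_ge0 smono.
  have V1 : 0 <= V 1 by rewrite -V0; apply: Vmono.
  pose M := Num.sqrt ((s b - s a) * V 1).
  have SV0 : 0 <= (s b - s a) * V 1 by rewrite mulr_ge0.
  have -> : (s b - s a) ^+ 3 * V 1 = (M * (s b - s a)) ^+ 2.
    by rewrite exprMn sqr_sqrtr//; ring.
  rewrite -[leLHS]real_normK ?num_real//; apply: lerXn2r; rewrite ?nnegrE//.
    by rewrite mulr_ge0// sqrtr_ge0.
  rewrite (Pg.2 a b)// (Ps.2 a b)// mulrC -RintegralZl//; last exact: integrable01S.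
  apply: Rintegral01_close => //; [exact: Pg.1|exact: integrable01Zl|].
  move=> t /andP[t1 t2].
  have tin : in01 t by rewrite /in01; lra.
  have r0 : 0 < enorm (dx g t) by apply/enorm_neq0_gt0/regular_neq0.
  have -> : dx g t 0 j = tau g t 0 j * enorm (dx g t).
    by rewrite /tau /ds !mxE mulrAC mulVf ?mul1r// gt_eqF.
  rewrite -mulrBl normrM (ger0_norm (ltW r0)) ler_wpM2r ?(ltW r0)//.
  rewrite -sqrtr_sqr; apply: ler_wsqrtr.
  apply: le_trans (TVj a t a0 t1 (le_trans t2 b1)) _.
  apply: ler_pM.
  - by rewrite subr_ge0 smono//; lra.
  - by rewrite subr_ge0 Vmono//; lra.
  - by rewrite lerD2r smono//; lra.
  - have : V t <= V 1 by apply: Vmono; lra.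
    have : V 0 <= V a by apply: Vmono; lra.
    by rewrite V0; lra.
have TV0 a b : 0 <= a -> a <= b -> b <= 1 ->
    (tau g b 0 0 - tau g a 0 0) ^+ 2 <= (s b - s a) * (V b - V a).
  move=> a0 ab b1; apply: le_trans (TV a b a0 ab b1); rewrite lerDl; exact: sqr_ge0.
have TV1 a b : 0 <= a -> a <= b -> b <= 1 ->
    (tau g b 0 1 - tau g a 0 1) ^+ 2 <= (s b - s a) * (V b - V a).
  move=> a0 ab b1; apply: le_trans (TV a b a0 ab b1); rewrite lerDr; exact: sqr_ge0.
have ch0 := chord 0 _ Pp TV0; have ch1 := chord 1 _ Pq TV1.
have Ln0 : L != 0 by rewrite gt_eqF.
exists (CurveData L (V 1 + L) (fun y => tau g (si y) 0 0) (fun y => tau g (si y) 0 1)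
  (fun y => (g (si y) 0 0 - g 0 0 0) / L) (fun y => (g (si y) 0 1 - g 0 0 1) / L)
  (fun y => L * V (si y))).
have resc j : (forall a b, 0 <= a -> a <= b -> b <= 1 ->
    (g b 0 j - g a 0 j - (s b - s a) * tau g a 0 j) ^+ 2 <= (s b - s a) ^+ 3 * V 1) ->
    forall x y, 0 <= x -> x <= y -> y <= 1 ->
    ((g (si y) 0 j - g 0 0 j) / L - (g (si x) 0 j - g 0 0 j) / L
       - (y - x) * tau g (si x) 0 j) ^+ 2 <= (y - x) ^+ 3 * (L * V 1).
  move=> H x y x0 xy y1.
  have xin : in01 x by rewrite /in01; lra.
  have yin : in01 y by rewrite /in01; lra.
  have /andP[sx0 _] := siin x xin; have /andP[_ sy1] := siin y yin.
  have := H _ _ sx0 (simono _ _ xin yin xy) sy1; rewrite !ssi// => K.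
  rewrite (_ : _ - _ - _ = (g (si y) 0 j - g (si x) 0 j - (L * y - L * x) * tau g (si x) 0 j) / L); last by field.
  rewrite expr_div_n ler_pdivrMr ?exprn_gt0//; apply: le_trans K _.
  by rewrite le_eqVlt; apply/orP; left; apply/eqP; ring.
split; [|exact: L0| | |].
- constructor => /=.
  + exact: ltW.
  + move=> x xin; have sin := siin x xin.
    have r0 : 0 < enorm (dx g (si x)) by apply/enorm_neq0_gt0/regular_neq0.
    rewrite /tau /ds !mxE !exprMn -mulrDr.
    have <- : enorm (dx g (si x)) ^+ 2 = dx g (si x) 0 0 ^+ 2 + dx g (si x) 0 1 ^+ 2.
      by rewrite sqr_sqrtr// addr_ge0// sqr_ge0.
    by rewrite -exprMn mulVf ?expr1n// gt_eqF.
  + by rewrite si0 V0 mulr0.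
  + move=> x y x0 xy y1; rewrite ler_pM2l//.
    have xin : in01 x by rewrite /in01; lra.
    have yin : in01 y by rewrite /in01; lra.
    have /andP[sx0 _] := siin x xin; have /andP[_ sy1] := siin y yin.
    by apply: Vmono => //; exact: simono.
  + move=> x y x0 xy y1.
    have xin : in01 x by rewrite /in01; lra.
    have yin : in01 y by rewrite /in01; lra.
    have /andP[sx0 _] := siin x xin; have /andP[_ sy1] := siin y yin.
    apply: le_trans (TV _ _ sx0 (simono _ _ xin yin xy) sy1) _.
    by rewrite !ssi// le_eqVlt; apply/orP; left; apply/eqP; ring.
  + by rewrite si0 !subrr !mul0r.
  + by rewrite si1; exact: resc.
  + by rewrite si1; exact: resc.
  + by rewrite si1 addrK.
  + by rewrite lerDr -V0; apply: Vmono.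
- rewrite /= (energy_tangent rg H2g Pp Pq) /L /V /s.
  rewrite -RintegralD//.
  rewrite /Rintegral fineK//.
  by apply: integrable_fin_num => //; exact: integrable01D.
- by rewrite /= si0 si1.
- by rewrite /= si1; split; rewrite mulrC divfK.
Qed.

End ConstantSpeed.

(** * L2 derivatives of limits *)

Section UltraLimits.
Variables (R : realType) (U : set_system nat).
Hypothesis UU : UltraFilter U.
Implicit Types (a b : nat -> R) (l M : R).

(** The image ultrafilter clusters at some [l] of a compact interval. If it missed a neighbourhood
    of [l], it would contain the complement, which contradicts clustering. *)
Lemma ultra_bounded_cvg a M : (forall n, `|a n| <= M) ->
  exists l, a @ U --> l.
Proof.
move=> aM; have cK := @segment_compact R (- M) M.
have Ua : U (a @^-1` `[- M, M]).
  by apply: filterE => n; rewrite /= in_itv /= -ler_norml.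
have [l [lin cl]] := cK (a @ U) _ Ua.
exists l => B Bl.
have [//|H] := in_ultra_setVsetC (a @^-1` B) UU.
by have [x [/= ]] := cl (~` B) B H Bl.
Qed.

End UltraLimits.

Lemma free_ultrafilter : exists U : set_system nat, UltraFilter U /\ \oo `<=` U.
Proof. exact: ultraFilterLemma. Qed.

(** * Limits of L2-bounded sequences as absolutely continuous charges *)

Section WeakLimit.
Variable R : realType.
Local Notation mu := (@lebesgue_measure R).
Variables (p : R -> R) (w : nat -> R -> R) (C : R).
Hypothesis C0 : 0 <= C.
Hypothesis iw : forall n, integrable01 (w n).
Hypothesis iw2 : forall n, integrable01 (fun x => w n x ^+ 2).
Hypothesis wC : forall n, \int[mu]_(x in `[0, 1]) (w n x ^+ 2) <= C.
Hypothesis wp : forall a, in01 a ->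
  \int[mu]_(x in `[0, a]) w n x @[n --> \oo] --> p a - p 0.

Local Notation T := (measurableTypeR R).
Local Notation I01 := (`[(0 : R), 1]%classic : set R).
Let m (A : set R) : R := fine (mu (A `&` I01)).

Let mI (A : set T) : measurable A -> measurable (A `&` I01 : set T).
Proof. by move=> mA; exact: measurableI. Qed.

Let mfin (A : set T) : measurable A -> (m A)%:E = mu (A `&` I01).
Proof.
move=> mA; rewrite /m fineK// ge0_fin_numE//.
apply: le_lt_trans (_ : (mu I01 < +oo)%E).
  by apply: le_measure; rewrite ?inE//; exact: mI.
by rewrite lebesgue_measure_itv /= lte_fin ltr01 -EFinD ltry.
Qed.

Let icst (c : R) : integrable01 (fun _ : R => c).
Proof. by apply: integrable01_cont; exact: cont01_cst. Qed.

Let iS f (A : set T) : measurable A -> integrable01 f -> mu.-integrable (A `&` I01) (EFin \o f).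
Proof. by move=> mA If; apply: integrableS If => //; exact: mI. Qed.

(** Young's inequality |w| <= l/2 + w^2 / (2l) with a free weight [l]: equi-integrability in a form
    without square roots. *)
Let bound n (A : set T) l : measurable A -> 0 < l ->
  `|\int[mu]_(x in A `&` I01) w n x| <= (l * m A + C / l) / 2.
Proof.
move=> mA l0.
apply: le_trans (le_normr_Rintegral _ _) _; [exact: mI|exact: iS|].
have i2 : integrable01 (fun x => l / 2 + (2 * l)^-1 * w n x ^+ 2).
  by apply: integrable01D; [exact: icst|exact: integrable01Zl].
apply: (@le_trans _ _ (\int[mu]_(x in A `&` I01) (l / 2 + (2 * l)^-1 * w n x ^+ 2))).
  apply: le_Rintegral; [exact: mI|apply: iS => //; exact: integrable01_norm|exact: iS|].
  move=> x _; rewrite -subr_ge0.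
  have -> : l / 2 + (2 * l)^-1 * w n x ^+ 2 - `|w n x| = (l - `|w n x|) ^+ 2 / (2 * l).
    by rewrite -(real_normK (num_real (w n x))); field; rewrite gt_eqF.
  by rewrite divr_ge0 ?sqr_ge0// mulr_ge0// ltW.
rewrite RintegralD; [|exact: mI|exact: iS|by apply: iS => //; exact: integrable01Zl].
rewrite (RintegralZl (2 * l)^-1); [|exact: mI|exact: iS].
rewrite Rintegral_cst; last exact: mI.
have : \int[mu]_(x in A `&` I01) (w n x ^+ 2) <= C.
  apply: le_trans (wC n); rewrite -lee_fin /Rintegral !fineK.
  - apply: ge0_subset_integral => //; first exact: mI.
      by have /measurable_int := iw2 n.
    by move=> x _; rewrite lee_fin sqr_ge0.
  - by apply: integrable_fin_num => //; exact: iw2.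
  - by apply: integrable_fin_num; [exact: mI|exact: iS].
rewrite -/(m A) => H.
have -> : (l * m A + C / l) / 2 = l / 2 * m A + (2 * l)^-1 * C by field; rewrite gt_eqF.
by rewrite lerD2l ler_wpM2l// invr_ge0 mulr_ge0// ltW.
Qed.

Let U := projT1 (cid free_ultrafilter).
Let UU : UltraFilter U. Proof. by rewrite /U; case: cid => ? []. Qed.
Let oU : \oo `<=` U. Proof. by rewrite /U; case: cid => ? []. Qed.

Let FU : ProperFilter U. Proof. exact: ultra_proper. Qed.
Local Existing Instance FU.

(** Along a free ultrafilter the limit exists for all measurable sets at once. Finite additivity is
    inherited from the integrals; countable additivity and absolute continuity come from
    [lam_bound]. *)
Let lam (A : set R) : R := lim (\int[mu]_(x in A `&` I01) w n x @[n --> U]).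

Let lam_cvg (A : set T) : measurable A ->
  \int[mu]_(x in A `&` I01) w n x @[n --> U] --> lam A.
Proof.
move=> mA; have [l Hl] := @ultra_bounded_cvg R U UU
  (fun n => \int[mu]_(x in A `&` I01) w n x) ((1 * m A + C / 1) / 2) (fun n => bound n mA ltr01).
by rewrite /lam (cvg_lim (@Rhausdorff R) Hl).
Qed.

Let lam_bound (A : set T) l : measurable A -> 0 < l -> `|lam A| <= (l * m A + C / l) / 2.
Proof.
move=> mA l0.
have H : `|\int[mu]_(x in A `&` I01) w n x| @[n --> U] --> `|lam A|.
  by apply: cvg_norm; exact: lam_cvg.
apply: (cvgr_to_le H); apply: filterE => n; exact: bound.
Qed.

Let lamU (A B : set T) : measurable A -> measurable B -> A `&` B = set0 ->
  lam (A `|` B) = lam A + lam B.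
Proof.
move=> mA mB AB.
have mAB : measurable (A `|` B) by exact: measurableU.
have E n : \int[mu]_(x in A `&` I01) w n x + \int[mu]_(x in B `&` I01) w n x =
    \int[mu]_(x in (A `|` B) `&` I01) w n x.
  rewrite setIUl Rintegral_setU//; [exact: mI|exact: mI| |].
  - by rewrite -setIUl; exact: iS.
  - apply/disj_setPS => x [[Ax _] [Bx _]].
    by have : (A `&` B) x by []; rewrite AB.
have H : \int[mu]_(x in (A `|` B) `&` I01) w n x @[n --> U] --> lam A + lam B.
  by under eq_fun do rewrite -E; apply: cvgD; exact: lam_cvg.
by rewrite /lam (cvg_lim (@Rhausdorff R) H).
Qed.

Let lam0 : lam set0 = 0.
Proof.
have := lamU (@measurable0 _ T) (@measurable0 _ T) (set0I _).
by rewrite setU0 => /eqP; rewrite -subr_eq0 opprD addrA subrr add0r oppr_eq0 => /eqP.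
Qed.

Let nu (A : set T) : \bar R := (lam A)%:E.

Let lam_bigsetU (F : nat -> set T) n : (forall i, measurable (F i)) -> trivIset setT F ->
  lam (\big[setU/set0]_(i < n) F i) = \sum_(i < n) lam (F i).
Proof.
move=> mF tF; elim: n => [|n IH]; first by rewrite !big_ord0 lam0.
rewrite !big_ord_recr /= lamU ?IH//; first exact: bigsetU_measurable.
rewrite -bigcup_mkord; apply/seteqP; split => // x [[i /= ni Fi] Fn].
have := tF i n I I (ex_intro _ x (conj Fi Fn)) => /eqP.
by rewrite ltn_eqF.
Qed.

(** The tails [G n] decrease to the empty set, so their measure tends to 0, and [lam_bound]
    transfers this to [lam]. *)
Let nu_sigma : semi_sigma_additive nu.
Proof.
move=> F mF tF mUF.
have mB n : measurable (\big[setU/set0]_(i < n) F i : set T) by exact: bigsetU_measurable.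
pose G n : set T := \bigcup_i F i `\` \big[setU/set0]_(i < n) F i.
have mG n : measurable (G n) by exact: measurableD.
have E n : \sum_(0 <= i < n) lam (F i) = lam (\bigcup_i F i) - lam (G n).
  rewrite big_mkord -lam_bigsetU//.
  have sub : \big[setU/set0]_(i < n) F i `<=` \bigcup_i F i.
    by rewrite -bigcup_mkord; apply: bigcup_sub => i _; exact: bigcup_sup.
  have -> : \bigcup_i F i = (\big[setU/set0]_(i < n) F i) `|` G n.
    by rewrite /G setDUK.
  by rewrite lamU//; [ring|rewrite /G setDIK].
have mG0 : m (G n) @[n --> \oo] --> 0.
  have : mu (G n `&` I01) @[n --> \oo] --> mu (\bigcap_n (G n `&` I01)).
    apply: nonincreasing_cvg_mu.
    - rewrite (_ : (mu (G 0%N `&` I01) < +oo)%E)//.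
      by rewrite -mfin// ltry.
    - by move=> n; exact: mI.
    - by apply: bigcap_measurable => // n _; exact: mI.
    - move=> i j ij; apply/subsetPset; apply: setSI; apply: setDS.
      exact: (@subset_bigsetU _ F).
  rewrite (_ : \bigcap_n _ = set0) ?measure0; last first.
    apply/seteqP; split => // x Gx.
    have [[k _ Fx] _] := (Gx 0%N I).1.
    have [[_ nF] _] := Gx k.+1 I; apply: nF.
    by rewrite -bigcup_mkord; exists k => //=.
  move/fine_cvgP => [_]; apply: cvg_trans; apply: near_eq_cvg; apply: nearW => n.
  by [].
have lG0 : lam (G n) @[n --> \oo] --> 0.
  apply/cvgrPdist_le => e e0; rewrite /=.
  (* This weight makes C / l at most [e], and l m(G n) <= e holds for large [n]; half the sum is
     then at most [e]. *)
  pose l := (C + 1) / e.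
  have l0 : 0 < l by rewrite divr_gt0// ltr_wpDl.
  have el : 0 < e / l by rewrite divr_gt0.
  move/cvgrPdist_le : mG0 => /(_ _ el); apply: filterS => n.
  rewrite !sub0r !normrN => mGn.
  apply: le_trans (lam_bound (mG n) l0) _.
  have A1 : l * m (G n) <= e.
    rewrite mulrC -ler_pdivlMr//; exact: le_trans (ler_norm _) mGn.
  have A2 : C / l <= e.
    by rewrite ler_pdivrMr// /l mulrCA divff ?gt_eqF// mulr1; lra.
  by rewrite ler_pdivrMr//; lra.
rewrite /nu; under eq_fun do rewrite sumEFin E.
apply: cvg_EFin; first by apply: nearW.
rewrite -[X in _ --> X]subr0.
by apply: cvgB => //; exact: cvg_cst.
Qed.

HB.instance Definition _ := isCharge.Build _ T R nu (congr1 EFin lam0)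
  (fun _ _ => isT) nu_sigma.

Let nu_dom : nu `<< mu.
Proof.
move=> N N0 A mA AN.
have mA0 : m A = 0.
  rewrite /m (_ : mu (A `&` I01) = 0)//; apply/eqP; rewrite -measure_le0.
  by rewrite -(N0 A mA AN) le_measure// inE//; exact: mI.
rewrite /nu; congr EFin; apply/eqP; rewrite -normr_le0; apply/ler_addgt0Pr => e e0.
rewrite add0r.
have l0 : 0 < (C + 1) / e by rewrite divr_gt0// ltr_wpDl.
apply: le_trans (lam_bound mA l0) _; rewrite mA0 mulr0 add0r.
have A2 : C / ((C + 1) / e) <= e.
  by rewrite ler_pdivrMr// mulrCA divff ?gt_eqF// mulr1; lra.
by rewrite ler_pdivrMr//; lra.
Qed.

(** The density is the Radon-Nikodym derivative of the limiting charge, whose value on [a,b] is p b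
    - p a by [wp], since the ultrafilter refines convergence at infinity. *)
Lemma weak_limit_primitive : exists z, primitive01 p z.
Proof.
have intT := Radon_Nikodym_integrable nu_dom.
have rep (A : set T) := @Radon_Nikodym_integral _ T R nu mu A nu_dom.
have fin x := Radon_Nikodym_fin_num x nu_dom.
set D := Radon_Nikodym nu mu in intT rep fin.
have ED : EFin \o (fine \o D) = D by apply/funext => x /=; rewrite fineK.
exists (fine \o D); split.
  by rewrite /integrable01 ED; apply: integrableS intT.
move=> a b a0 ab b1.
have -> : \int[mu]_(x in `[a, b]) (fine \o D) x = lam `[a, b].
  rewrite /Rintegral; have -> : (\int[mu]_(x in `[a, b]) ((fine \o D) x)%:E)%E = nu `[a, b].
    by rewrite rep//; apply: eq_integral => x _; rewrite -[in RHS]ED.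
  by [].
have E n : \int[mu]_(x in `[a, b] `&` I01) w n x =
    \int[mu]_(x in `[0, b]) w n x - \int[mu]_(x in `[0, a]) w n x.
  rewrite setIidl; last exact: sub_dom.
  by rewrite (@Rintegral_split _ _ 0 a b)//; ring.
suff H : \int[mu]_(x in `[a, b] `&` I01) w n x @[n --> U] --> p b - p a.
  by rewrite /lam (cvg_lim (@Rhausdorff R) H).
under eq_fun do rewrite E.
rewrite (_ : p b - p a = (p b - p 0) - (p a - p 0)); last by ring.
apply: cvgB; (apply: cvg_trans; last apply: wp).
- exact: cvg_app oU.
- by rewrite /in01; lra.
- exact: cvg_app oU.
- by rewrite /in01; lra.
Qed.

End WeakLimit.

(** * Difference quotients on uniform partitions *)

Section StepFunctions.
Variable R : realType.
Implicit Types (p V : R -> R) (c : nat -> R) (x y a e : R).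
Local Notation mu := (@lebesgue_measure R).

(** The partition has [N.+1] cells, which keeps the denominator nonzero; as the cells of [step] are
    half open, [step] is 0 at the point 1. *)
Definition node (N k : nat) : R := k%:R / N.+1%:R.

Definition step N c x : R :=
  \sum_(k < N.+1) c k * ((node N k <= x) && (x < node N k.+1))%:R.

Lemma node0 N : node N 0 = 0. Proof. by rewrite /node mul0r. Qed.

Lemma node_last N : node N N.+1 = 1.
Proof. by rewrite /node divff// pnatr_eq0. Qed.

Lemma nodeS N k : node N k.+1 = node N k + N.+1%:R^-1.
Proof. by rewrite /node -natr1 mulrDl mul1r. Qed.

Lemma ler_node N i j : (i <= j)%N -> node N i <= node N j.
Proof. by move=> ij; rewrite /node ler_wpM2r ?invr_ge0// ler_nat. Qed.

Lemma node_ge0 N k : 0 <= node N k.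
Proof. by rewrite -(node0 N) ler_node. Qed.

Lemma node_le1 N k : (k <= N.+1)%N -> node N k <= 1.
Proof. by move=> kN; rewrite -(node_last N) ler_node. Qed.

Lemma step_val N c k x : (k < N.+1)%N -> node N k <= x < node N k.+1 ->
  step N c x = c k.
Proof.
move=> kN /[dup] xk /andP[kx xk1]; rewrite /step (bigD1 (Ordinal kN))//= xk mulr1.
rewrite big1 ?addr0// => i ik; have {}ik : (i : nat) != k.
  by apply: contra ik => /eqP ik; apply/eqP/val_inj.
case: ltngtP ik => // ik _.
  rewrite (ltNge x) (le_trans (ler_node N ik) kx) andbF mulr0//.
by rewrite (leNgt _ x) (lt_le_trans xk1 (ler_node N ik)) mulr0.
Qed.

Lemma step_integrable N c : integrable01 (step N c).
Proof.
have I k : integrable01 (fun x => ((node N k <= x) && (x < node N k.+1))%:R : R).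
  rewrite (_ : (fun x => _) = \1_(`[node N k, node N k.+1[)); last first.
    by apply/funext => x; rewrite indicE mem_setE in_itv.
  apply: measurable_bounded_integrable => //.
  - have : (mu `[0%R, 1%R]%classic < +oo)%E by rewrite lebesgue_measure_itv /= lte_fin ltr01 -EFinD ltry.
    by [].
  - exists 1; split; first exact: num_real.
    move=> M M1 x _ /=; rewrite ger0_norm// indicE.
    by apply: le_trans (ltW M1); case: (_ \in _).
rewrite /step; elim: N.+1 => [|n IH].
  by under eq_fun do rewrite big_ord0; apply: integrable01_cont; exact: cont01_cst.
under eq_fun do rewrite big_ord_recr /=.
by apply: integrable01D => //; exact: integrable01Zl.
Qed.

Lemma step_sqr N c : (fun x => step N c x ^+ 2) = step N (fun k => c k ^+ 2).
Proof.
apply/funext => x.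
have [[k kN kx]|H] := pselect (exists2 k, (k < N.+1)%N & node N k <= x < node N k.+1).
  have E c' := @step_val N c' k x kN kx.
  by rewrite (E c) (E (fun k => c k ^+ 2)).
have Z c' : step N c' x = 0.
  rewrite /step big1// => k _.
  by case: (boolP (_ && _)) => kx; [case: H; exists k|rewrite mulr0].
by rewrite !Z expr0n.
Qed.

Lemma step_Rintegral N c k a : (k < N.+1)%N -> node N k <= a <= node N k.+1 ->
  \int[mu]_(x in `[node N k, a]) step N c x = c k * (a - node N k).
Proof.
move=> kN /andP[ka ak].
have n1 := node_le1 kN.
rewrite -Rintegral_itv_bndo_bndc; last first.
  apply: integrableS (step_integrable N c) => //.
  by apply: subset_itvScc; rewrite bnd_simp ?node_ge0//; lra.
rewrite -(Rintegral_cst_itv (c k) ka) -[RHS]Rintegral_itv_bndo_bndc; last first.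
  apply: (@integrableS _ _ _ mu `[0, 1]) => //.
    by apply: subset_itvScc; rewrite bnd_simp ?node_ge0//; lra.
  by apply: integrable01_cont; exact: cont01_cst.
apply: eq_Rintegral => x; rewrite inE /= in_itv /= => /andP[kx xa].
by rewrite (step_val _ kN)// kx (lt_le_trans xa).
Qed.

Variables (p q V : R -> R).
Hypothesis Vmono : nondecr01 V.
Hypothesis pqV : forall x y, 0 <= x -> x <= y -> y <= 1 ->
  (p y - p x) ^+ 2 + (q y - q x) ^+ 2 <= (y - x) * (V y - V x).

Let pV x y : 0 <= x -> x <= y -> y <= 1 ->
  (p y - p x) ^+ 2 <= (y - x) * (V y - V x).
Proof. by move=> x0 xy y1; apply: le_trans (pqV x0 xy y1); rewrite lerDl sqr_ge0. Qed.

(** [step N (slope f N)] is the derivative of the piecewise affine interpolation of [f] at the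
    nodes. *)
Definition slope (f : R -> R) N k : R := N.+1%:R * (f (node N k.+1) - f (node N k)).

Lemma slope_Rintegral (f : R -> R) N k : (k <= N.+1)%N ->
  \int[mu]_(x in `[0, node N k]) step N (slope f N) x = f (node N k) - f 0.
Proof.
elim: k => [|k IH] kN; first by rewrite node0 set_itv1 Rintegral_set1 subrr.
rewrite (@Rintegral_split _ _ 0 (node N k)) ?IH ?node_ge0 ?node_le1//; first last.
- exact: ler_node.
- exact: step_integrable.
- exact: ltnW.
rewrite step_Rintegral// ?lexx ?ler_node//.
have -> : node N k.+1 - node N k = N.+1%:R^-1 by rewrite nodeS; ring.
rewrite /slope.
by field; rewrite nat1r pnatr_eq0.
Qed.

(** On one cell the squared slopes integrate to the squared increments divided by the mesh, at most
    the increment of [V] by [pqV]; these bounds telescope. *)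
Lemma slope_sqr_Rintegral N k : (k <= N.+1)%N ->
  \int[mu]_(x in `[0, node N k]) (step N (slope p N) x ^+ 2) +
  \int[mu]_(x in `[0, node N k]) (step N (slope q N) x ^+ 2) <= V (node N k) - V 0.
Proof.
have E f : (fun x => step N (slope f N) x ^+ 2) = step N (fun k => slope f N k ^+ 2).
  exact: step_sqr.
rewrite !E; elim: k => [|k IH] kN; first by rewrite node0 set_itv1 !Rintegral_set1 addr0 subrr.
have D f : \int[mu]_(x in `[0, node N k.+1]) step N (fun k => slope f N k ^+ 2) x =
    \int[mu]_(x in `[0, node N k]) step N (fun k => slope f N k ^+ 2) x +
    N.+1%:R * (f (node N k.+1) - f (node N k)) ^+ 2.
  rewrite (@Rintegral_split _ _ 0 (node N k)) ?node_ge0 ?node_le1//; first last.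
  - exact: ler_node.
  - exact: step_integrable.
  rewrite step_Rintegral// ?lexx ?ler_node//; congr (_ + _).
  have -> : node N k.+1 - node N k = N.+1%:R^-1 by rewrite nodeS; ring.
  by rewrite /slope; field; rewrite nat1r pnatr_eq0.
rewrite !D; have := IH (ltnW kN).
have N0 : 0 < N.+1%:R^-1 :> R by rewrite invr_gt0.
have := pqV (node_ge0 N k) (ler_node N (leqnSn k)) (node_le1 kN).
have -> : node N k.+1 - node N k = N.+1%:R^-1 by rewrite nodeS; ring.
rewrite mulrC -ler_pdivrMr// invrK mulrC => K.
by lra.
Qed.

(** The integral is exact at the nodes. The last, partial cell costs at most two increments of [p],
    small because [p] is Hölder continuous with exponent 1/2. *)
Lemma slope_cvg a : in01 a ->
  \int[mu]_(x in `[0, a]) step n (slope p n) x @[n --> \oo] --> p a - p 0.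
Proof.
move=> ain; have /andP[a0 a1] := ain.
pose K := V 1 - V 0.
have K0 : 0 <= K by rewrite subr_ge0 Vmono.
have VK x y : 0 <= x -> x <= y -> y <= 1 -> V y - V x <= K.
  move=> x0 xy y1; have := @Vmono 0 x; have := @Vmono y 1; rewrite /K.
  by move=> /(_ ltac:(lra) y1 (lexx _)) + /(_ (lexx _) x0 ltac:(lra)); lra.
apply/cvgrPdist_le => e e0.
(* A mesh below this number, multiplied by [K], is at most (e / 2)^2; adding 1 covers K = 0. *)
have e2 : 0 < e ^+ 2 / (4 * (K + 1)) by rewrite divr_gt0 ?exprn_gt0// mulr_gt0//; lra.
have := @near_infty_natSinv_lt R (PosNum e2); apply: filterS => n /= ne.
have n0 : (0 : R) < n.+1%:R by [].
have small x y : 0 <= x -> x <= y -> y <= 1 -> y - x <= n.+1%:R^-1 -> `|p y - p x| <= e / 2.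
  move=> x0 xy y1 yx; have := pV x0 xy y1 => H.
  have e20 : 0 <= e / 2 by lra.
  rewrite -(ger0_norm e20) -ler_sqr ?nnegrE// !real_normK ?num_real//.
  apply: le_trans H _.
  apply: (@le_trans _ _ (n.+1%:R^-1 * K)).
    by apply: ler_pM => //; [lra|rewrite subr_ge0 Vmono|exact: VK].
  apply: (@le_trans _ _ (e ^+ 2 / (4 * (K + 1)) * K)).
    by rewrite ler_wpM2r// ltW.
  have -> : (e / 2) ^+ 2 = e ^+ 2 / (4 * (K + 1)) * (K + 1) by field; rewrite gt_eqF//; lra.
  by rewrite ler_wpM2l ?(ltW e2)//; lra.
pose k := Num.truncn (n.+1%:R * a).
have na0 : 0 <= n.+1%:R * a by rewrite mulr_ge0.
have /andP[k1 k2] := truncn_itv na0.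
have xk : node n k <= a by rewrite /node ler_pdivrMr// mulrC.
have xk1 : a < node n k.+1 by rewrite /node ltr_pdivlMr// mulrC.
have kn : (k <= n.+1)%N.
  rewrite -(ler_nat R) (le_trans k1)// ler_piMr//.
rewrite (@Rintegral_split _ _ 0 (node n k)) ?node_ge0//; last exact: step_integrable.
rewrite slope_Rintegral//.
(* The index of the last node has no cell; it occurs only for a = 1. *)
move: kn; rewrite leq_eqVlt => /predU1P[kE|kn].
  have aE : a = node n k by apply/eqP; rewrite eq_le xk andbT kE node_last.
  by rewrite -aE set_itv1 Rintegral_set1 addr0 subrr normr0 ltW.
rewrite step_Rintegral ?xk ?(ltW xk1)//.
rewrite (_ : _ - _ = (p a - p (node n k)) - slope p n k * (a - node n k)); last by ring.
rewrite (le_trans (ler_normB _ _))// (splitr e) lerD//.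
  by apply: small => //; [exact: node_ge0|rewrite lerBlDl -nodeS ltW].
have B : `|p (node n k.+1) - p (node n k)| <= e / 2.
  apply: small; [exact: node_ge0|exact: ler_node|exact: node_le1|].
  by rewrite lerBlDl -nodeS.
have nn : 0 <= a - node n k by rewrite subr_ge0.
rewrite /slope normrM normrM (ger0_norm (ltW n0)) (ger0_norm nn).
rewrite mulrAC -[leRHS]mul1r; apply: ler_pM => //; first by rewrite mulr_ge0 ?(ltW n0)//; lra.
by rewrite -ler_pdivlMl// mulr1 lerBlDl -nodeS ltW.
Qed.

(** The slopes are bounded in L2 by [slope_sqr_Rintegral], so [weak_limit_primitive] applies. The
    square bound on the density itself is left to [fatou_energy]. *)
Lemma energy_primitive : exists z, primitive01 p z.
Proof.
apply: (@weak_limit_primitive R p (fun n => step n (slope p n)) (V 1 - V 0)).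
- by rewrite subr_ge0 Vmono.
- by move=> n; exact: step_integrable.
- by move=> n; rewrite step_sqr; exact: step_integrable.
- move=> n; have := slope_sqr_Rintegral (leqnn n.+1); rewrite node_last.
  apply: le_trans; rewrite lerDl; apply: Rintegral_ge0 => x _; exact: sqr_ge0.
- exact: slope_cvg.
Qed.

End StepFunctions.

(** * Fatou's lemma for the difference quotients *)

Section FatouEnergy.
Variable R : realType.
Implicit Types (p q V z : R -> R) (x y a e l : R).
Local Notation mu := (@lebesgue_measure R).

(** The cell containing [x] shrinks to it, and the errors of the expansion at its two ends add up to
    at most [e] times its length. *)
Lemma slope_deriv01 p x l : 0 < x < 1 -> deriv01 p x l ->
  step n (slope p n) x @[n --> \oo] --> l.
Proof.
move=> /andP[x0 x1] dp; apply/cvgrPdist_le => e e0.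
have [d d0 Hd] := dp e e0.
have := @near_infty_natSinv_lt R (PosNum d0); apply: filterS => n /= ne.
have n0 : (0 : R) < n.+1%:R by [].
pose k := Num.truncn (n.+1%:R * x).
have nx0 : 0 <= n.+1%:R * x by rewrite mulr_ge0// ltW.
have /andP[k1 k2] := truncn_itv nx0.
have xk : node R n k <= x by rewrite /node ler_pdivrMr// mulrC.
have xk1 : x < node R n k.+1 by rewrite /node ltr_pdivlMr// mulrC.
have kn : (k < n.+1)%N.
  by rewrite -(ltr_nat R) (le_lt_trans k1)// gtr_pMr.
rewrite (step_val _ kn) ?xk//.
have S : node R n k.+1 - node R n k = n.+1%:R^-1 by rewrite nodeS; ring.
have a0 := node_ge0 R n k; have b1 := @node_le1 R n k.+1 kn.
set a := node R n k in xk S a0 *; set b := node R n k.+1 in xk1 S b1 *.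
have ab0 : 0 < b - a by rewrite S invr_gt0.
move: ne; rewrite -S => ne.
have A : `|p a - p x - l * (a - x)| <= e * (x - a).
  have := Hd a; rewrite /in01 distrC (ger0_norm (_ : 0 <= x - a)) ?subr_ge0//.
  by apply; lra.
have B : `|p b - p x - l * (b - x)| <= e * (b - x).
  have xb := ltW xk1.
  have := Hd b; rewrite /in01 (ger0_norm (_ : 0 <= b - x)) ?subr_ge0//.
  by apply; lra.
rewrite /slope -/a -/b.
have -> : n.+1%:R = (b - a)^-1 by rewrite S invrK.
rewrite distrC.
rewrite (_ : _ - l = ((p b - p x - l * (b - x)) - (p a - p x - l * (a - x))) / (b - a)); last first.
  by field; rewrite gt_eqF.
rewrite normrM (ger0_norm (_ : 0 <= (b - a)^-1)) ?invr_ge0 ?(ltW ab0)//.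
rewrite ler_pdivrMr// (le_trans (ler_normB _ _))//.
by apply: le_trans (lerD B A) _; lra.
Qed.

(** The slopes converge almost everywhere to [zp] and [zq], while [slope_sqr_Rintegral] bounds the
    integrals of their squares by the increment of [V]. *)
Lemma fatou_energy p q zp zq V :
  nondecr01 V -> primitive01 p zp -> primitive01 q zq ->
  (forall x y, 0 <= x -> x <= y -> y <= 1 ->
    (p y - p x) ^+ 2 + (q y - q x) ^+ 2 <= (y - x) * (V y - V x)) ->
  (\int[mu]_(x in `[0%R, 1%R]) (zp x ^+ 2 + zq x ^+ 2)%:E <= (V 1 - V 0)%:E)%E.
Proof.
move=> Vm Pp Pq H.
pose f n x := (step n (slope p n) x ^+ 2 + step n (slope q n) x ^+ 2)%:E.
have mw w : integrable01 w -> measurable_fun (`[0, 1] : set R) (fun x => w x ^+ 2).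
  move=> /measurable_int/measurable_EFinP mw.
  by apply: (measurableT_comp (f := fun x : R => x ^+ 2)) => //; exact: exprn_measurable.
have mf n : measurable_fun (`[0, 1] : set R) (f n).
  by apply/measurable_EFinP/measurable_funD; apply: mw; exact: step_integrable.
have f0 n x : (0 <= f n x)%E by rewrite lee_fin addr_ge0// sqr_ge0.
have cvE (u : nat -> \bar R) : cvgn (einfs u).
  by apply/cvg_ex; eexists; apply/ereal_nondecreasing_cvgn; exact: nondecreasing_einfs.
have li0 x : (0 <= limn_einf (f ^~ x))%E.
  rewrite limn_einf_lim; apply: lime_ge => //; apply: nearW => n.
  by apply: le_ereal_inf_tmp => _ [m _ <-]; exact: f0.
apply: (@le_trans _ _ (\int[mu]_(x in `[0%R, 1%R]) limn_einf (f ^~ x))%E).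
  apply: ge0_integral_ae_ge => //.
  - by move=> x _; rewrite lee_fin addr_ge0// sqr_ge0.
  - by apply/measurable_EFinP/measurable_funD; apply: mw; [exact: Pp.1|exact: Pq.1].
  have F := ae_filter_ringOfSetsType mu.
  apply: (@filterS3 _ _ F _ _ _ _ _ (primitive01_ae_deriv Pp) (primitive01_ae_deriv Pq) (ae_interior01 R)).
  move=> x dp dq xi; rewrite /= in_itv /= => xin; have x01 := xi xin.
  have C : f n x @[n --> \oo] --> (zp x ^+ 2 + zq x ^+ 2)%:E.
    apply: cvg_EFin; first by apply: nearW.
    have Cp := slope_deriv01 x01 (dp x01); have Cq := slope_deriv01 x01 (dq x01).
    by apply: cvgD; rewrite expr2; apply: cvgM.
  rewrite is_cvg_limn_einfE; last by apply/cvg_ex; eexists; exact: C.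
  by rewrite (cvg_lim _ C).
apply: le_trans (fatou _ _ _ _) _ => //.
rewrite limn_einf_lim; apply: lime_le => //; apply: nearW => n.
apply: (@le_trans _ _ (\int[mu]_(x in `[0%R, 1%R]) f n x)%E).
  by apply: ereal_inf_lbound; exists n => /=.
have iw c : integrable01 (fun x => step n c x ^+ 2).
  by rewrite step_sqr; exact: step_integrable.
have E : (\int[mu]_(x in `[0%R, 1%R]) f n x)%E =
  (\int[mu]_(x in `[0, 1]) (step n (slope p n) x ^+ 2 + step n (slope q n) x ^+ 2))%:E.
  rewrite /Rintegral fineK//; apply: integrable_fin_num => //.
  by apply: integrable01D.
rewrite E lee_fin RintegralD//; [|exact: iw..].
by have := slope_sqr_Rintegral H (leqnn n.+1); rewrite node_last.
Qed.

End FatouEnergy.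

(** * From constant-speed data to curves *)

Section DataToCurve.
Variable R : realType.
Implicit Types (f p w : R -> R) (x y e d l : R) (g : R -> 'rV[R]_2) (D : curve_data R).
Local Notation mu := (@lebesgue_measure R).

Lemma cont01_L2 f : {within `[0, 1], continuous f} -> L2 f.
Proof.
move=> cf; split.
  apply: measurable_funS (cont01_measurable cf) => //.
  by apply: subset_itvScc; rewrite bnd_simp.
have i2 : integrable01 (fun x => f x ^+ 2).
  by apply: integrable01_cont; under [X in continuous X]eq_fun do rewrite expr2; exact: cont01M.
have i3 : mu.-integrable `]0, 1[ (EFin \o (fun x => f x ^+ 2)).
  by apply: integrableS i2 => //; apply: subset_itvScc; rewrite bnd_simp.
have /integrableP[_] := i3; apply: le_lt_trans.
rewrite le_eqVlt; apply/orP; left; apply/eqP; apply: eq_integral => x _ /=.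
by rewrite ger0_norm// sqr_ge0.
Qed.

Lemma test_function_ends (phi : R -> R) : test_function phi -> phi 0 = 0 /\ phi 1 = 0.
Proof.
move=> [_ _ supp]; split; apply/eqP; apply/negPn/negP => H.
- by have := supp 0 (@subset_closure R [set x | phi x != 0] _ H); rewrite /= in_itv /= ltxx.
- by have := supp 1 (@subset_closure R [set x | phi x != 0] _ H); rewrite /= in_itv /= ltxx andbF.
Qed.

Lemma primitive01_weak_derivative f w : primitive01 f w -> weak_derivative f w.
Proof.
move=> fw phi tphi; have [phi0 phi1] := test_function_ends tphi.
have [dphi cphi _] := tphi.
have Pphi : primitive01 phi (derive1 phi).
  apply: FTC01; last exact: continuous_subspaceT.
  by move=> x _; exact: derivable_deriv01.
have ioo h : integrable01 h -> \int[mu]_(x in `]0, 1[) h x = \int[mu]_(x in `[0, 1]) h x.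
  move=> If; rewrite Rintegral_itv_bndo_bndc; last first.
    by apply: integrableS If => //; apply: subset_itvScc; rewrite bnd_simp.
  rewrite Rintegral_itv_obnd_cbnd//.
  by apply: integrableS If => //; apply: subset_itvScc; rewrite bnd_simp.
have I1 : integrable01 (fun x => f x * derive1 phi x).
  apply: integrable01_cont; apply: cont01M; first exact: primitive01_continuous fw.
  exact: continuous_subspaceT.
have I2 : integrable01 (fun x => phi x * w x).
  by apply: integrable01M_cont; [exact: primitive01_continuous Pphi|exact: fw.1].
have I3 : integrable01 (fun x => w x * phi x).
  by under [X in integrable01 X]eq_fun do rewrite mulrC.
rewrite (ioo _ I1) (ioo _ I3).
have := (primitive01M fw Pphi).2 0 1 (lexx _) ler01 (lexx _).
rewrite phi0 phi1 !mulr0 subrr (RintegralD _ I2 I1)//.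
have -> : \int[mu]_(x in `[0, 1]) (phi x * w x) = \int[mu]_(x in `[0, 1]) (w x * phi x).
  by apply: eq_Rintegral => x _; rewrite mulrC.
by set A := Rintegral _ _ _; set B := Rintegral _ _ _ => H; lra.
Qed.

Lemma chord_deriv01 p (t : R -> R) (M : R) : 0 <= M ->
  (forall x y, 0 <= x -> x <= y -> y <= 1 -> (t y - t x) ^+ 2 <= (y - x) * M) ->
  (forall x y, 0 <= x -> x <= y -> y <= 1 ->
     (p y - p x - (y - x) * t x) ^+ 2 <= (y - x) ^+ 3 * M) ->
  forall x, in01 x -> deriv01 p x (t x).
Proof.
move=> M0 Ht Hp x /andP[x0 x1] e e0.
have d0 : 0 < (e / 2) ^+ 2 / (M + 1) by rewrite divr_gt0 ?exprn_gt0 ?divr_gt0//; lra.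
exists ((e / 2) ^+ 2 / (M + 1)) => // y /andP[y0 y1] yx.
have key (h : R) : 0 <= h -> h < (e / 2) ^+ 2 / (M + 1) -> h * M <= (e / 2) ^+ 2.
  move=> h0 hd; apply: (@le_trans _ _ (h * (M + 1))); first by rewrite ler_wpM2l//; lra.
  by rewrite -ler_pdivlMr ?(ltW hd)//; lra.
have e20 : 0 <= e / 2 by lra.
have e00 := ltW e0.
have [xy|/ltW yx'] := leP x y.
  have yx0 : 0 <= y - x by rewrite subr_ge0.
  rewrite (ger0_norm yx0) in yx *.
  have K : `|p y - p x - (y - x) * t x| <= (y - x) * (e / 2).
    rewrite -ler_sqr ?nnegrE ?mulr_ge0// real_normK ?num_real//.
    apply: le_trans (Hp _ _ x0 xy y1) _.
    rewrite exprSr -mulrA exprMn ler_wpM2l ?sqr_ge0//; exact: key.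
  by rewrite mulrC in K; rewrite [t x * _]mulrC (mulrC (y - x)); nra.
(* To the left of [x] the chord inequality is based at [y]; replacing [t y] by [t x] costs the
   Hölder bound on [t]. *)
have xy0 : 0 <= x - y by rewrite subr_ge0.
rewrite distrC (ger0_norm xy0) in yx *.
have K : `|p x - p y - (x - y) * t y| <= (x - y) * (e / 2).
  rewrite -ler_sqr ?nnegrE ?mulr_ge0// real_normK ?num_real//.
  apply: le_trans (Hp _ _ y0 yx' x1) _.
  rewrite exprSr -mulrA exprMn ler_wpM2l ?sqr_ge0//; exact: key.
have K2 : `|t x - t y| <= e / 2.
  rewrite -ler_sqr ?nnegrE// real_normK ?num_real//.
  apply: le_trans (Ht _ _ y0 yx' x1) _; exact: key.
rewrite (_ : _ - _ = - (p x - p y - (x - y) * t y) + (x - y) * (t x - t y)); last by ring.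
rewrite (le_trans (ler_normD _ _))// normrN normrM (ger0_norm xy0).
have := ler_wpM2l xy0 K2; lra.
Qed.

(** [energy_primitive] yields a density for its first function only, so it is applied again with the
    coordinates exchanged. *)
Lemma valid_curve_primitives D : valid_curve D ->
  exists zp zq, [/\ primitive01 (tx D) zp, primitive01 (ty D) zq, L2 zp, L2 zq &
  (\int[mu]_(x in `[0%R, 1%R]) (zp x ^+ 2 + zq x ^+ 2)%:E <= (var D 1)%:E)%E].
Proof.
move=> vD; have [zp Pp] := energy_primitive (var_nondecr vD) (tangent_var vD).
have tv' x y : 0 <= x -> x <= y -> y <= 1 ->
    (ty D y - ty D x) ^+ 2 + (tx D y - tx D x) ^+ 2 <= (y - x) * (var D y - var D x).
  by move=> x0 xy y1; rewrite addrC; exact: (tangent_var vD).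
have [zq Pq] := energy_primitive (var_nondecr vD) tv'.
have E := fatou_energy (var_nondecr vD) Pp Pq (tangent_var vD).
rewrite (var0 vD) subr0 in E.
have sub : `]0, 1[ `<=` `[(0 : R), 1] by apply: subset_itvScc; rewrite bnd_simp.
have mz w : integrable01 w -> measurable_fun (`[0, 1] : set R) w.
  by move=> /measurable_int/measurable_EFinP.
have mw w : integrable01 w -> measurable_fun (`[0, 1] : set R) (fun x => w x ^+ 2).
  by move=> /mz ?; apply: (measurableT_comp (f := fun x : R => x ^+ 2)) => //; exact: exprn_measurable.
have half w w' : integrable01 w -> integrable01 w' ->
    (\int[mu]_(x in `[0%R, 1%R]) (w x ^+ 2 + w' x ^+ 2)%:E <= (var D 1)%:E)%E -> L2 w.
  move=> iw iw' EE; split; first exact: measurable_funS (mz _ iw).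
  apply: le_lt_trans (ltry (var D 1)); apply: le_trans EE.
  apply: (@le_trans _ _ (\int[mu]_(x in `[0%R, 1%R]) (w x ^+ 2)%:E)%E).
    apply: ge0_subset_integral => //; first by apply/measurable_EFinP; exact: mw.
    by move=> x _; rewrite lee_fin sqr_ge0.
  apply: ge0_le_integral => //.
  - by move=> x _; rewrite lee_fin sqr_ge0.
  - by apply/measurable_EFinP; exact: mw.
  - by apply/measurable_EFinP/measurable_funD; exact: mw.
  - by move=> x _; rewrite lee_fin lerDl sqr_ge0.
exists zp, zq; split => //; first exact: (half _ _ Pp.1 Pq.1 E).
apply: (half _ _ Pq.1 Pp.1).
by under eq_integral do rewrite addrC.
Qed.

(** This undoes the division by [len]. The curve starts at the origin, which only fixes a
    translation. *)
Definition curve_of D : R -> 'rV[R]_2 :=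
  fun x => \row_j (len D * (if j == 0 then px D x else py D x)).

Section ValidCurve.
Variable D : curve_data R.
Hypotheses (vD : valid_curve D) (L0 : 0 < len D).

Let V1 : 0 <= var D 1.
Proof. by rewrite -(var0 vD); apply: (var_nondecr vD). Qed.

Let var_sub x y : 0 <= x -> x <= y -> y <= 1 -> var D y - var D x <= var D 1.
Proof.
move=> x0 xy y1; have := @var_nondecr _ _ vD 0 x; have := @var_nondecr _ _ vD y 1.
rewrite (var0 vD) => /(_ ltac:(lra) y1 (lexx _)) + /(_ (lexx _) x0 ltac:(lra)); lra.
Qed.

Lemma tx_holder x y : 0 <= x -> x <= y -> y <= 1 ->
  (tx D y - tx D x) ^+ 2 <= (y - x) * var D 1.
Proof.
move=> x0 xy y1.
apply: (@le_trans _ _ ((y - x) * (var D y - var D x))).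
  by apply: le_trans (tangent_var vD x0 xy y1); rewrite lerDl sqr_ge0.
by rewrite ler_wpM2l ?subr_ge0// var_sub.
Qed.

Lemma ty_holder x y : 0 <= x -> x <= y -> y <= 1 ->
  (ty D y - ty D x) ^+ 2 <= (y - x) * var D 1.
Proof.
move=> x0 xy y1.
apply: (@le_trans _ _ ((y - x) * (var D y - var D x))).
  by apply: le_trans (tangent_var vD x0 xy y1); rewrite lerDr sqr_ge0.
by rewrite ler_wpM2l ?subr_ge0// var_sub.
Qed.

Lemma px_deriv01 x : in01 x -> deriv01 (px D) x (tx D x).
Proof. exact: (chord_deriv01 V1 tx_holder (chord_x vD)). Qed.

Lemma py_deriv01 x : in01 x -> deriv01 (py D) x (ty D x).
Proof. exact: (chord_deriv01 V1 ty_holder (chord_y vD)). Qed.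

Let g := curve_of D.
Let tt j x := if (j : 'I_2) == 0 then tx D x else ty D x.

Lemma deriv01Zl (c : R) f x l : deriv01 f x l -> deriv01 (fun t => c * f t) x (c * l).
Proof.
move=> H e e0; have c0 : 0 < `|c| + 1 by rewrite ltr_wpDl.
have [d d0 Hd] := H _ (divr_gt0 e0 c0); exists d => // y yin yx.
rewrite (_ : _ - _ = c * (f y - f x - l * (y - x))); last by ring.
rewrite normrM; apply: (@le_trans _ _ (`|c| * (e / (`|c| + 1) * `|y - x|))).
  by rewrite ler_wpM2l// Hd.
rewrite mulrA ler_wpM2r// mulrCA ler_piMr ?(ltW e0)// ler_pdivrMr// mul1r lerDl//.
Qed.

Let g_deriv01 j x : in01 x -> deriv01 (fun t => g t 0 j) x (len D * tt j x).
Proof.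
move=> xin; rewrite /g /curve_of /tt.
under [X in deriv01 X _ _]eq_fun do rewrite mxE.
by case: ifP => _; apply: deriv01Zl; [exact: px_deriv01|exact: py_deriv01].
Qed.

Lemma curve_of_dx x : in01 x ->
  derivable_at g x /\ dx g x = \row_j (len D * tt j x).
Proof.
by move=> xin; apply: deriv01_dx => // j; rewrite mxE; exact: g_deriv01.
Qed.

Lemma curve_of_speed x : in01 x -> enorm (dx g x) = len D.
Proof.
move=> xin; rewrite (curve_of_dx xin).2 /enorm !mxE /tt /= !exprMn -mulrDr.
by rewrite (tangent_unit vD xin) mulr1 sqrtr_sqr ger0_norm// ltW.
Qed.

Lemma curve_of_tau x : in01 x -> tau g x = \row_j tt j x.
Proof.
move=> xin; rewrite /tau /ds (curve_of_speed xin) (curve_of_dx xin).2.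
by apply/rowP => j; rewrite !mxE mulKf// gt_eqF.
Qed.

Lemma curve_of_regular : regular g.
Proof.
have [zp [zq [Pp Pq _ _ _]]] := valid_curve_primitives vD.
split; last by move=> x; rewrite in_itv /= => xin; rewrite curve_of_speed// gt_eqF.
split; first by move=> x; rewrite in_itv /= => xin; exact: (curve_of_dx xin).1.
apply: (@subspace_eq_continuous _ _ _ (fun x => \row_j (len D * tt j x))).
  by move=> x; rewrite inE /= in_itv /= => xin; apply/esym; exact: (curve_of_dx xin).2.
apply/subspace_continuousP => x xin; apply: cvg_rV2 => j.
rewrite mxE; under eq_fun do rewrite mxE.
apply: cvgM; first exact: cvg_cst.
rewrite /tt; case: ifP => _.
- by have /subspace_continuousP := primitive01_continuous Pp; apply.
- by have /subspace_continuousP := primitive01_continuous Pq; apply.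
Qed.

Lemma curve_of_H2 : H2 g.
Proof.
have [zp [zq [Pp Pq Lp Lq _]]] := valid_curve_primitives vD.
move=> j; pose z := if j == 0 then zp else zq.
have Pz : primitive01 (tt j) z by rewrite /tt /z; case: (j == 0).
have Lz : L2 z by rewrite /z; case: (j == 0).
exists (fun x => len D * tt j x), (fun x => len D * z x).
have PL := primitive01Zl (len D) Pz.
have cL := primitive01_continuous PL.
have Pg : primitive01 (fun x => g x 0 j) (fun x => len D * tt j x).
  by apply: FTC01 => // x xin; exact: g_deriv01.
split.
- exact/cont01_L2/(primitive01_continuous Pg).
- exact: cont01_L2.
- have [mz iz] := Lz; split; first exact: measurable_funM.
  have i2 := L2_integrable_sqr Lz.
  have i3 : integrable01 (fun x => (len D * z x) ^+ 2).
    by under [X in integrable01 X]eq_fun do rewrite exprMn; exact: integrable01Zl.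
  have i4 : mu.-integrable `]0, 1[ (EFin \o (fun x => (len D * z x) ^+ 2)).
    by apply: integrableS i3 => //; apply: subset_itvScc; rewrite bnd_simp.
  have /integrableP[_] := i4; apply: le_lt_trans.
  rewrite le_eqVlt; apply/orP; left; apply/eqP; apply: eq_integral => x _ /=.
  by rewrite ger0_norm// sqr_ge0.
- exact: primitive01_weak_derivative.
- exact: primitive01_weak_derivative.
Qed.

(** Only an inequality is available: [var] may exceed the integral of |T'|^2, since a pointwise
    limit of the functions [var] keeps energy that the densities lose. *)
Lemma curve_of_energy :
  (int_ds g (fun x => curvature g x ^+ 2 + 1)%R <= (nrg D)%:E)%E.
Proof.
have [zp [zq [Pp Pq Lp Lq E]]] := valid_curve_primitives vD.
have Qp : primitive01 (fun t => tau g t 0 0) zp.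
  by apply: eq_primitive01 Pp => // x xin; rewrite curve_of_tau// mxE.
have Qq : primitive01 (fun t => tau g t 0 1) zq.
  by apply: eq_primitive01 Pq => // x xin; rewrite curve_of_tau// mxE.
rewrite (energy_tangent curve_of_regular curve_of_H2 Qp Qq).
have i2 := integrable01D (L2_integrable_sqr Lp) (L2_integrable_sqr Lq).
have ic : integrable01 (fun=> len D) by apply: integrable01_cont; exact: cont01_cst.
have i3 : integrable01 (fun x => (len D)^-1 * (zp x ^+ 2 + zq x ^+ 2)) by exact: integrable01Zl.
pose I := \int[mu]_(x in `[0, 1]) (zp x ^+ 2 + zq x ^+ 2).
have IE : I <= var D 1.
  rewrite -lee_fin; apply: le_trans E; rewrite /I /Rintegral fineK//.
  exact: integrable_fin_num.
have -> : (\int[mu]_(x in `[0%R, 1%R])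
     ((zp x ^+ 2 + zq x ^+ 2) / enorm (dx g x) + enorm (dx g x))%:E)%E =
    (\int[mu]_(x in `[0, 1]) ((len D)^-1 * (zp x ^+ 2 + zq x ^+ 2) + len D))%:E.
  rewrite /Rintegral fineK; last by apply: integrable_fin_num => //; exact: integrable01D.
  apply: eq_integral => x; rewrite inE /= in_itv /= => xin.
  by rewrite curve_of_speed// mulrC.
rewrite lee_fin RintegralD// RintegralZl// -/I Rintegral_cst_itv// subr0 mulr1.
rewrite -lerBrDr mulrC ler_pdivrMr// (le_trans IE)// mulrC; exact: (var_energy vD).
Qed.

End ValidCurve.
End DataToCurve.

(** * Energy of loops *)

Section Calibration.
Variable R : realType.
Implicit Types (x y a b e d : R).

(** Reverse triangle inequality for the distances of p and q to e. It comes from Cauchy-Schwarz,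
    here the nonnegativity of a squared determinant. *)
Lemma chord_triangle (p1 p2 q1 q2 e1 e2 f g : R) : 0 <= f -> 0 <= g ->
  f ^+ 2 = (p1 - e1) ^+ 2 + (p2 - e2) ^+ 2 ->
  g ^+ 2 = (q1 - e1) ^+ 2 + (q2 - e2) ^+ 2 ->
  (g - f) ^+ 2 <= (q1 - p1) ^+ 2 + (q2 - p2) ^+ 2.
Proof.
move=> f0 g0 fE gE.
have fg0 : 0 <= f * g by rewrite mulr_ge0.
have C : (p1 - e1) * (q1 - e1) + (p2 - e2) * (q2 - e2) <= f * g.
  rewrite leNgt; apply/negP => H.
  have : (f * g) ^+ 2 < ((p1 - e1) * (q1 - e1) + (p2 - e2) * (q2 - e2)) ^+ 2.
    by rewrite ltr_pXn2r ?nnegrE//; lra.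
  rewrite exprMn fE gE ltNge => /negP; apply; rewrite -subr_ge0.
  rewrite (_ : _ - _ = ((p1 - e1) * (q2 - e2) - (p2 - e2) * (q1 - e1)) ^+ 2); last by ring.
  exact: sqr_ge0.
rewrite -subr_ge0 (_ : _ - _ = 2 * (f * g - ((p1 - e1) * (q1 - e1) + (p2 - e2) * (q2 - e2)))).
  by rewrite mulr_ge0// subr_ge0.
rewrite (_ : (g - f) ^+ 2 = g ^+ 2 + f ^+ 2 - 2 * (f * g)); last by ring.
by rewrite fE gE; ring.
Qed.

(* With M the midpoint of the unit vectors p and q: since q - p is orthogonal
   to M, the component of e along q - p is controlled by M.e, and
   g^2 - f^2 = -2 (q - p).e. *)
Lemma chord_calibration (p1 p2 q1 q2 e1 e2 f g c : R) : 0 <= f -> 0 <= g ->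
  p1 ^+ 2 + p2 ^+ 2 = 1 -> q1 ^+ 2 + q2 ^+ 2 = 1 -> e1 ^+ 2 + e2 ^+ 2 = 1 ->
  f ^+ 2 = (p1 - e1) ^+ 2 + (p2 - e2) ^+ 2 ->
  g ^+ 2 = (q1 - e1) ^+ 2 + (q2 - e2) ^+ 2 ->
  c = (q1 - p1) ^+ 2 + (q2 - p2) ^+ 2 ->
  2 * (g - f) ^+ 2 <=
    c * (1 + ((p1 + q1) / 2 * e1 + (p2 + q2) / 2 * e2) + c / 2).
Proof.
move=> f0 g0 up uq ue fE gE cD.
have tri := chord_triangle f0 g0 fE gE; rewrite -cD in tri.
have c0 : 0 <= c by rewrite cD addr_ge0// sqr_ge0.
set m := _ * e1 + _ * e2.
pose s := f ^+ 2 + g ^+ 2.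
have mE : m = 1 - s / 4.
  have -> : s = 4 - 4 * m; last by field.
  by rewrite /s fE gE /m; nra.
have sum0 : 0 <= f + g by rewrite addr_ge0.
(* The factor 1 - c/4 is the squared length of the midpoint M. *)
have key : (g - f) ^+ 2 * (2 * (1 - c / 4)) <= c * (1 + m).
  have [fg|fg] := eqVneq (f + g) 0.
    have -> : g - f = 0 by lra.
    rewrite expr0n mul0r mulr_ge0// mE /s.
    have -> : f = 0 by lra.
    have -> : g = 0 by lra.
    by rewrite !expr0n /=; lra.
  have fg2 : 0 < (f + g) ^+ 2 by rewrite exprn_even_gt0.
  rewrite -(ler_pM2r fg2).
  (* Pythagoras for the orthogonal vectors q - p and M and the unit vector e: |M|^2 ((q - p).e)^2 +
     |q - p|^2 (M.e)^2 = |q - p|^2 |M|^2. *)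
  have ortho : (1 - c / 4) * ((q1 - p1) * e1 + (q2 - p2) * e2) ^+ 2 + c * m ^+ 2 = c * (1 - c / 4).
    have cE : c = 2 - 2 * (p1 * q1 + p2 * q2) by rewrite cD; nra.
    have -> : 1 - c / 4 = (((p1 + q1) / 2) ^+ 2 + ((p2 + q2) / 2) ^+ 2) by rewrite cE; nra.
    have perp : (q1 - p1) * ((p1 + q1) / 2) + (q2 - p2) * ((p2 + q2) / 2) = 0 by nra.
    rewrite cD /m; set a1 := q1 - p1 in perp *; set a2 := q2 - p2 in perp *.
    set b1 := (p1 + q1) / 2 in perp *; set b2 := (p2 + q2) / 2 in perp *.
    have -> : (b1 ^+ 2 + b2 ^+ 2) * (a1 * e1 + a2 * e2) ^+ 2 +
        (a1 ^+ 2 + a2 ^+ 2) * (b1 * e1 + b2 * e2) ^+ 2 =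
        (a1 ^+ 2 + a2 ^+ 2) * (b1 ^+ 2 + b2 ^+ 2) * (e1 ^+ 2 + e2 ^+ 2)
        + (a1 * b1 + a2 * b2) * ((a1 * b1 - a2 * b2) * (e1 ^+ 2 - e2 ^+ 2)
          + 2 * (a1 * b2 + a2 * b1) * (e1 * e2)).
      by ring.
    by rewrite perp ue; ring.
  have dE : (q1 - p1) * e1 + (q2 - p2) * e2 = (f ^+ 2 - g ^+ 2) / 2.
    by rewrite fE gE; nra.
  rewrite dE in ortho.
  have -> : (g - f) ^+ 2 * (2 * (1 - c / 4)) * (f + g) ^+ 2 =
      8 * ((1 - c / 4) * ((f ^+ 2 - g ^+ 2) / 2) ^+ 2) by field.
  have -> : (1 - c / 4) * ((f ^+ 2 - g ^+ 2) / 2) ^+ 2 = c * (1 - c / 4) - c * m ^+ 2.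
    by rewrite -ortho; ring.
  have -> : 8 * (c * (1 - c / 4) - c * m ^+ 2) = c * (2 * s * (2 - s / 4) - 2 * c).
    by rewrite mE; field.
  have -> : c * (1 + m) * (f + g) ^+ 2 = c * ((2 - s / 4) * (2 * s - (g - f) ^+ 2)).
    by rewrite mE /s; field.
  rewrite ler_wpM2l//.
  have s0 : 0 <= s by rewrite /s addr_ge0// sqr_ge0.
  have : (2 - s / 4) * (g - f) ^+ 2 <= 2 * c.
    apply: (@le_trans _ _ (2 * (g - f) ^+ 2)); last by rewrite ler_wpM2l.
    by rewrite ler_wpM2r ?sqr_ge0//; lra.
  by lra.
(* The defect c/4 of |M|^2 is paid for by the term c/2 of the statement, through the triangle
   inequality. *)
have c4 : c / 2 * (g - f) ^+ 2 <= c / 2 * c by rewrite ler_wpM2l//; lra.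
have -> : 2 * (g - f) ^+ 2 = (g - f) ^+ 2 * (2 * (1 - c / 4)) + c / 2 * (g - f) ^+ 2 by field.
by rewrite mulrDr; lra.
Qed.

Lemma le_sqrt_arg (h M r : R) : 0 <= r -> h * M <= r ^+ 2 ->
  forall z, z ^+ 2 <= h * M -> `|z| <= r.
Proof.
move=> r0 H z zM; rewrite -ler_sqr ?nnegrE// real_normK ?num_real//.
exact: le_trans H.
Qed.

Variables (D : curve_data R) (e1 e2 : R).
Hypotheses (vD : valid_curve D) (L0 : 0 < len D) (ue : e1 ^+ 2 + e2 ^+ 2 = 1).

(** [tdist] is 2 |sin(a/2)| for the angle a from e to T. [calib] is the primitive of the calibrated
    density L (1 + T.e) + |T'|^2 / L, written with the rescaled position and with [var] for the
    integral of |T'|^2. *)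
Definition tdist x := Num.sqrt ((tx D x - e1) ^+ 2 + (ty D x - e2) ^+ 2).
Definition calib x := len D * (x + (px D x * e1 + py D x * e2)) + var D x / len D.

Let tdist_ge0 x : 0 <= tdist x. Proof. exact: sqrtr_ge0. Qed.
Let tdist_sqr x : tdist x ^+ 2 = (tx D x - e1) ^+ 2 + (ty D x - e2) ^+ 2.
Proof. by rewrite sqr_sqrtr// addr_ge0// sqr_ge0. Qed.

(** [chord_calibration] gives the inequality on short chords up to an error o(h), so
    [local_to_global] makes [calib] plus or minus sqrt 8 times [tdist] nondecreasing. Only the
    inequalities of [valid_curve] enter, no derivative of the tangent. *)
Lemma tdist_calib a b : 0 <= a -> a <= b -> b <= 1 ->
  Num.sqrt 8 * `|tdist b - tdist a| <= calib b - calib a.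
Proof.
pose k : R := Num.sqrt 8.
have k0 : 0 <= k by exact: sqrtr_ge0.
have k2 : k ^+ 2 = 8 by rewrite sqr_sqrtr.
have V1 : 0 <= var D 1 by rewrite -(var0 vD); apply: (var_nondecr vD).
have mono s : `|s| = 1 -> nondecr01 (fun x => calib x - s * (k * tdist x)).
  move=> s1; apply: (local_to_global (m := id)) => [x y //|eps eps0].
  (* The errors in position, in replacing the left tangent by the midpoint, and in c / 2 add up to
     at most 4 L eta h, which is at most eps h. *)
  pose eta := Num.min 1 (eps / (4 * len D)).
  have eta0 : 0 < eta by rewrite lt_min ltr01 divr_gt0// mulr_gt0.
  have eta1 : eta <= 1 by rewrite ge_min lexx.
  have eta2 : eta <= eps / (4 * len D) by rewrite ge_min lexx orbT.
  exists (eta ^+ 2 / (var D 1 + 1)); first by rewrite divr_gt0 ?exprn_gt0//; lra.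
  move=> x y x0 xy y1 yx; set h := y - x in yx *.
  have h0 : 0 <= h by rewrite subr_ge0.
  have hV : h * var D 1 <= eta ^+ 2.
    apply: (@le_trans _ _ (h * (var D 1 + 1))); first by rewrite ler_wpM2l//; lra.
    by rewrite -ler_pdivlMr ?(ltW yx)//; lra.
  have e0 := ltW eta0.
  have d1 := le_sqrt_arg e0 hV (tx_holder vD x0 xy y1).
  have d2 := le_sqrt_arg e0 hV (ty_holder vD x0 xy y1).
  have hV' : (h * eta) ^+ 2 >= h ^+ 3 * var D 1.
    by rewrite exprSr -mulrA exprMn ler_wpM2l ?sqr_ge0.
  have heta : 0 <= h * eta by rewrite mulr_ge0.
  have r1 : `|px D y - px D x - h * tx D x| <= h * eta.
    rewrite -ler_sqr ?nnegrE// real_normK ?num_real//.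
    exact: le_trans (chord_x vD x0 xy y1) hV'.
  have r2 : `|py D y - py D x - h * ty D x| <= h * eta.
    rewrite -ler_sqr ?nnegrE// real_normK ?num_real//.
    exact: le_trans (chord_y vD x0 xy y1) hV'.
  have xin : in01 x by rewrite /in01; lra.
  have yin : in01 y by rewrite /in01; lra.
  have := chord_calibration (tdist_ge0 x) (tdist_ge0 y) (tangent_unit vD xin)
    (tangent_unit vD yin) ue (tdist_sqr x) (tdist_sqr y) erefl.
  set c := (tx D y - tx D x) ^+ 2 + _.
  have cV : c <= h * (var D y - var D x) by exact: (tangent_var vD).
  have c0 : 0 <= c by rewrite addr_ge0// sqr_ge0.
  set me := _ * e1 + _ * e2; set A := 1 + me + c / 2; set dV := var D y - var D x in cV *.
  move=> cal.
  have dV0 : 0 <= dV by rewrite subr_ge0 (var_nondecr vD).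
  have le1 : `|e1| <= 1 by rewrite -ler_sqr ?nnegrE// real_normK ?num_real// expr1n -ue lerDl sqr_ge0.
  have le2 : `|e2| <= 1 by rewrite -ler_sqr ?nnegrE// real_normK ?num_real// expr1n -ue lerDr sqr_ge0.
  have A0 : 0 <= A.
    rewrite /A; suff : - 1 <= me by lra.
    have := tangent_unit vD xin; have := tangent_unit vD yin; rewrite /me => uy ux.
    set m := _ + _.
    have E : 4 + 4 * m = (tx D x + e1) ^+ 2 + (ty D x + e2) ^+ 2 +
        ((tx D y + e1) ^+ 2 + (ty D y + e2) ^+ 2).
      transitivity ((tx D x ^+ 2 + ty D x ^+ 2) + (tx D y ^+ 2 + ty D y ^+ 2)
          + 2 * (e1 ^+ 2 + e2 ^+ 2) + 4 * m); first by rewrite ux uy ue; ring.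
      by rewrite /m; field.
    have : 0 <= 4 + 4 * m by rewrite E !addr_ge0// sqr_ge0.
    by lra.
  (* After 8 (tdist y - tdist x)^2 <= 4 c A <= 4 h dV A, this is the arithmetic-geometric mean
     inequality for L h A and dV / L. *)
  have amgm : k * `|tdist y - tdist x| <= len D * (h * A) + dV / len D.
    have R0 : 0 <= len D * (h * A) + dV / len D.
      by rewrite addr_ge0 ?mulr_ge0 ?invr_ge0// ltW.
    rewrite -ler_sqr ?nnegrE ?mulr_ge0// exprMn k2 real_normK ?num_real//.
    apply: (@le_trans _ _ (4 * (h * dV * A))).
      have : c * A <= h * dV * A by rewrite ler_wpM2r.
      by lra.
    rewrite -subr_ge0 (_ : _ - _ = (len D * (h * A) - dV / len D) ^+ 2) ?sqr_ge0//.
    by field; rewrite gt_eqF.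
  have sab : s * (k * (tdist y - tdist x)) <= k * `|tdist y - tdist x|.
    by rewrite (le_trans (ler_norm _))// normrM s1 mul1r normrM (ger0_norm k0).
  have B1 : `|(px D y - px D x - h * tx D x) * e1| <= h * eta.
    by rewrite normrM -[leRHS]mulr1 ler_pM.
  have B2 : `|(py D y - py D x - h * ty D x) * e2| <= h * eta.
    by rewrite normrM -[leRHS]mulr1 ler_pM.
  have B3 : `|(tx D y - tx D x) * e1| <= eta by rewrite normrM -[leRHS]mulr1 ler_pM.
  have B4 : `|(ty D y - ty D x) * e2| <= eta by rewrite normrM -[leRHS]mulr1 ler_pM.
  have cb : c <= eta ^+ 2.
    apply: le_trans hV; apply: le_trans cV _; rewrite ler_wpM2l//.
    have := @var_nondecr _ _ vD 0 x; have := @var_nondecr _ _ vD y 1.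
    by rewrite (var0 vD) /dV => /(_ ltac:(lra) y1 (lexx _)) + /(_ (lexx _) x0 ltac:(lra)); lra.
  have cb' : c <= eta by apply: le_trans cb _; rewrite expr2 ler_piMr.
  move: B1 B2 B3 B4; rewrite !ler_norml => /andP[B1 _] /andP[B2 _] /andP[_ B3] /andP[_ B4].
  have P : h + ((px D y - px D x) * e1 + (py D y - py D x) * e2) >= h * A - h * (4 * eta).
    have -> : h + ((px D y - px D x) * e1 + (py D y - py D x) * e2) =
       h * A + ((px D y - px D x - h * tx D x) * e1 + (py D y - py D x - h * ty D x) * e2)
       - h * (((tx D y - tx D x) * e1 + (ty D y - ty D x) * e2 + c) / 2).
      by rewrite /A /me; field.
    have : h * (((tx D y - tx D x) * e1 + (ty D y - ty D x) * e2 + c) / 2) <= h * (2 * eta).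
      by rewrite ler_wpM2l//; lra.
    by lra.
  have P2 : len D * (h * A) - eps * h <= len D * (h + ((px D y - px D x) * e1 + (py D y - py D x) * e2)).
    apply: le_trans (ler_wpM2l (ltW L0) P).
    rewrite (mulrBr (len D) (h * A)) lerD2l lerN2.
    rewrite (_ : len D * (h * (4 * eta)) = (eta * (4 * len D)) * h); last by ring.
    by rewrite ler_wpM2r// -ler_pdivlMr// mulr_gt0.
  have -> : calib y - s * (k * tdist y) - (calib x - s * (k * tdist x)) =
     len D * (h + ((px D y - px D x) * e1 + (py D y - py D x) * e2)) + dV / len D
     - s * (k * (tdist y - tdist x)).
    by rewrite /calib /dV /h; field; rewrite gt_eqF.
  by lra.
move=> a0 ab b1; rewrite -/k -(ger0_norm k0) -normrM.
have := mono 1 (normr1 _) a b a0 ab b1; have := mono (-1) (normrN1 _) a b a0 ab b1.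
by rewrite ler_norml => H1 H2; apply/andP; split; lra.
Qed.

End Calibration.

(** * Lower bounds for the energy of closed curves *)

Section Loop.
Variable R : realType.
Implicit Types (x y a b e d t : R).
Variable D : curve_data R.
Hypotheses (vD : valid_curve D) (L0 : 0 < len D).
Hypotheses (px1 : px D 1 = 0) (py1 : py D 1 = 0).

(** On a closed curve T.e integrates to 0; what remains is L + var(1) / L. *)
Lemma calib_total e1 e2 : calib D e1 e2 1 - calib D e1 e2 0 <= nrg D.
Proof.
rewrite /calib px1 py1 (pos0 vD).1 (pos0 vD).2 (var0 vD) !mul0r !addr0 mulr1 mulr0 subr0.
rewrite addrC -lerBrDr ler_pdivrMr// mulrC; exact: (var_energy vD).
Qed.

Lemma tdist_variation e1 e2 t : e1 ^+ 2 + e2 ^+ 2 = 1 -> in01 t ->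
  Num.sqrt 8 * (`|tdist D e1 e2 t - tdist D e1 e2 0| + `|tdist D e1 e2 1 - tdist D e1 e2 t|)
  <= nrg D.
Proof.
move=> ue /andP[t0 t1]; apply: le_trans (calib_total e1 e2).
have := tdist_calib vD L0 ue (lexx 0) t0 t1.
have := tdist_calib vD L0 ue t0 t1 (lexx 1).
by rewrite mulrDr; lra.
Qed.

(** With f the function [tdist], the four arcs cut by [r], [s], [t] contribute f r - f 0, f r, f t
    and f t - f 1 to its variation; the middle two because f s = 0. *)
Lemma tdist_variation3 e1 e2 r s t : e1 ^+ 2 + e2 ^+ 2 = 1 ->
  0 <= r -> r <= s -> s <= t -> t <= 1 -> tdist D e1 e2 s = 0 ->
  Num.sqrt 8 * (2 * (tdist D e1 e2 r + tdist D e1 e2 t)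
     - tdist D e1 e2 0 - tdist D e1 e2 1) <= nrg D.
Proof.
move=> ue r0 rs st t1 s0; apply: le_trans (calib_total e1 e2).
have st1 := le_trans st t1; have rs1 := le_trans rs st1.
have r0s := le_trans r0 rs; have r0t := le_trans r0s st.
have A := tdist_calib vD L0 ue (lexx 0) r0 rs1.
have B := tdist_calib vD L0 ue r0 rs st1.
have C := tdist_calib vD L0 ue r0s st t1.
have E := tdist_calib vD L0 ue r0t t1 (lexx 1).
rewrite s0 in B C.
have k0 : 0 <= Num.sqrt 8 :> R by exact: sqrtr_ge0.
set k := Num.sqrt 8 in A B C E k0 *.
set fr := tdist _ _ _ r in A B *; set ft := tdist _ _ _ t in C E *.
set f0 := tdist _ _ _ 0 in A *; set f1 := tdist _ _ _ 1 in E *.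
have A' := le_trans (ler_wpM2l k0 (ler_norm (fr - f0))) A.
have B' : k * fr <= calib D e1 e2 s - calib D e1 e2 r.
  apply: le_trans B; rewrite ler_wpM2l// sub0r normrN ler_norm//.
have C' : k * ft <= calib D e1 e2 t - calib D e1 e2 s.
  apply: le_trans C; rewrite ler_wpM2l// subr0 ler_norm//.
have E' : k * (ft - f1) <= calib D e1 e2 1 - calib D e1 e2 t.
  by apply: le_trans E; rewrite ler_wpM2l// distrC ler_norm.
by rewrite mulrBr in A'; rewrite mulrBr in E'; rewrite !mulrBr mulrCA mulrDr; lra.
Qed.

Variables (q1 q2 : R).
Hypothesis uq : q1 ^+ 2 + q2 ^+ 2 = 1.

(** [X] and [Y] are the cosine and sine of the angle from q to the tangent. *)
Let X t := tx D t * q1 + ty D t * q2.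
Let Y t := ty D t * q1 - tx D t * q2.

Let XY t : in01 t -> X t ^+ 2 + Y t ^+ 2 = 1.
Proof.
move=> tin; rewrite /X /Y.
transitivity ((tx D t ^+ 2 + ty D t ^+ 2) * (q1 ^+ 2 + q2 ^+ 2)); first by ring.
by rewrite (tangent_unit vD tin) uq mul1r.
Qed.

Lemma tdist_dot t : in01 t -> tdist D q1 q2 t ^+ 2 = 2 - 2 * X t.
Proof.
move=> tin; rewrite /tdist sqr_sqrtr; last by rewrite addr_ge0// sqr_ge0.
rewrite /X; have := tangent_unit vD tin; have := uq.
move=> U1 U2.
transitivity ((tx D t ^+ 2 + ty D t ^+ 2) + (q1 ^+ 2 + q2 ^+ 2) - 2 * X t).
  by rewrite /X; ring.
by rewrite U1 U2 /X; ring.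
Qed.

(* The mean of the tangent over a closed curve vanishes. *)
Lemma loop_direction_zero v1 v2 : exists2 t, 0 < t < 1 & tx D t * v1 + ty D t * v2 = 0.
Proof.
have Dr t : t \in `]0, 1[ ->
    is_derive t 1 (fun s => px D s * v1 + py D s * v2) (tx D t * v1 + ty D t * v2).
  rewrite in_itv /= => /andP[t0 t1].
  have tin : in01 t by rewrite /in01; lra.
  have dx := deriv01_is_derive t0 t1 (deriv01Zl v1 (px_deriv01 vD tin)).
  have dy := deriv01_is_derive t0 t1 (deriv01Zl v2 (py_deriv01 vD tin)).
  have := is_deriveD dx dy.
  rewrite (_ : (fun s => v1 * px D s) + (fun s => v2 * py D s) = (fun s => px D s * v1 + py D s * v2)).
    by rewrite (mulrC v1) (mulrC v2).
  by apply/funext => s; rewrite /= -[LHS]/(v1 * px D s + v2 * py D s) mulrC (mulrC v2).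
have cx := deriv01_cont 0 (px_deriv01 vD); have cy := deriv01_cont 0 (py_deriv01 vD).
have cc : {within `[0, 1], continuous (fun s => px D s * v1 + py D s * v2)}.
  by apply: cont01D; apply: cont01M => //; exact: cont01_cst.
have [c] := MVT ltr01 Dr cc.
rewrite in_itv /= px1 py1 (pos0 vD).1 (pos0 vD).2 !mul0r addr0 subrr subr0 mulr1 => cin c0.
by exists c.
Qed.

Hypothesis avoid : forall t, in01 t -> 0 < 1 + X t.

(** This is tan(a/2) for the angle a from q to T, with nonzero denominator by [avoid]; [tdist] grows
    with its absolute value. *)
Let sg t := Y t / (1 + X t).

Let sgE t : in01 t -> sg t ^+ 2 * (1 + X t) = 1 - X t.
Proof.
move=> tin; have a0 := avoid tin.
have -> : sg t ^+ 2 * (1 + X t) = Y t ^+ 2 / (1 + X t) by rewrite /sg; field; rewrite gt_eqF.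
have -> : Y t ^+ 2 = (1 - X t) * (1 + X t) by have H := XY tin; nra.
by rewrite mulfK// gt_eqF.
Qed.

Let X_of_sg s t : in01 s -> in01 t -> sg s ^+ 2 <= sg t ^+ 2 -> X t <= X s.
Proof.
move=> sin tin H.
have as0 := avoid sin; have at0 := avoid tin; have Es := sgE sin; have Et := sgE tin.
have : (1 - X s) * (1 + X t) <= (1 - X t) * (1 + X s).
  rewrite -Es -Et mulrAC (mulrAC (sg t ^+ 2)) -mulrA -(mulrA (sg t ^+ 2)).
  by rewrite (mulrC (1 + X t)) ler_wpM2r// mulr_ge0// ltW.
by lra.
Qed.

Let tdist_le s t : in01 s -> in01 t -> sg s ^+ 2 <= sg t ^+ 2 ->
  tdist D q1 q2 s <= tdist D q1 q2 t.
Proof.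
move=> sin tin H; rewrite -ler_sqr ?nnegrE ?sqrtr_ge0//.
rewrite (tdist_dot sin) (tdist_dot tin).
by have := X_of_sg sin tin H; lra.
Qed.

(* The stereographic coordinate of the tangent cannot lie in an interval
   (-1/c, c): otherwise the tangent would stay in an open half plane. *)
Lemma loop_extrema : exists rs : R * R,
  [/\ in01 rs.1, in01 rs.2,
    4 <= tdist D q1 q2 rs.1 ^+ 2 + tdist D q1 q2 rs.2 ^+ 2,
    (forall t, in01 t -> (0 <= Y t -> tdist D q1 q2 t <= tdist D q1 q2 rs.2) /\
       (Y t <= 0 -> tdist D q1 q2 t <= tdist D q1 q2 rs.1)) &
    Num.sqrt 8 * (2 * (tdist D q1 q2 rs.1 + tdist D q1 q2 rs.2)
     - tdist D q1 q2 0 - tdist D q1 q2 1) <= nrg D].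
Proof.
have [zp [zq [Pp Pq _ _ _]]] := valid_curve_primitives vD.
have ctx := primitive01_continuous Pp; have cty := primitive01_continuous Pq.
have ccst (c : R) : {within `[(0 : R), 1], continuous (fun=> c : R)} by exact: cont01_cst.
have cX : {within `[0, 1], continuous X}.
  by apply: cont01D; apply: cont01M => //; exact: ccst.
have cY : {within `[0, 1], continuous Y}.
  move=> t; apply: cvgB; first exact: (cont01M cty (ccst q1)).
  exact: (cont01M ctx (ccst q2)).
have c1X : {within `[0, 1], continuous (fun t => 1 + X t)} by apply: cont01D.
have [t0 t0in t0min] := EVT_min (@ler01 R) c1X.
have csg : {within `[0, 1], continuous sg}.
  apply: cont01M => //; apply: (@cont01V _ _ (1 + X t0)) => //.
  by apply: avoid; move: t0in; rewrite in_itv.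
have [r rin rmin] := EVT_min (@ler01 R) csg.
have [s sin smax] := EVT_max (@ler01 R) csg.
rewrite in_itv /= in rin; rewrite in_itv /= in sin.
have rmin' t : in01 t -> sg r <= sg t by move=> tin; apply: rmin; rewrite in_itv.
have smax' t : in01 t -> sg t <= sg s by move=> tin; apply: smax; rewrite in_itv.
have nohalf c : 0 < c -> sg s < c -> - c^-1 < sg r -> False.
  move=> c0 sc rc.
  (* Let q' be q rotated by a right angle. For this [k], the product T.(q + k q') = X + k Y equals
     (1 + X) (c - sg) (sg + 1/c) / 2, so it vanishes only for sg = c or sg = -1/c. *)
  pose k := (c - c^-1) / 2.
  have [t /andP[tt0 tt1] tz] := loop_direction_zero (q1 - k * q2) (q2 + k * q1).
  have tin : in01 t by rewrite /in01; lra.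
  have Z : X t + k * Y t = 0 by rewrite -[RHS]tz /X /Y; ring.
  have a0 := avoid tin.
  have YE : Y t = sg t * (1 + X t) by rewrite /sg divfK// gt_eqF.
  have xE : X t = (1 + X t) * (1 - sg t ^+ 2) / 2.
    by have E := sgE tin; rewrite mulrBr mulr1 (mulrC (1 + X t)) E; field.
  have {}Z : (1 + X t) * ((c - sg t) * (sg t + c^-1)) / 2 = 0.
    rewrite -[RHS]Z YE.
    transitivity ((1 + X t) * (1 - sg t ^+ 2) / 2 + k * (sg t * (1 + X t))).
      by rewrite /k; field; rewrite gt_eqF.
    by rewrite -xE.
  have p1 : 0 < c - sg t by have := smax' t tin; lra.
  have p2 : 0 < sg t + c^-1 by have := rmin' t tin; lra.
  by have := mulr_gt0 a0 (mulr_gt0 p1 p2); lra.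
have r_lt0 : sg r < 0.
  rewrite ltNge; apply/negP => r0.
  have s0 : 0 <= sg s by apply: le_trans (smax' r rin).
  apply: (nohalf (sg s + 1)); [lra|lra|].
  have : 0 < (sg s + 1)^-1 by rewrite invr_gt0; lra.
  by lra.
have nr0 : 0 < - sg r by rewrite oppr_gt0.
have srge : 1 <= sg s * - sg r.
  rewrite leNgt; apply/negP => H.
  have M1 : sg s < (- sg r)^-1 by rewrite -[ltRHS]mul1r ltr_pdivlMr.
  have M2 : 0 < (- sg r)^-1 by rewrite invr_gt0.
  (* Any positive [c] strictly between [sg s] and -1 / sg r contradicts [nohalf]; the maximum with 0
     ensures positivity. *)
  pose m := Num.max (sg s) 0.
  have m1 : m < (- sg r)^-1 by rewrite gt_max M1 M2.
  have m2 : sg s <= m by rewrite le_max lexx.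
  have m3 : 0 <= m by rewrite le_max lexx orbT.
  pose c := (m + (- sg r)^-1) / 2.
  have c0 : 0 < c by rewrite /c; lra.
  apply: (nohalf c) => //; first by rewrite /c; lra.
  rewrite ltrNl -[ltLHS]invrK ltf_pV2 ?posrE ?invr_gt0//.
  by rewrite /c; lra.
have s_gt0 : 0 < sg s by rewrite -(pmulr_lgt0 _ nr0); lra.
have ar := avoid rin; have as' := avoid sin.
(* For angles between 0 and pi, tan(a/2) tan(b/2) >= 1 forces cos a + cos b <= 0; the squared
   distances 2 - 2X then add up to at least 4. *)
have X0 : X r + X s <= 0.
  have Er := sgE rin; have Es := sgE sin.
  have : 1 <= sg s ^+ 2 * sg r ^+ 2.
    have -> : sg s ^+ 2 * sg r ^+ 2 = (sg s * - sg r) ^+ 2 by ring.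
    by rewrite exprn_ege1.
  move=> H.
  have : (1 + X s) * (1 + X r) <= (1 - X s) * (1 - X r).
    rewrite -Es -Er mulrACA -[leLHS]mul1r ler_wpM2r// mulr_ge0// ltW//.
  by lra.
have Ysg t : in01 t -> (0 <= Y t -> 0 <= sg t) /\ (Y t <= 0 -> sg t <= 0).
  move=> tin; have a0 := avoid tin; split=> Hy; rewrite /sg.
    by rewrite divr_ge0// ltW.
  by rewrite mulr_le0_ge0// invr_ge0 ltW.
(* Between the two extrema [sg] changes sign, so the tangent passes through q, where [tdist] is
   0. *)
have zero a b : 0 <= a -> a <= b -> b <= 1 -> Num.min (sg a) (sg b) <= 0 <= Num.max (sg a) (sg b) ->
    exists2 t, a <= t <= b & tdist D q1 q2 t = 0.
  move=> a0 ab b1 H.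
  have cab : {within `[a, b], continuous sg} by apply: continuous_subspaceW csg; exact: sub_dom.
  have [t] := IVT ab cab H; rewrite in_itv /= => tab st0; exists t => //.
  have tin : in01 t by rewrite /in01; lra.
  have := sgE tin; rewrite st0 expr0n mul0r => X1.
  apply/eqP; rewrite -sqrf_eq0 tdist_dot//; apply/eqP; lra.
exists (r, s); split => //=.
- by rewrite !tdist_dot//; lra.
- move=> t tin; have [Y1 Y2] := Ysg t tin; split=> Hy; apply: tdist_le => //.
    by rewrite ler_sqr ?nnegrE ?smax' ?Y1// ltW.
  rewrite -sqrrN -[leRHS]sqrrN ler_sqr ?nnegrE ?lerN2 ?rmin' ?oppr_ge0 ?Y2// ltW//.
have /andP[r0 r1] := rin; have /andP[s0 s1] := sin.
have [rs|/ltW sr] := leP r s.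
  have [|t /andP[rt ts] tz] := zero r s r0 rs s1.
    by rewrite ge_min (ltW r_lt0) le_max (ltW s_gt0) orbT.
  exact: (tdist_variation3 uq r0 rt ts s1 tz).
have [|t /andP[rt ts] tz] := zero s r s0 sr r1.
  by rewrite ge_min (ltW r_lt0) le_max (ltW s_gt0) orbT.
have := tdist_variation3 uq s0 rt ts r1 tz.
by rewrite [tdist _ _ _ s + _]addrC.
Qed.

End Loop.

Section LoopEnergy.
Variable R : realType.
Implicit Types (x y a b e d t : R).
Variable D : curve_data R.
Hypotheses (vD : valid_curve D) (L0 : 0 < len D).
Hypotheses (px1 : px D 1 = 0) (py1 : py D 1 = 0).

(* Here q bisects the tangents at the two ends.  If the tangent passes through
   -q, calibrate with e = -q, and otherwise with e = q. *)
Lemma loop_energy_bisector q1 q2 (c : R) : q1 ^+ 2 + q2 ^+ 2 = 1 ->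
  tx D 0 * q1 + ty D 0 * q2 = c -> tx D 1 * q1 + ty D 1 * q2 = c ->
  (ty D 0 * q1 - tx D 0 * q2) + (ty D 1 * q1 - tx D 1 * q2) = 0 ->
  c = 1 \/ c = 1 / 2 ->
  Num.sqrt 8 * (2 * Num.sqrt 3) <= nrg D.
Proof.
move=> uq u0 u1 sym cE.
have in0 : in01 (0 : R) by rewrite /in01; lra.
have in1 : in01 (1 : R) by rewrite /in01; lra.
have k0 : 0 <= Num.sqrt 8 :> R by exact: sqrtr_ge0.
have c12 : 1 / 2 <= c by case: cE => ->; lra.
have r30 : 0 <= Num.sqrt 3 :> R by exact: sqrtr_ge0.
have r3 : Num.sqrt 3 ^+ 2 = 3 :> R by rewrite sqr_sqrtr.
have [[t tin tz]|avoid] := pselect (exists2 t, in01 t & 1 + (tx D t * q1 + ty D t * q2) = 0).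
  (* The distance to -q is 0 at [t] and at least sqrt 3 at both ends, because its square there is 2
     + 2c >= 3. *)
  have uq' : (- q1) ^+ 2 + (- q2) ^+ 2 = 1 by rewrite !sqrrN.
  apply: le_trans (tdist_variation vD L0 px1 py1 uq' tin).
  rewrite ler_wpM2l//.
  have ft : tdist D (- q1) (- q2) t = 0.
    apply/eqP; rewrite -sqrf_eq0 (tdist_dot vD uq' tin); apply/eqP; lra.
  have f3 s : in01 s -> tx D s * q1 + ty D s * q2 = c -> Num.sqrt 3 <= tdist D (- q1) (- q2) s.
    move=> sin sc; rewrite -ler_sqr ?nnegrE ?sqrtr_ge0// (tdist_dot vD uq' sin) r3; lra.
  rewrite ft sub0r normrN subr0 !ger0_norm ?sqrtr_ge0//.
  by have := f3 0 in0 u0; have := f3 1 in1 u1; lra.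
have av t : in01 t -> 0 < 1 + (tx D t * q1 + ty D t * q2).
  move=> tin; rewrite lt_def; apply/andP; split.
    by apply/eqP => H; apply: avoid; exists t.
  have := tdist_dot vD uq tin; have := tangent_unit vD tin => U.
  have : 0 <= (tx D t + q1) ^+ 2 + (ty D t + q2) ^+ 2 by rewrite addr_ge0// sqr_ge0.
  rewrite (_ : _ + _ = (tx D t ^+ 2 + ty D t ^+ 2) + (q1 ^+ 2 + q2 ^+ 2) + 2 * (tx D t * q1 + ty D t * q2)).
    by rewrite U uq; lra.
  by ring.
have [[r s] /= [rin sin f4 ext]] := loop_extrema vD L0 px1 py1 uq av.
apply: le_trans; rewrite ler_wpM2l//.
have F0 := tdist_dot vD uq in0; have F1 := tdist_dot vD uq in1.
rewrite u0 in F0; rewrite u1 in F1.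
have p0 : 0 <= tdist D q1 q2 0 by exact: sqrtr_ge0.
have p1 : 0 <= tdist D q1 q2 1 by exact: sqrtr_ge0.
have pr : 0 <= tdist D q1 q2 r by exact: sqrtr_ge0.
have ps : 0 <= tdist D q1 q2 s by exact: sqrtr_ge0.
have [E00 E01] := ext 0 in0; have [E10 E11] := ext 1 in1.
move: F0 F1 p0 p1 E00 E01 E10 E11 f4 pr ps.
set f0 := tdist D q1 q2 0; set f1 := tdist D q1 q2 1.
set A := tdist D q1 q2 r; set B := tdist D q1 q2 s.
move=> F0 F1 p0 p1 E00 E01 E10 E11 f4 pr ps.
(* For c = 1 both end tangents are q, at distance 0, and A + B >= 2 suffices. For c = 1/2 both ends
   are at distance 1 from q. *)
case: cE => cE; rewrite cE in F0 F1.
  have -> : f0 = 0 by apply/eqP; rewrite -sqrf_eq0 F0; apply/eqP; lra.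
  have -> : f1 = 0 by apply/eqP; rewrite -sqrf_eq0 F1; apply/eqP; lra.
  have : Num.sqrt 3 <= 2 :> R by rewrite -ler_sqr ?nnegrE// r3; lra.
  have : 2 <= A + B.
    rewrite -ler_sqr ?nnegrE ?addr_ge0// sqrrD; have := mulr_ge0 pr ps; lra.
  by lra.
have f0E : f0 = 1 by apply/eqP; rewrite -(@eqrXn2 _ 2)// F0 expr1n; apply/eqP; lra.
have f1E : f1 = 1 by apply/eqP; rewrite -(@eqrXn2 _ 2)// F1 expr1n; apply/eqP; lra.
rewrite f0E f1E in E00 E01 E10 E11 *.
(* By [sym] the end tangents lie on opposite sides of q, so each extremum dominates one of them. *)
have [A1 B1] : 1 <= A /\ 1 <= B.
  have [Y0|Y0] := leP 0 (ty D 0 * q1 - tx D 0 * q2).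
    by split; [apply: E11; lra|exact: E00].
  by split; [apply: E01; exact: ltW|apply: E10; lra].
suff : 1 + Num.sqrt 3 <= A + B by lra.
have [B3|B3] := leP (Num.sqrt 3) B; first by lra.
rewrite -ler_sqr ?nnegrE ?addr_ge0//.
have B2 : B ^+ 2 < 3 by rewrite -r3 ltr_pXn2r ?nnegrE.
have B12 : 1 <= B ^+ 2 by rewrite exprn_ege1.
(* With t = B^2 in [1,3], A^2 B^2 >= t (4 - t) >= 3; then (A + B)^2 >= 4 + 2 sqrt 3 = (1 + sqrt
   3)^2. *)
have AB : Num.sqrt 3 <= A * B.
  rewrite -ler_sqr ?nnegrE ?mulr_ge0// r3 exprMn.
  have : (4 - B ^+ 2) * B ^+ 2 <= A ^+ 2 * B ^+ 2 by rewrite ler_wpM2r ?sqr_ge0//; lra.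
  by nra.
rewrite !sqrrD expr1n r3; lra.
Qed.

(** The bisector is the common tangent itself, or the sum of the two end tangents, which has length
    1 when they are 120 degrees apart. *)
Lemma loop_energy :
  (tx D 1 = tx D 0 /\ ty D 1 = ty D 0) \/ tx D 0 * tx D 1 + ty D 0 * ty D 1 = - 1 / 2 ->
  Num.sqrt 8 * (2 * Num.sqrt 3) <= nrg D.
Proof.
have in0 : in01 (0 : R) by rewrite /in01; lra.
have in1 : in01 (1 : R) by rewrite /in01; lra.
have U0 := tangent_unit vD in0; have U1 := tangent_unit vD in1.
case=> [[X1 Y1]|H].
  apply: (@loop_energy_bisector (tx D 0) (ty D 0) 1) => //.
  - by rewrite X1 Y1 -[RHS]U0 !expr2.
  - by rewrite X1 Y1; ring.
  - by left.
apply: (@loop_energy_bisector (tx D 0 + tx D 1) (ty D 0 + ty D 1) (1 / 2)).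
- transitivity ((tx D 0 ^+ 2 + ty D 0 ^+ 2) + (tx D 1 ^+ 2 + ty D 1 ^+ 2)
    + 2 * (tx D 0 * tx D 1 + ty D 0 * ty D 1)); first by ring.
  by rewrite U0 U1 H; field.
- transitivity ((tx D 0 ^+ 2 + ty D 0 ^+ 2) + (tx D 0 * tx D 1 + ty D 0 * ty D 1)); first by ring.
  by rewrite U0 H; field.
- transitivity ((tx D 1 ^+ 2 + ty D 1 ^+ 2) + (tx D 0 * tx D 1 + ty D 0 * ty D 1)); first by ring.
  by rewrite U1 H; field.
- by ring.
- by right.
Qed.

End LoopEnergy.

(** * The standard double bubble *)

Section DoubleBubble.
Variable R : realType.
Implicit Types (x y a b e d h : R).

Lemma sin_lipschitz a b : a <= b -> `|sin b - sin a| <= b - a.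
Proof.
move=> ab.
have [c _ ->] := @MVT_segment R sin cos a b ab (fun x _ => is_derive_sin x)
  (continuous_subspaceT (@continuous_sin R)).
by rewrite normrM (ger0_norm (_ : 0 <= b - a)) ?subr_ge0// ler_piMl ?subr_ge0// cos_max.
Qed.

Lemma cos_lipschitz a b : a <= b -> `|cos b - cos a| <= b - a.
Proof.
move=> ab.
have [c _ ->] := @MVT_segment R cos (fun x => - sin x) a b ab (fun x _ => is_derive_cos x)
  (continuous_subspaceT (@continuous_cos R)).
rewrite normrM (ger0_norm (_ : 0 <= b - a)) ?subr_ge0// ler_piMl ?subr_ge0//.
by rewrite normrN sin_max.
Qed.

Lemma sin_chord a b : a <= b -> `|sin b - sin a - (b - a) * cos a| <= (b - a) ^+ 2.
Proof.
move=> ab.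
have [c] := @MVT_segment R sin cos a b ab (fun x _ => is_derive_sin x)
  (continuous_subspaceT (@continuous_sin R)).
rewrite in_itv /= => /andP[ac cb] ->.
have ab0 : 0 <= b - a by rewrite subr_ge0.
rewrite mulrC -mulrBr normrM (ger0_norm ab0) expr2 ler_wpM2l//.
by apply: le_trans (cos_lipschitz ac) _; rewrite lerD2r.
Qed.

Lemma cos_chord a b : a <= b -> `|cos a - cos b - (b - a) * sin a| <= (b - a) ^+ 2.
Proof.
move=> ab.
have [c] := @MVT_segment R cos (fun x => - sin x) a b ab (fun x _ => is_derive_cos x)
  (continuous_subspaceT (@continuous_cos R)).
rewrite in_itv /= => /andP[ac cb] E.
have ab0 : 0 <= b - a by rewrite subr_ge0.
rewrite (_ : _ - _ = (b - a) * (sin c - sin a)); last first.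
  by rewrite -[cos a - cos b]opprB E; ring.
rewrite normrM (ger0_norm ab0) expr2 ler_wpM2l//.
by apply: le_trans (sin_lipschitz ac) _; rewrite lerD2r.
Qed.

Lemma cos_half x : cos x = 1 - 2 * sin (x / 2) ^+ 2.
Proof.
have {1}-> : x = (x / 2) *+ 2 by rewrite -mulr_natr divfK.
by rewrite cos_mulr2n cos2sin2 -mulr_natr; ring.
Qed.

Lemma sin_le x : 0 <= x -> `|sin x| <= x.
Proof. by move=> x0; have := sin_lipschitz x0; rewrite sin0 !subr0. Qed.

Lemma cos_ge x : 0 <= x -> 1 - x ^+ 2 / 2 <= cos x.
Proof.
move=> x0; rewrite cos_half; have x20 : 0 <= x / 2 by rewrite divr_ge0.
have := sin_le x20.
have : sin (x / 2) ^+ 2 = `|sin (x / 2)| ^+ 2 by rewrite real_normK ?num_real.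
move=> -> H; have : `|sin (x / 2)| ^+ 2 <= (x / 2) ^+ 2 by rewrite lerXn2r ?nnegrE.
by rewrite expr_div_n; lra.
Qed.

Lemma sin_ge x : 0 <= x -> x - x ^+ 3 / 6 <= sin x.
Proof.
move=> x0.
have D (t : R) : is_derive t (1 : R) (fun s => sin s - (s - (s * (s * s)) / 6)) (cos t - (1 - t ^+ 2 / 2)).
  have I := is_derive_id t (1 : R).
  have C := is_deriveM I (is_deriveM I I).
  have E := is_deriveB (is_derive_sin t) (is_deriveB I (is_deriveZ (6^-1 : R) C)).
  have -> : (fun s : R => sin s - (s - (s * (s * s)) / 6)) =
      (sin - (id - (6^-1 \*: (id * (id * id))))).
    by apply/funext => s; rewrite [in LHS](mulrC (s * (s * s))).
  by apply: is_derive_eq E _; rewrite !fctE /GRing.scale /=; field.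
have cs : {within `[0, x], continuous (fun s => sin s - (s - (s * (s * s)) / 6))}.
  apply: continuous_subspaceT => t; apply/differentiable_continuous/derivable1_diffP.
  by case: (D t).
have [c] := MVT_segment x0 (fun t _ => D t) cs.
rewrite in_itv /= => /andP[c0 cx].
rewrite sin0 !mul0r !subr0 => E.
have : 0 <= sin x - (x - x * (x * x) / 6).
  rewrite E mulr_ge0// subr_ge0; exact: cos_ge.
by rewrite (_ : x ^+ 3 = x * (x * x)) ?exprS ?expr0 ?mulr1//; lra.
Qed.

(** The angle 2 pi / 3; written as an [acos], it has a cosine known at once. *)
Definition bubble_angle : R := acos (- 1 / 2).

Lemma bubble_range : -1 <= (- 1 / 2 : R) <= 1.
Proof. by apply/andP; split; lra. Qed.

Lemma cos_bubble : cos bubble_angle = - 1 / 2.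
Proof. by rewrite /bubble_angle acosK// in_itv /= bubble_range. Qed.

Lemma bubble_gt0 : 0 < bubble_angle.
Proof. by apply: acos_gt0; apply/andP; split; lra. Qed.

Lemma sin_bubble_sqr : sin bubble_angle ^+ 2 = 3 / 4.
Proof. by rewrite sin2cos2 cos_bubble; field. Qed.

Lemma sin_bubble_gt0 : 0 < sin bubble_angle.
Proof.
have : 0 <= sin bubble_angle.
  by apply: sin_ge0_pi; rewrite acos_ge0 ?acos_lepi ?bubble_range.
rewrite le_eqVlt => /orP[/eqP H|//].
by have := sin_bubble_sqr; rewrite -H expr0n /=; lra.
Qed.

(** The true value is about 2.094. As the cosine decreases on [0, pi], cos(11/5) < -1/2 suffices,
    and halving the angle twice reduces this to bounds on sin(11/20). *)
Lemma bubble_lt : bubble_angle < 11 / 5.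
Proof.
have [p|p] := leP (11 / 5 : R) pi; last first.
  apply: lt_trans p; apply: acos_ltpi; apply/andP; split; lra.
have m1 : (11 / 5 : R) \in `[0, pi] by rewrite in_itv /= p andbT divr_ge0.
have m2 : bubble_angle \in `[0, pi].
  by rewrite in_itv /= (ltW bubble_gt0) acos_lepi ?bubble_range.
rewrite -(ltr_cos m2 m1).
rewrite cos_bubble.
have c1 : cos (11 / 5) = 2 * cos (11 / 10) ^+ 2 - 1 :> R.
  have -> : 11 / 5 = (11 / 10) *+ 2 :> R by rewrite -mulr_natr; field.
  by rewrite cos_mulr2n -mulr_natr mulrC.
have c2 : cos (11 / 10) = 1 - 2 * sin (11 / 20) ^+ 2 :> R.
  by rewrite cos_half; congr (1 - 2 * sin _ ^+ 2); field.
have s1 : 52 / 100 <= sin (11 / 20) :> R.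
  apply: le_trans (@sin_ge (11 / 20) _); last by rewrite divr_ge0.
  by rewrite !exprS expr0; lra.
have s2 : `|sin (11 / 20)| <= 11 / 20 :> R by apply: sin_le; rewrite divr_ge0.
have s3 : sin (11 / 20) <= 11 / 20 :> R by exact: le_trans (ler_norm _) s2.
rewrite c1 c2; set s := sin _ in s1 s2 s3 *.
have q1 : (52 / 100) ^+ 2 <= s ^+ 2 by rewrite lerXn2r ?nnegrE ?divr_ge0//; lra.
have q2 : s ^+ 2 <= (11 / 20) ^+ 2 by rewrite lerXn2r ?nnegrE ?divr_ge0//; lra.
rewrite !expr_div_n in q1 q2.
have l1 : 0 <= 1 - 2 * s ^+ 2 by lra.
have l2 : 1 - 2 * s ^+ 2 <= 46 / 100 by lra.
have : (1 - 2 * s ^+ 2) ^+ 2 <= (46 / 100) ^+ 2 by rewrite lerXn2r ?nnegrE ?divr_ge0.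
by rewrite expr_div_n; lra.
Qed.

Definition arc_angle x : R := - bubble_angle + 2 * bubble_angle * x.

(** Arc of a unit circle, of length 4 pi / 3 over a chord of length sqrt 3, for s = 1 or its mirror
    image for s = -1; since k^2 = 1 the energy is twice the length. *)
Definition arc_data (s : R) : curve_data R := CurveData
  (2 * bubble_angle) (4 * bubble_angle)
  (fun x => cos (arc_angle x)) (fun x => s * sin (arc_angle x))
  (fun x => (sin (arc_angle x) + sin bubble_angle) / (2 * bubble_angle))
  (fun x => s * ((cos bubble_angle - cos (arc_angle x)) / (2 * bubble_angle)))
  (fun x => (2 * bubble_angle) ^+ 2 * x).

Lemma arc_angle0 : arc_angle 0 = - bubble_angle.
Proof. by rewrite /arc_angle mulr0 addr0. Qed.

Lemma arc_angle1 : arc_angle 1 = bubble_angle.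
Proof. by rewrite /arc_angle; ring. Qed.

Lemma arc_valid s : s ^+ 2 = 1 -> valid_curve (arc_data s).
Proof.
move=> s2; have a0 := bubble_gt0.
have an0 : bubble_angle != 0 by rewrite gt_eqF.
have w0 : 0 < 2 * bubble_angle by rewrite mulr_gt0.
have am x y : x <= y -> arc_angle x <= arc_angle y.
  by move=> xy; rewrite lerD2l ler_wpM2l// ltW.
have ad x y : arc_angle y - arc_angle x = 2 * bubble_angle * (y - x) by rewrite /arc_angle; ring.
(* A chord error quadratic in y - x has a square of order four; the surplus power is dropped because
   y - x <= 1. *)
have chord (z x y : R) : 0 <= x -> x <= y -> y <= 1 ->
    `|z| <= (arc_angle y - arc_angle x) ^+ 2 ->
    (z / (2 * bubble_angle)) ^+ 2 <= (y - x) ^+ 3 * ((2 * bubble_angle) ^+ 2 * 1).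
  move=> x0 xy y1; rewrite ad => H.
  have h0 : 0 <= y - x by rewrite subr_ge0.
  have h1 : y - x <= 1 by lra.
  rewrite expr_div_n ler_pdivrMr ?exprn_gt0// mulr1.
  rewrite -(real_normK (num_real z)).
  apply: (@le_trans _ _ (((2 * bubble_angle * (y - x)) ^+ 2) ^+ 2)).
    by rewrite lerXn2r ?nnegrE ?sqr_ge0.
  rewrite (_ : _ ^+ 2 = (y - x) ^+ 3 * (2 * bubble_angle) ^+ 2 * (2 * bubble_angle) ^+ 2 * (y - x)); last by ring.
  by rewrite ler_piMr// !mulr_ge0// ?exprn_ge0// ltW.
constructor => /=.
- exact: ltW.
- by move=> x _; rewrite exprMn s2 mul1r cos2Dsin2.
- by rewrite mulr0.
- by move=> x y _ xy _; rewrite ler_wpM2l// exprn_ge0// ltW.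
- move=> x y x0 xy y1.
  rewrite -mulrBr exprMn s2 mul1r.
  have -> : (cos (arc_angle y) - cos (arc_angle x)) ^+ 2 + (sin (arc_angle y) - sin (arc_angle x)) ^+ 2
     = 2 - 2 * cos (arc_angle y - arc_angle x).
    rewrite cosB; have := cos2Dsin2 (arc_angle y); have := cos2Dsin2 (arc_angle x) => H1 H2.
    transitivity ((cos (arc_angle x) ^+ 2 + sin (arc_angle x) ^+ 2) +
      (cos (arc_angle y) ^+ 2 + sin (arc_angle y) ^+ 2) -
      2 * (cos (arc_angle y) * cos (arc_angle x) + sin (arc_angle y) * sin (arc_angle x))).
      by ring.
    by rewrite H1 H2; ring.
  have d0 : 0 <= arc_angle y - arc_angle x by rewrite subr_ge0 am.
  have := cos_ge d0; rewrite ad exprMn => H.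
  by rewrite -mulrBr mulrCA -expr2; lra.
- split; first by rewrite arc_angle0 sinN addrC subrr mul0r.
  by rewrite arc_angle0 cosN subrr mul0r mulr0.
- move=> x y x0 xy y1.
  have H := sin_chord (am x y xy).
  have := chord _ x y x0 xy y1 H; apply: le_trans; rewrite le_eqVlt; apply/orP; left; apply/eqP.
  congr (_ ^+ 2); rewrite ad.
  move: (sin (arc_angle y)) (sin (arc_angle x)) (cos (arc_angle x)) (sin bubble_angle) => u1 u2 u3 u4.
  by move: bubble_angle an0 => A An0; field.
- move=> x y x0 xy y1.
  have H := cos_chord (am x y xy).
  have := chord _ x y x0 xy y1 H; apply: le_trans; rewrite le_eqVlt; apply/orP; left; apply/eqP.
  transitivity ((s * ((cos (arc_angle x) - cos (arc_angle y) -
    (arc_angle y - arc_angle x) * sin (arc_angle x)) / (2 * bubble_angle))) ^+ 2); last first.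
    by rewrite exprMn s2 mul1r.
  congr (_ ^+ 2).
  rewrite ad.
  move: (cos (arc_angle y)) (sin (arc_angle x)) (cos (arc_angle x)) (cos bubble_angle) => u1 u2 u3 u4.
  by move: bubble_angle an0 => A An0; field.
- by rewrite mulr1 expr2 le_eqVlt; apply/orP; left; apply/eqP; ring.
- lra.
Qed.

Definition segment_data (l : R) : curve_data R := CurveData l l
  (fun=> 1) (fun=> 0) (fun x => x) (fun=> 0) (fun=> 0).

Lemma segment_valid l : 0 <= l -> valid_curve (segment_data l).
Proof.
move=> l0; constructor => //=.
- by move=> x _; rewrite expr1n expr0n addr0.
- by move=> x y x0 xy y1; rewrite !subrr expr0n addr0 mulr0.
- by move=> x y x0 xy y1; rewrite mulr1 subrr expr0n mulr0.
- by move=> x y x0 xy y1; rewrite mulr0 !subrr expr0n mulr0.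
- by rewrite subrr mulr0.
Qed.

End DoubleBubble.

(** * Networks *)

Section Networks.
Variable R : realType.
Implicit Types (D : 'I_3 -> curve_data R) (G : 'I_3 -> R -> 'rV[R]_2).

Record valid_network D : Prop := ValidNetwork {
  net_curve : forall i, valid_curve (D i);
  net_end : forall i j, len (D i) * px (D i) 1 = len (D j) * px (D j) 1 /\
                        len (D i) * py (D i) 1 = len (D j) * py (D j) 1;
  net_tangent0 : \sum_(i < 3) tx (D i) 0 = 0 /\ \sum_(i < 3) ty (D i) 0 = 0;
  net_tangent1 : \sum_(i < 3) tx (D i) 1 = 0 /\ \sum_(i < 3) ty (D i) 1 = 0 }.

(** This replaces a relabelling of the curves: two of them are singled out and sums over the three
    split accordingly. *)
Lemma third_index (i j : 'I_3) : i != j ->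
  exists2 k, (k != i) && (k != j) &
    forall (F : 'I_3 -> R), \sum_(l < 3) F l = F i + F j + F k.
Proof.
have S (F : 'I_3 -> R) : \sum_(l < 3) F l =
    F (@Ordinal 3 0 isT) + F (@Ordinal 3 1 isT) + F (@Ordinal 3 2 isT).
  rewrite !big_ord_recl big_ord0 addr0 addrA.
  by congr (_ + _ + _); congr F; exact: val_inj.
case: i => [[|[|[|//]]] pi]; case: j => [[|[|[|//]]] pj] // _;
  rewrite (bool_irrelevance pi isT) (bool_irrelevance pj isT).
- by exists (@Ordinal 3 2 isT) => // F; rewrite S.
- by exists (@Ordinal 3 1 isT) => // F; rewrite S addrAC.
- by exists (@Ordinal 3 2 isT) => // F; rewrite S [F _ + F _]addrC.
- by exists (@Ordinal 3 0 isT) => // F; rewrite S -addrA addrC.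
- by exists (@Ordinal 3 1 isT) => // F; rewrite S; ring.
- by exists (@Ordinal 3 0 isT) => // F; rewrite S; ring.
Qed.

Lemma int_ds_ge0 (g : R -> 'rV[R]_2) :
  (0 <= int_ds g (fun x => curvature g x ^+ 2 + 1)%R)%E.
Proof.
apply: integral_ge0 => x _; rewrite lee_fin mulr_ge0 ?enorm_ge0//.
by rewrite addr_ge0// sqr_ge0.
Qed.

Lemma penalized_energy_ge0 G : (0 <= penalized_energy G)%E.
Proof. by apply: sume_ge0 => i _; exact: int_ds_ge0. Qed.

Lemma theta_network_data G : theta_network G -> (penalized_energy G < +oo)%E ->
  exists D, [/\ valid_network D, forall i, 0 < len (D i) &
    penalized_energy G = (\sum_(i < 3) nrg (D i))%:E].
Proof.
move=> [regG [P1 hP1] [P2 hP2] t0 t1] fin.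
have fini i : (int_ds (G i) (fun x => curvature (G i) x ^+ 2 + 1)%R < +oo)%E.
  apply: le_lt_trans fin; rewrite /penalized_energy (bigD1 i)//= leeDl//.
  by apply: sume_ge0 => j _; exact: int_ds_ge0.
have [D HD] := choice (fun i => curve_to_data (regG i).1 (regG i).2 (fini i)).
exists D; split.
- constructor.
  + by move=> i; case: (HD i).
  + move=> i j; case: (HD i) => _ _ _ _ [-> ->]; case: (HD j) => _ _ _ _ [-> ->].
    by rewrite !hP1 !hP2.
  + have E j : \sum_(i < 3) tau (G i) 0 0 j = 0.
      by have := congr1 (fun v : 'rV[R]_2 => v 0 j) t0; rewrite summxE mxE.
    split; [rewrite -[RHS](E 0)|rewrite -[RHS](E 1)]; apply: eq_bigr => i _;
      by have [_ _ _ [E1 E2 _ _] _] := HD i.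
  + have E j : \sum_(i < 3) tau (G i) 1 0 j = 0.
      by have := congr1 (fun v : 'rV[R]_2 => v 0 j) t1; rewrite summxE mxE.
    split; [rewrite -[RHS](E 0)|rewrite -[RHS](E 1)]; apply: eq_bigr => i _;
      by have [_ _ _ [_ _ E3 E4] _] := HD i.
- by move=> i; case: (HD i).
- by rewrite -sumEFin; apply: eq_bigr => i _; case: (HD i).
Qed.

Lemma data_theta_network D : valid_network D -> (forall i, 0 < len (D i)) ->
  exists2 G, theta_network G & (penalized_energy G <= (\sum_(i < 3) nrg (D i))%:E)%E.
Proof.
move=> vD L0; have vi := net_curve vD.
have in0 : in01 (0 : R) by rewrite /in01; lra.
have in1 : in01 (1 : R) by rewrite /in01; lra.
exists (fun i => curve_of (D i)); last first.
  rewrite -sumEFin; apply: lee_sum => i _; exact: curve_of_energy.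
split.
- by move=> i; split; [exact: curve_of_regular|exact: curve_of_H2].
- exists 0 => i; apply/rowP => j; rewrite !mxE.
  by rewrite (pos0 (vi i)).1 (pos0 (vi i)).2 if_same mulr0.
- exists (curve_of (D 0) 1) => i; apply/rowP => j; rewrite !mxE.
  by have [E1 E2] := net_end vD i 0; case: ifP.
- apply/rowP => j; rewrite summxE mxE.
  have [E1 E2] := net_tangent0 vD.
  transitivity (\sum_(i < 3) (if j == 0 then tx (D i) 0 else ty (D i) 0)).
    by apply: eq_bigr => i _; rewrite curve_of_tau// mxE.
  by case: (j == 0).
- apply/rowP => j; rewrite summxE mxE.
  have [E1 E2] := net_tangent1 vD.
  transitivity (\sum_(i < 3) (if j == 0 then tx (D i) 1 else ty (D i) 1)).
    by apply: eq_bigr => i _; rewrite curve_of_tau// mxE.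
  by case: (j == 0).
Qed.

(** Expand |u + v|^2 = |w|^2 = 1. *)
Lemma unit_sum0_dot (u1 u2 v1 v2 w1 w2 : R) :
  u1 ^+ 2 + u2 ^+ 2 = 1 -> v1 ^+ 2 + v2 ^+ 2 = 1 -> w1 ^+ 2 + w2 ^+ 2 = 1 ->
  u1 + v1 + w1 = 0 -> u2 + v2 + w2 = 0 -> u1 * v1 + u2 * v2 = - 1 / 2.
Proof.
move=> U V W s1 s2.
have w1E : w1 = - (u1 + v1) by lra.
have w2E : w2 = - (u2 + v2) by lra.
move: W; rewrite w1E w2E => W.
have : (u1 ^+ 2 + u2 ^+ 2) + (v1 ^+ 2 + v2 ^+ 2) + 2 * (u1 * v1 + u2 * v2) = 1.
  by rewrite -[RHS]W; ring.
by rewrite U V; lra.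
Qed.

(* If two curves are short, their tangents stay close to directions at 120
   degrees, so that the two curves cannot have the same endpoint. *)
Lemma network_two_short D i j : valid_network D -> (forall i, 0 < len (D i)) ->
  \sum_(l < 3) nrg (D l) <= 21 -> i != j ->
  1 / 100 <= Num.max (len (D i)) (len (D j)).
Proof.
move=> vD L0 E21 ij; rewrite leNgt gt_max; apply/negP => /andP[Li Lj].
have [k _ sumk] := third_index ij.
have vi := net_curve vD.
have in0 : in01 (0 : R) by rewrite /in01; lra.
have n0 l : 0 <= nrg (D l) by apply: le_trans (len_le_nrg (vi l)); exact: ltW.
(* [var_energy] bounds var(1) by L (nrg - L), with L < 1/100 and nrg <= 21. *)
have V l : len (D l) < 1 / 100 -> nrg (D l) <= 21 -> var (D l) 1 <= 21 / 100.
  move=> Ll nl; apply: le_trans (var_energy (vi l)) _.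
  have := L0 l; have := n0 l; set a := len _ in Ll *; set b := nrg _ in nl *.
  nra.
rewrite sumk in E21; have ni := n0 i; have nj := n0 j; have nk := n0 k.
have Vi := V i Li ltac:(lra); have Vj := V j Lj ltac:(lra).
have chx l : (px (D l) 1 - tx (D l) 0) ^+ 2 <= var (D l) 1.
  have := chord_x (vi l) (lexx 0) ler01 (lexx 1).
  by rewrite (pos0 (vi l)).1 !subr0 mul1r expr1n mul1r.
have chy l : (py (D l) 1 - ty (D l) 0) ^+ 2 <= var (D l) 1.
  have := chord_y (vi l) (lexx 0) ler01 (lexx 1).
  by rewrite (pos0 (vi l)).2 !subr0 mul1r expr1n mul1r.
have [s1 s2] := net_tangent0 vD; rewrite !sumk in s1 s2.
have Ui := tangent_unit (vi i) in0; have Uj := tangent_unit (vi j) in0.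
have Uk := tangent_unit (vi k) in0.
have dot := unit_sum0_dot Ui Uj Uk s1 s2.
(* The difference v of the two initial tangents has scalar products 3/2 and -3/2 with them, so it
   separates the directions of the two endpoints. *)
pose v1 := tx (D i) 0 - tx (D j) 0; pose v2 := ty (D i) 0 - ty (D j) 0.
have vv : v1 ^+ 2 + v2 ^+ 2 = 3.
  transitivity ((tx (D i) 0 ^+ 2 + ty (D i) 0 ^+ 2) + (tx (D j) 0 ^+ 2 + ty (D j) 0 ^+ 2)
     - 2 * (tx (D i) 0 * tx (D j) 0 + ty (D i) 0 * ty (D j) 0)); first by rewrite /v1 /v2; ring.
  by rewrite Ui Uj dot; field.
have Ti : tx (D i) 0 * v1 + ty (D i) 0 * v2 = 3 / 2.
  transitivity ((tx (D i) 0 ^+ 2 + ty (D i) 0 ^+ 2)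
     - (tx (D i) 0 * tx (D j) 0 + ty (D i) 0 * ty (D j) 0)); first by rewrite /v1 /v2; ring.
  by rewrite Ui dot; field.
have Tj : tx (D j) 0 * v1 + ty (D j) 0 * v2 = - (3 / 2).
  transitivity (- (tx (D j) 0 ^+ 2 + ty (D j) 0 ^+ 2)
     + (tx (D i) 0 * tx (D j) 0 + ty (D i) 0 * ty (D j) 0)); first by rewrite /v1 /v2; ring.
  by rewrite Uj dot; field.
(* By Cauchy-Schwarz the square is at most 3 times 42/100, that is 1.26, below 9/4. *)
have small (r1 r2 : R) : r1 ^+ 2 <= 21 / 100 -> r2 ^+ 2 <= 21 / 100 -> `|r1 * v1 + r2 * v2| < 3 / 2.
  move=> R1 R2; rewrite -ltr_sqr ?nnegrE ?divr_ge0// real_normK ?num_real//.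
  apply: (@le_lt_trans _ _ ((r1 ^+ 2 + r2 ^+ 2) * (v1 ^+ 2 + v2 ^+ 2))).
    rewrite -subr_ge0 (_ : _ - _ = (r1 * v2 - r2 * v1) ^+ 2) ?sqr_ge0//; ring.
  rewrite vv expr_div_n; lra.
have := small _ _ (le_trans (chx i) Vi) (le_trans (chy i) Vi).
have := small _ _ (le_trans (chx j) Vj) (le_trans (chy j) Vj).
rewrite !ltr_norml => /andP[_ Hj] /andP[Hi _].
have Pi : 0 < px (D i) 1 * v1 + py (D i) 1 * v2.
  by move: Hi; rewrite !mulrBl; lra.
have Pj : px (D j) 1 * v1 + py (D j) 1 * v2 < 0.
  by move: Hj; rewrite !mulrBl; lra.
have [e1 e2] := net_end vD i j.
have : len (D i) * (px (D i) 1 * v1 + py (D i) 1 * v2) = len (D j) * (px (D j) 1 * v1 + py (D j) 1 * v2).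
  by rewrite !mulrDr !mulrA e1 e2.
have := mulr_gt0 (L0 i) Pi; have := L0 j => Lj0.
have : len (D j) * (px (D j) 1 * v1 + py (D j) 1 * v2) < 0 by rewrite pmulr_rlt0.
by lra.
Qed.

(** The hypothesis on pairs lets at most one length vanish. Then [var_energy] freezes that tangent,
    and [loop_energy] applies to both other curves. *)
Lemma network_nondegenerate D : valid_network D ->
  (forall i j, i != j -> 1 / 100 <= Num.max (len (D i)) (len (D j))) ->
  \sum_(l < 3) nrg (D l) < 2 * (Num.sqrt 8 * (2 * Num.sqrt 3)) ->
  forall i, 0 < len (D i).
Proof.
move=> vD short El i; have vi := net_curve vD.
have in0 : in01 (0 : R) by rewrite /in01; lra.
have in1 : in01 (1 : R) by rewrite /in01; lra.
rewrite lt_def len_ge0// andbT; apply/eqP => Li0.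
have Lj0 j : j != i -> 0 < len (D j).
  move=> ji; have := short j i ji; rewrite le_max Li0 => /orP[|]; lra.
have Vi0 : var (D i) 1 <= 0 by have := var_energy (vi i); rewrite Li0 mul0r.
have Tc := tangent_var (vi i) (lexx 0) ler01 (lexx 1).
rewrite (var0 (vi i)) !subr0 mul1r in Tc.
have sx0 := sqr_ge0 (tx (D i) 1 - tx (D i) 0).
have sy0 := sqr_ge0 (ty (D i) 1 - ty (D i) 0).
have tx1 : tx (D i) 1 = tx (D i) 0.
  by apply/eqP; rewrite -subr_eq0 -sqrf_eq0; apply/eqP; lra.
have ty1 : ty (D i) 1 = ty (D i) 0.
  by apply/eqP; rewrite -subr_eq0 -sqrf_eq0; apply/eqP; lra.
have loop j : j != i -> Num.sqrt 8 * (2 * Num.sqrt 3) <= nrg (D j).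
  move=> ji; have Lj := Lj0 j ji.
  have [ex ey] := net_end vD j i; rewrite Li0 !mul0r in ex ey.
  have px1 : px (D j) 1 = 0.
    by move/eqP: ex; rewrite mulf_eq0 gt_eqF//= => /eqP.
  have py1 : py (D j) 1 = 0.
    by move/eqP: ey; rewrite mulf_eq0 gt_eqF//= => /eqP.
  apply: (loop_energy (vi j) Lj px1 py1).
  have ij : i != j by rewrite eq_sym.
  have [k _ sumk] := third_index ij.
  have [s1 s2] := net_tangent0 vD; rewrite !sumk in s1 s2.
  have [r1 r2] := net_tangent1 vD; rewrite !sumk tx1 ty1 in r1 r2.
  have Ui := tangent_unit (vi i) in0.
  have Uj := tangent_unit (vi j) in0; have Uk := tangent_unit (vi k) in0.
  have Uj' := tangent_unit (vi j) in1; have Uk' := tangent_unit (vi k) in1.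
  have d0 := unit_sum0_dot Ui Uj Uk s1 s2.
  have d1 := unit_sum0_dot Ui Uj' Uk' r1 r2.
  move: Ui Uj Uj' d0 d1.
  set a1 := tx (D i) 0; set a2 := ty (D i) 0; set u1 := tx (D j) 0; set u2 := ty (D j) 0.
  set w1 := tx (D j) 1; set w2 := ty (D j) 1 => Ua Uu Uw d0 d1.
  pose p := u2 * a1 - u1 * a2; pose q := w2 * a1 - w1 * a2.
  have p2 : p ^+ 2 = 3 / 4.
    transitivity ((a1 ^+ 2 + a2 ^+ 2) * (u1 ^+ 2 + u2 ^+ 2) - (a1 * u1 + a2 * u2) ^+ 2); first by rewrite /p; ring.
    by rewrite Ua Uu d0; field.
  have q2 : q ^+ 2 = 3 / 4.
    transitivity ((a1 ^+ 2 + a2 ^+ 2) * (w1 ^+ 2 + w2 ^+ 2) - (a1 * w1 + a2 * w2) ^+ 2); first by rewrite /q; ring.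
    by rewrite Ua Uw d1; field.
  have uw : u1 * w1 + u2 * w2 = 1 / 4 + p * q.
    transitivity ((a1 ^+ 2 + a2 ^+ 2) * (u1 * w1 + u2 * w2)); first by rewrite Ua mul1r.
    transitivity ((a1 * u1 + a2 * u2) * (a1 * w1 + a2 * w2) + p * q); first by rewrite /p /q; ring.
    by rewrite d0 d1; field.
  have : (p - q) * (p + q) = 0 by rewrite -subr_sqr p2 q2 subrr.
  move/eqP; rewrite mulf_eq0 => /orP[/eqP pq|/eqP pq].
    left; have uw1 : u1 * w1 + u2 * w2 = 1.
      by rewrite uw (_ : q = p) -?expr2 ?p2; [field|lra].
    have : (w1 - u1) ^+ 2 + (w2 - u2) ^+ 2 = 0.
      transitivity ((u1 ^+ 2 + u2 ^+ 2) + (w1 ^+ 2 + w2 ^+ 2) - 2 * (u1 * w1 + u2 * w2)); first by ring.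
      by rewrite Uu Uw uw1; ring.
    have b1 := sqr_ge0 (w1 - u1); have b2 := sqr_ge0 (w2 - u2) => H.
    by split; apply/eqP; rewrite -subr_eq0 -sqrf_eq0; apply/eqP; lra.
  right; rewrite uw (_ : q = - p); last by lra.
  by rewrite mulrN -expr2 p2; field.
have [j ji] : exists j : 'I_3, i != j.
  have [->|i0] := eqVneq i ord0; first by exists ord_max.
  by exists ord0.
have [k /andP[ki kj] sumk] := third_index ji.
have nj := loop j; rewrite eq_sym ji in nj; have nk := loop k ki.
have {}nj := nj isT.
have ni := len_le_nrg (vi i); rewrite Li0 in ni.
by rewrite sumk in El; lra.
Qed.

Lemma bubble_network : exists D, [/\ valid_network D, forall i, 0 < len (D i) &
  \sum_(i < 3) nrg (D i) = 8 * bubble_angle R + 2 * sin (bubble_angle R)].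
Proof.
have a0 := bubble_gt0 R; have s0 := sin_bubble_gt0 R.
pose D (i : 'I_3) := if i == 0 :> nat then arc_data 1
  else if i == 1 :> nat then arc_data (- 1) else segment_data (2 * sin (bubble_angle R)).
have l0 : 0 < 2 * sin (bubble_angle R) by rewrite mulr_gt0.
have S (F : 'I_3 -> R) : \sum_(l < 3) F l =
    F (@Ordinal 3 0 isT) + F (@Ordinal 3 1 isT) + F (@Ordinal 3 2 isT).
  rewrite !big_ord_recl big_ord0 addr0 addrA.
  by congr (_ + _ + _); congr F; exact: val_inj.
exists D; split.
- constructor.
  + move=> i; rewrite /D; case: ifP => _; first by apply: arc_valid; rewrite expr1n.
    by case: ifP => _; [apply: arc_valid; rewrite sqrrN expr1n|apply: segment_valid; exact: ltW].
  + have an0 : 2 * bubble_angle R != 0 by rewrite gt_eqF// mulr_gt0.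
    have E i : len (D i) * px (D i) 1 = 2 * sin (bubble_angle R) /\ len (D i) * py (D i) 1 = 0.
      rewrite /D; case: ifP => _ /=.
        rewrite arc_angle1 subrr mul0r !mulr0; split => //.
        by rewrite mulrC divfK//; ring.
      case: ifP => _ /=.
        rewrite arc_angle1 subrr mul0r !mulr0; split => //.
        by rewrite mulrC divfK//; ring.
      by rewrite mulr1 mulr0.
    by move=> i j; have [-> ->] := E i; have [-> ->] := E j.
  + by rewrite !S /D /= arc_angle0 cosN cos_bubble; split; [field|ring].
  + by rewrite !S /D /= arc_angle1 cos_bubble; split; [field|ring].
- move=> i; rewrite /D; case: ifP => _ /=; first by rewrite mulr_gt0.
  by case: ifP => _ //=; rewrite mulr_gt0.
- by rewrite S /D /=; ring.
Qed.

(** With 11/5 for the angle and 87/100 for its sine the energy is below 19.34, while 8 sqrt 6 = 4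
    sqrt 24 exceeds 4 times 4.89, that is 19.56. The bound 20 serves to keep a minimizing sequence
    below energy 21. *)
Lemma bubble_energy_lt : 8 * bubble_angle R + 2 * sin (bubble_angle R) < 20 /\
  8 * bubble_angle R + 2 * sin (bubble_angle R) < 2 * (Num.sqrt 8 * (2 * Num.sqrt 3)).
Proof.
have a := bubble_lt R.
have s : sin (bubble_angle R) <= 87 / 100.
  rewrite -ler_sqr ?nnegrE ?divr_ge0//; last exact/ltW/sin_bubble_gt0.
  by rewrite sin_bubble_sqr expr_div_n; lra.
have q : 489 / 100 <= Num.sqrt 8 * Num.sqrt 3 :> R.
  rewrite -sqrtrM// -ler_sqr ?nnegrE ?sqrtr_ge0 ?divr_ge0// sqr_sqrtr ?mulr_ge0//.
  by rewrite expr_div_n; lra.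
by split; [lra|rewrite mulrCA mulrA; lra].
Qed.

End Networks.

(** * Existence of a minimizer *)

Section Limit.
Variables (R : realType) (U : set_system nat).
Hypothesis UU : UltraFilter U.

Let FU : ProperFilter U. Proof. exact: ultra_proper. Qed.
Local Existing Instance FU.

Lemma ultra_cvg_le (a b : nat -> R) (l l' : R) :
  a @ U --> l -> b @ U --> l' -> (forall n, a n <= b n) -> l <= l'.
Proof. by move=> al bl ab; apply: (ler_cvg_to al bl); exact: filterE. Qed.

Lemma ultra_cvg_eq (a b : nat -> R) (l l' : R) :
  a @ U --> l -> b @ U --> l' -> (forall n, a n = b n) -> l = l'.
Proof.
move=> al bl /funext ab; rewrite ab in al.
by rewrite -(cvg_lim (@Rhausdorff R) al) (cvg_lim (@Rhausdorff R) bl).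
Qed.

Lemma ultra_cvg_sqr (a : nat -> R) (l : R) : a @ U --> l -> (fun n => a n ^+ 2) @ U --> l ^+ 2.
Proof. by move=> al; rewrite expr2; under eq_fun do rewrite expr2; exact: cvgM. Qed.

Let cst (c : R) : (fun _ : nat => c) @ U --> c. Proof. exact: cvg_cst. Qed.

(** Lengths, energies, [var], tangents and rescaled positions are uniformly bounded, so limits along
    the ultrafilter exist at every point simultaneously, and continuity of the expressions in
    [valid_curve] does the rest. *)
Lemma valid_curve_limit (D : nat -> curve_data R) (C : R) : 0 <= C ->
  (forall n, valid_curve (D n)) -> (forall n, nrg (D n) <= C) ->
  exists D0, [/\ valid_curve D0, len (D n) @[n --> U] --> len D0,
    nrg (D n) @[n --> U] --> nrg D0,
    (forall x, in01 x -> tx (D n) x @[n --> U] --> tx D0 x /\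
       ty (D n) x @[n --> U] --> ty D0 x) &
    (forall x, in01 x -> px (D n) x @[n --> U] --> px D0 x /\
       py (D n) x @[n --> U] --> py D0 x)].
Proof.
move=> C0 vD nC.
have in0 : in01 (0 : R) by rewrite /in01; lra.
have in1 : in01 (1 : R) by rewrite /in01; lra.
have L0 n := len_ge0 (vD n).
have LC n : len (D n) <= C by apply: le_trans (len_le_nrg (vD n)) (nC n).
have V0 n x : in01 x -> 0 <= var (D n) x.
  by move=> /andP[x0 x1]; rewrite -(var0 (vD n)); exact: (var_nondecr (vD n)).
have V1C n : var (D n) 1 <= C ^+ 2.
  apply: le_trans (var_energy (vD n)) _; rewrite expr2 ler_pM//.
    by rewrite subr_ge0; exact: len_le_nrg.
  by have := L0 n; have := nC n; lra.
have VC n x : in01 x -> `|var (D n) x| <= C ^+ 2.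
  move=> xin; rewrite ger0_norm ?V0//; apply: le_trans (V1C n).
  by move: xin => /andP[x0 x1]; exact: (var_nondecr (vD n)).
have T1 n x : in01 x -> `|tx (D n) x| <= 1 /\ `|ty (D n) x| <= 1.
  move=> xin; have := tangent_unit (vD n) xin => u.
  have sx := sqr_ge0 (tx (D n) x); have sy := sqr_ge0 (ty (D n) x).
  by split; rewrite -ler_sqr ?nnegrE// real_normK ?num_real// expr1n; lra.
(* Positions are bounded through the chord inequality based at 0. *)
have bnd (r x t : R) n : in01 x -> `|t| <= 1 -> (r - x * t) ^+ 2 <= x ^+ 3 * var (D n) 1 -> `|r| <= C + 1.
  move=> /andP[x0 x1] t1 H.
  have K : `|r - x * t| <= C.
    rewrite -ler_sqr ?nnegrE// real_normK ?num_real//; apply: le_trans H _.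
    apply: le_trans (V1C n); rewrite ler_piMl ?V0// exprn_ile1//.
  rewrite (_ : r = (r - x * t) + x * t); last by ring.
  rewrite (le_trans (ler_normD _ _))// lerD// normrM (ger0_norm x0).
  by rewrite mulr_ile1.
have Px n x : in01 x -> `|px (D n) x| <= C + 1.
  move=> /[dup] xin /andP[x0 x1]; apply: (bnd _ x (tx (D n) 0) n xin (T1 n 0 in0).1).
  by have := chord_x (vD n) (lexx 0) x0 x1; rewrite (pos0 (vD n)).1 !subr0.
have Py n x : in01 x -> `|py (D n) x| <= C + 1.
  move=> /[dup] xin /andP[x0 x1]; apply: (bnd _ x (ty (D n) 0) n xin (T1 n 0 in0).2).
  by have := chord_y (vD n) (lexx 0) x0 x1; rewrite (pos0 (vD n)).2 !subr0.
have lim1 (f : nat -> R -> R) M : (forall n x, in01 x -> `|f n x| <= M) ->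
    exists g : R -> R, forall x, in01 x -> f n x @[n --> U] --> g x.
  move=> H.
  have K x : exists l : R, in01 x -> f n x @[n --> U] --> l.
    have [xin|] := boolP (in01 x); last by exists 0.
    by have [l Hl] := ultra_bounded_cvg UU (fun n => H n x xin); exists l.
  by have [g Hg] := choice K; exists g.
have [l Hl] : exists l : R, len (D n) @[n --> U] --> l.
  by apply: (ultra_bounded_cvg UU (M := C)) => n; rewrite ger0_norm.
have [e He] : exists l : R, nrg (D n) @[n --> U] --> l.
  apply: (ultra_bounded_cvg UU (M := C)) => n; rewrite ger0_norm//.
  by apply: le_trans (L0 n) (len_le_nrg (vD n)).
have [fx Hx] := lim1 (fun n => tx (D n)) 1 (fun n x xin => (T1 n x xin).1).
have [fy Hy] := lim1 (fun n => ty (D n)) 1 (fun n x xin => (T1 n x xin).2).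
have [gx Gx] := lim1 (fun n => px (D n)) (C + 1) Px.
have [gy Gy] := lim1 (fun n => py (D n)) (C + 1) Py.
have [v Hv] := lim1 (fun n => var (D n)) (C ^+ 2) VC.
have chord (f p : nat -> R -> R) (g q : R -> R) :
    (forall x, in01 x -> f n x @[n --> U] --> g x) ->
    (forall x, in01 x -> p n x @[n --> U] --> q x) ->
    (forall n x y, 0 <= x -> x <= y -> y <= 1 ->
       (p n y - p n x - (y - x) * f n x) ^+ 2 <= (y - x) ^+ 3 * var (D n) 1) ->
    forall x y, 0 <= x -> x <= y -> y <= 1 ->
       (q y - q x - (y - x) * g x) ^+ 2 <= (y - x) ^+ 3 * v 1.
  move=> Hf Hp H x y x0 xy y1.
  have xin : in01 x by rewrite /in01; lra.
  have yin : in01 y by rewrite /in01; lra.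
  apply: (@ultra_cvg_le (fun n => (p n y - p n x - (y - x) * f n x) ^+ 2)
     (fun n => (y - x) ^+ 3 * var (D n) 1)).
  - apply: ultra_cvg_sqr; apply: cvgB; first by apply: cvgB; exact: Hp.
    by apply: cvgM => //; exact: Hf.
  - by apply: cvgM => //; exact: Hv.
  - by move=> n; exact: H.
exists (CurveData l e fx fy gx gy v); split => //=; last 2 first.
- by move=> x xin; split; [exact: Hx|exact: Hy].
- by move=> x xin; split; [exact: Gx|exact: Gy].
constructor => /=.
- exact: (ultra_cvg_le (@cst 0) Hl L0).
- move=> x xin; apply: (@ultra_cvg_eq (fun n => tx (D n) x ^+ 2 + ty (D n) x ^+ 2) (fun=> 1)) => //.
    by apply: cvgD; apply: ultra_cvg_sqr; [exact: Hx|exact: Hy].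
  by move=> n; exact: tangent_unit.
- by apply: (ultra_cvg_eq (Hv 0 in0) (@cst 0)) => n; exact: var0.
- move=> x y x0 xy y1.
  have xin : in01 x by rewrite /in01; lra.
  have yin : in01 y by rewrite /in01; lra.
  by apply: (ultra_cvg_le (Hv x xin) (Hv y yin)) => n; exact: (var_nondecr (vD n)).
- move=> x y x0 xy y1.
  have xin : in01 x by rewrite /in01; lra.
  have yin : in01 y by rewrite /in01; lra.
  apply: (@ultra_cvg_le (fun n => (tx (D n) y - tx (D n) x) ^+ 2 + (ty (D n) y - ty (D n) x) ^+ 2)
     (fun n => (y - x) * (var (D n) y - var (D n) x))).
  - by apply: cvgD; apply: ultra_cvg_sqr; apply: cvgB; solve [exact: Hx|exact: Hy].
  - by apply: cvgM => //; apply: cvgB; exact: Hv.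
  - by move=> n; exact: tangent_var.
- split; first by apply: (ultra_cvg_eq (Gx 0 in0) (@cst 0)) => n; case: (pos0 (vD n)).
  by apply: (ultra_cvg_eq (Gy 0 in0) (@cst 0)) => n; case: (pos0 (vD n)).
- exact: (chord (fun n => tx (D n)) (fun n => px (D n)) fx gx Hx Gx (fun n => @chord_x _ _ (vD n))).
- exact: (chord (fun n => ty (D n)) (fun n => py (D n)) fy gy Hy Gy (fun n => @chord_y _ _ (vD n))).
- apply: (@ultra_cvg_le (fun n => var (D n) 1) (fun n => len (D n) * (nrg (D n) - len (D n)))).
  - exact: Hv.
  - by apply: cvgM => //; apply: cvgB.
  - by move=> n; exact: var_energy.
- by apply: (ultra_cvg_le Hl He) => n; exact: len_le_nrg.
Qed.

(** Positivity of the lengths can be lost in the limit; the quantitative bound [c] on pairs is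
    carried along because it is a closed condition. *)
Lemma valid_network_limit (D : nat -> 'I_3 -> curve_data R) (C c : R) : 0 <= C ->
  (forall n, valid_network (D n)) -> (forall n i, nrg (D n i) <= C) ->
  (forall n i j, i != j -> c <= Num.max (len (D n i)) (len (D n j))) ->
  exists D0, [/\ valid_network D0,
    (forall i, nrg (D n i) @[n --> U] --> nrg (D0 i)) &
    forall i j, i != j -> c <= Num.max (len (D0 i)) (len (D0 j))].
Proof.
move=> C0 vD nC short.
have in0 : in01 (0 : R) by rewrite /in01; lra.
have in1 : in01 (1 : R) by rewrite /in01; lra.
have [D0 H0] := choice (fun i => valid_curve_limit C0 (fun n => net_curve (vD n) i) (nC^~ i)).
have sum3 (f : nat -> 'I_3 -> R) (g : 'I_3 -> R) :
    (forall i, f n i @[n --> U] --> g i) -> (forall n, \sum_(i < 3) f n i = 0) ->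
    \sum_(i < 3) g i = 0.
  move=> Hf f0; apply: (@ultra_cvg_eq (fun n => \sum_(i < 3) f n i) (fun=> 0)) => //.
  by under eq_fun do rewrite !big_ord_recl big_ord0; rewrite !big_ord_recl big_ord0;
    do 3 (apply: cvgD => //).
exists D0; split.
- constructor.
  + by move=> i; case: (H0 i).
  + move=> i j; have [_ Li _ _ Pi] := H0 i; have [_ Lj _ _ Pj] := H0 j.
    have [Pix Piy] := Pi 1 in1; have [Pjx Pjy] := Pj 1 in1.
    split; apply: (ultra_cvg_eq (cvgM Li _) (cvgM Lj _)); try eassumption;
      by move=> n; case: (net_end (vD n) i j).
  + split; apply: sum3 => [i|n].
    * by have [_ _ _ T _] := H0 i; exact: (T 0 in0).1.
    * by case: (net_tangent0 (vD n)).
    * by have [_ _ _ T _] := H0 i; exact: (T 0 in0).2.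
    * by case: (net_tangent0 (vD n)).
  + split; apply: sum3 => [i|n].
    * by have [_ _ _ T _] := H0 i; exact: (T 1 in1).1.
    * by case: (net_tangent1 (vD n)).
    * by have [_ _ _ T _] := H0 i; exact: (T 1 in1).2.
    * by case: (net_tangent1 (vD n)).
- by move=> i; case: (H0 i).
- move=> i j ij; have [_ Li _ _ _] := H0 i; have [_ Lj _ _ _] := H0 j.
  rewrite leNgt gt_max; apply/negP => /andP[ic jc].
  have Ui : U [set n | len (D n i) < c] by exact: (cvgr_lt _ Li _ ic).
  have Uj : U [set n | len (D n j) < c] by exact: (cvgr_lt _ Lj _ jc).
  have [n /= [ni nj]] := filter_ex (filterI Ui Uj).
  by have := short n i j ij; rewrite leNgt gt_max ni nj.
Qed.

End Limit.

Theorem theorem4p10 (R : realType) :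
  exists G0 : 'I_3 -> R -> 'rV[R]_2,
    theta_network G0 /\
    penalized_energy G0 =
      ereal_inf [set penalized_energy G | G in [set G | theta_network G]].
Proof.
set S := [set _ | _ in _].
have S0 e : S e -> (0 <= e)%E by move=> [G _ <-]; exact: penalized_energy_ge0.
have [Db [vDb Lb Eb]] := bubble_network R.
have [Gb thGb EGb] := data_theta_network vDb Lb.
rewrite Eb in EGb; have [B20 Bloop] := bubble_energy_lt R.
set B := _ + _ in EGb B20 Bloop.
(* Comparison with the double bubble makes the infimum finite and puts it below the energy of two
   loops. *)
have infB : (ereal_inf S <= B%:E)%E.
  by apply: le_trans EGb; apply: ereal_inf_lbound; exists Gb.
have inf0 : (0 <= ereal_inf S)%E by exact: le_ereal_inf_tmp.
have inf_fin : ereal_inf S \is a fin_num.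
  by rewrite ge0_fin_numE// (le_lt_trans infB)// ltry.
pose m := fine (ereal_inf S).
have mE : ereal_inf S = m%:E by rewrite /m fineK.
have mB : m <= B by rewrite -lee_fin -mE.
have pick n : exists D : 'I_3 -> curve_data R,
    [/\ valid_network D, forall i, 0 < len (D i) &
     \sum_(i < 3) nrg (D i) <= m + n.+1%:R^-1].
  have e0 : (0 : R) < n.+1%:R^-1 by rewrite invr_gt0.
  have [e [G thG <-] eE] := lb_ereal_inf_adherent e0 inf_fin.
  have fin : (penalized_energy G < +oo)%E.
    by apply: lt_trans eE _; rewrite mE -EFinD ltry.
  have [D [vD L0 EG]] := theta_network_data thG fin.
  by exists D; split => //; rewrite -lee_fin -EG EFinD -mE; exact: ltW.
have [D HD] := choice pick.
have vD n : valid_network (D n) by case: (HD n).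
have L0 n i : 0 < len (D n i) by case: (HD n).
have ED n : \sum_(i < 3) nrg (D n i) <= m + n.+1%:R^-1 by case: (HD n).
have i1 n : n.+1%:R^-1 <= 1 :> R by rewrite invf_le1// ler1n.
(* The infimum is below 20 and the excess at most 1; 21 is the bound under which [network_two_short]
   yields 1/100. *)
have E21 n : \sum_(i < 3) nrg (D n i) <= 21.
  apply: le_trans (ED n) _; rewrite (_ : 21 = 20 + 1); last by ring.
  by rewrite lerD// (le_trans mB)// ltW.
have n0 n i : 0 <= nrg (D n i).
  by apply: le_trans (len_le_nrg (net_curve (vD n) i)); exact/ltW/L0.
have nC n i : nrg (D n i) <= 21.
  apply: le_trans (E21 n); rewrite (bigD1 i)//= lerDl; apply: sumr_ge0 => j _; exact: n0.
have short n i j : i != j -> 1 / 100 <= Num.max (len (D n i)) (len (D n j)).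
  by move=> ij; exact: network_two_short.
have [U [UU oU]] := free_ultrafilter.
have [D0 [vD0 nrg0 short0]] := valid_network_limit UU (ler0n R 21) vD nC short.
have FU : ProperFilter U := ultra_proper.
have Em : \sum_(i < 3) nrg (D0 i) <= m.
  have cl : \sum_(i < 3) nrg (D n i) @[n --> U] --> \sum_(i < 3) nrg (D0 i).
    by under eq_fun do rewrite !big_ord_recl big_ord0; rewrite !big_ord_recl big_ord0;
      do 3 (apply: cvgD => //); exact: cvg_cst.
  have cr : m + n.+1%:R^-1 @[n --> U] --> m.
    rewrite -[X in _ --> X]addr0; apply: cvgD; first exact: cvg_cst.
    by apply: cvg_trans (@cvg_harmonic R); exact: cvg_app.
  by apply: (ultra_cvg_le UU cl cr) => n; exact: ED.
(* Since m <= B and B is strictly below the energy of two loops, the limit has no vanishing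
   curve. *)
have L00 := network_nondegenerate vD0 short0 (le_lt_trans Em (le_lt_trans mB Bloop)).
have [G0 thG0 EG0] := data_theta_network vD0 L00.
exists G0; split => //; apply/eqP; rewrite eq_le; apply/andP; split.
  by apply: le_trans EG0 _; rewrite mE lee_fin.
by apply: ereal_inf_lbound; exists G0.
Qed.
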